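(* Let $(\mathfrak{J},\mathfrak{M})$ be a $\mathfrak{J}$-ternary superalgebra. Then $\mathrm{TAG}(\mathfrak{J},\mathfrak{M})$ is a short $\mathfrak{sl}_2$-Lie superalgebra, where $$\mathrm{TAG}(\mathfrak{J},\mathfrak{M})=\mathfrak{sl}_2\otimes\mathfrak{J}\ \oplus\ V\otimes\mathfrak{M}\ \oplus\ \mathfrak{B}^s(\mathfrak{J},\mathfrak{M}),$$ $\mathfrak{sl}_2$ acts through the first tensor factors and trivially on $\mathfrak{B}^s(\mathfrak{J},\mathfrak{M})$, and the (super-anticommutative) bracket is given, for $x,y\in\mathfrak{sl}_2$, $v,w\in V$, $a,b,c,d\in\mathfrak{J}$, $m,n,r,s\in\mathfrak{M}$, by $$[\{a\otimes b\},\{c\otimes d\}]=\langle a,b\rangle(\{c\otimes d\}),\quad[\{a\otimes b\},\{m\otimes n\}]=\langle a,b\rangle(\{m\otimes n\}),\quad[\{m\otimes n\},\{r\otimes s\}]=\partial_{m,n}(\{r\otimes s\}),$$ $$[\{a\otimes b\},x\otimes c]=x\otimes\langle a,b\rangle(c),\quad[\{m\otimes n\},x\otimes c]=x\otimes\partial_{m,n}(c),$$ $$[\{a\otimes b\},v\otimes m]=v\otimes\langle a,b\rangle(m),\quad[\{m\otimes n\},v\otimes r]=v\otimes\partial_{m,n}(r),$$ $$[x\otimes a,y\otimes b]=[x,y]\otimes a\cdot b+\tfrac12\kappa(x,y)\{a\otimes b\},\quad[x\otimes a,v\otimes m]=x(v)\otimes a\bullet m,$$ $$[v\otimes m,w\otimes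 n]=(v\odot w)\otimes m\star n+\det(v,w)\{m\otimes n\}.$$
   Context: Everything is over $\mathbb{C}$; superspaces are $\mathbb{Z}_2$-graded. $\mathfrak{sl}_2=\mathfrak{sl}_2(\mathbb{C})$ has standard basis $e,f,h$; $V=\mathbb{C}e_1\oplus\mathbb{C}e_2$ is its natural representation; both have even degree. $\kappa(x,y)=4\,\mathrm{tr}(xy)$; $\det:V\otimes V\to\mathbb{C}$ is the determinant form; $\odot:V\otimes V\to\mathfrak{sl}_2$ is bilinear with $e_1\odot e_1=e$, $e_1\odot e_2=e_2\odot e_1=-\tfrac12h$, $e_2\odot e_2=-f$. A short $\mathfrak{sl}_2$-Lie superalgebra is a Lie superalgebra on which $\mathfrak{sl}_2$ acts by even derivations and which as $\mathfrak{sl}_2$-module is of the form $\mathfrak{sl}_2\otimes\mathfrak{J}\oplus V\otimes\mathfrak{M}\oplus\mathfrak{D}$ with $\mathfrak{J},\mathfrak{M},\mathfrak{D}$ superspaces with trivial $\mathfrak{sl}_2$-action. A Jordan superalgebra is a superspace $\mathfrak{J}$ with an even product satisfying $a\cdot b=(-1)^{|a||b|}b\cdot a$ and $(a\cdot b)\cdot(c\cdot d)+(-1)^{|b||c|}(a\cdot c)\cdot(b\cdot d)+(-1)^{|b||d|+|c||d|}(a\cdot d)\cdot(b\cdot c)=((a\cdot b)\cdot c)\cdot d+(-1)^{|b||c|+|b||d|+|c||d|}((a\cdot d)\cdot c)\cdot b+(-1)^{|a||b|+|a||c|+|a||d|+|c||d|}((b\cdot d)\cdot c)\cdot a$. A special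 $\mathfrak{J}$-supermodule is a superspace $\mathfrak{M}$ with an even bilinear $\bullet:\mathfrak{J}\otimes\mathfrak{M}\to\mathfrak{M}$ such that $(a\cdot b)\bullet m=\tfrac12(a\bullet(b\bullet m)+(-1)^{|a||b|}b\bullet(a\bullet m))$. A $\mathfrak{J}$-ternary superalgebra $(\mathfrak{J},\mathfrak{M})$ consists of a Jordan superalgebra $(\mathfrak{J},\cdot)$, a special $\mathfrak{J}$-supermodule $(\mathfrak{M},\bullet)$, an even super-anticommutative bilinear map $\star:\mathfrak{M}\otimes\mathfrak{M}\to\mathfrak{J}$ ($m\star n=-(-1)^{|m||n|}n\star m$) and an even trilinear product $(-,-,-):\mathfrak{M}^{\otimes3}\to\mathfrak{M}$ such that for all homogeneous $a\in\mathfrak{J}$, $m,n,r,s,t\in\mathfrak{M}$: (SJT1) $a\cdot(m\star n)=\tfrac12((a\bullet m)\star n+(-1)^{|a||m|}m\star(a\bullet n))$; (SJT2) $a\bullet(m,n,s)=(a\bullet m,n,s)-(-1)^{|a||m|}(m,a\bullet n,s)+(-1)^{|a|(|m|+|n|)}(m,n,a\bullet s)$; (SJT3) $(m,n,s)=(-1)^{|m|(|n|+|s|)+|n||s|}(s,n,m)-(-1)^{|n||s|}(m\star s)\bullet n$; (SJT4) $(m,n,s)=(-1)^{|m||n|}(n,m,s)+(m\star n)\bullet s$; (SJT5) $(m,n,r)\star s+(-1)^{|r|(|m|+|n|)}r\star(m,n,s)=(-1)^{|n|(|r|+|s|)}m\star((r\star s)\bullet n)$; (SJT6) $(m,n,(r,s,t))=((m,n,r),s,t)+(-1)^{|r|(|m|+|n|)+|m||n|}(r,(n,m,s),t)+(-1)^{(|m|+|n|)(|r|+|s|)}(r,s,(m,n,t))$.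 For homogeneous $a,b,c\in\mathfrak{J}$, $m,n,r\in\mathfrak{M}$, the endomorphisms $\langle a,b\rangle,\partial_{m,n}\in\mathrm{End}(\mathfrak{J}\oplus\mathfrak{M})$ are defined by $\langle a,b\rangle(c)=a\cdot(b\cdot c)-(-1)^{|a||b|}b\cdot(a\cdot c)$, $\langle a,b\rangle(m)=\tfrac14(a\bullet(b\bullet m)-(-1)^{|a||b|}b\bullet(a\bullet m))$, $\partial_{m,n}(a)=\tfrac12((-1)^{|a|(|m|+|n|)}(a\bullet m)\star n-(-1)^{|a||n|}m\star(a\bullet n))$, $\partial_{m,n}(r)=\tfrac12(m\star n)\bullet r-(m,n,r)$. $\mathrm{InnDer}(\mathfrak{J},\mathfrak{M})$ is their linear span, a Lie superalgebra under the supercommutator. $\mathfrak{B}^s(\mathfrak{J},\mathfrak{M})=(\mathfrak{J}\otimes\mathfrak{J}\oplus\mathfrak{M}\otimes\mathfrak{M})/R^s(\mathfrak{J},\mathfrak{M})$, where $R^s(\mathfrak{J},\mathfrak{M})$ is spanned by the following elements, for homogeneous $a,b,c\in\mathfrak{J}$, $m,n,r,s\in\mathfrak{M}$: $I_{a,b}=a\otimes b+(-1)^{|a||b|}b\otimes a$; $I_{m,n}=m\otimes n-(-1)^{|m||n|}n\otimes m$; $I_{a,b,c}=(-1)^{|a||c|}(a\cdot b)\otimes c+(-1)^{|a||b|}(b\cdot c)\otimes a+(-1)^{|b||c|}(c\cdot a)\otimes b$; $I_{a,m,n}=(a\bullet m)\otimes n-(-1)^{|a||m|}m\otimes(a\bullet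 n)-(-1)^{|a|(|m|+|n|)}2(m\star n)\otimes a$; $I_{m,n,r,s}=\partial_{m,n}(r)\otimes s+(-1)^{(|m|+|n|)|r|}r\otimes\partial_{m,n}(s)+(-1)^{(|m|+|n|)(|r|+|s|)}\partial_{r,s}(m)\otimes n+(-1)^{(|r|+|s|)|n|}m\otimes\partial_{r,s}(n)$. The class of $a\otimes b$ is $\{a\otimes b\}$, that of $m\otimes n$ is $\{m\otimes n\}$. $\mathrm{InnDer}(\mathfrak{J},\mathfrak{M})$ acts on $\mathfrak{B}^s(\mathfrak{J},\mathfrak{M})$ by $D(\{z_1\otimes z_2\})=\{D(z_1)\otimes z_2\}+(-1)^{|D||z_1|}\{z_1\otimes D(z_2)\}$. *)

(* Defs.v *)
From HB Require Import structures.
From mathcomp Require Import all_boot all_order all_algebra.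
From mathcomp Require Import boolp reals.
From mathcomp.real_closed Require Import complex.
From mathcomp.multinomials Require Import freeg.

Set Implicit Arguments.
Unset Strict Implicit.
Unset Printing Implicit Defensive.

Import GRing.Theory.
Local Open Scope ring_scope.
Local Open Scope quotient_scope.

(* Parities are booleans, [addb] (written (+)) being their sum.  Signs are
   written [sgn K n] with n a natural number built from parities through the
   coercion bool >-> nat, so that the exponents can be read as in the
   textbook formulas. *)
Definition sgn (K : fieldType) (n : nat) : K := (-1) ^+ n.
Arguments sgn K n%_N.

Definition bilin (K : fieldType) (U V W : lmodType K) (f : U -> V -> W) : Prop :=
  (forall v, linear (f^~ v)) /\ (forall u, linear (f u)).

(* A vector space V = V_0 ⊕ V_1; [homog p] is the subspace of parity p. *)
Record superspace (K : fieldType) := Superspace {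
  ss_sort :> lmodType K;
  homog : bool -> ss_sort -> Prop;
  homog0 : forall p, homog p 0;
  homog_lin : forall p k u v, homog p u -> homog p v -> homog p (k *: u + v);
  homog_dec : forall v, exists u0 u1,
    [/\ homog false u0, homog true u1 & v = u0 + u1];
  homog_cap : forall v, homog false v -> homog true v -> v = 0 }.
Arguments homog {K s}.

Definition even_linear (K : fieldType) (U V : superspace K) (f : U -> V) : Prop :=
  linear f /\ forall p u, homog p u -> homog p (f u).

Definition even_bilinear (K : fieldType) (U V W : superspace K)
    (f : U -> V -> W) : Prop :=
  bilin f /\
  forall p q u v, homog p u -> homog q v -> homog (p (+) q) (f u v).

Section Components.
Variables (K : fieldType) (V : superspace K).
Implicit Types (u v : V) (p : bool).

Lemma homogD p u v : homog p u -> homog p v -> homog p (u + v).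
Proof. by move=> hu hv; rewrite -[u]scale1r; exact: homog_lin. Qed.

Lemma homogZ p k u : homog p u -> homog p (k *: u).
Proof. by move=> hu; rewrite -[_ *: _]addr0; exact: homog_lin (homog0 _ _). Qed.

Lemma homogN p u : homog p u -> homog p (- u).
Proof. by move=> hu; rewrite -scaleN1r; exact: homogZ. Qed.

Lemma homogB p u v : homog p u -> homog p v -> homog p (u - v).
Proof. by move=> hu hv; apply: homogD => //; exact: homogN. Qed.

Lemma comp_subproof v : exists u : V * V,
  [/\ homog false u.1, homog true u.2 & v = u.1 + u.2].
Proof. by have [u0 [u1 h]] := homog_dec v; exists (u0, u1). Qed.

(* The component of parity p of v. *)
Definition comp p v : V :=
  let u := projT1 (cid (comp_subproof v)) in if p then u.2 else u.1.

Lemma comp_homog p v : homog p (comp p v).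
Proof. by rewrite /comp; case: cid => u [? ? ?]; case: p. Qed.

Lemma compE v : v = comp false v + comp true v.
Proof. by rewrite /comp; case: cid => u [? ? ?]. Qed.

Lemma comp_uniq u0 u1 v : homog false u0 -> homog true u1 -> v = u0 + u1 ->
  comp false v = u0 /\ comp true v = u1.
Proof.
move=> h0 h1 E.
have D : comp false v - u0 = u1 - comp true v.
  by apply/eqP; rewrite subr_eq addrAC eq_sym subr_eq [u1 + u0]addrC -E -compE.
have Z : comp false v - u0 = 0.
  apply: homog_cap; first exact: homogB (comp_homog _ _) h0.
  by rewrite D; exact: homogB h1 (comp_homog _ _).
by split; apply/eqP; [rewrite -subr_eq0 Z|rewrite eq_sym -subr_eq0 -D Z].
Qed.

Lemma comp_linear p : linear (comp p).
Proof.
move=> k u v.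
have [|||E0 E1] := @comp_uniq (k *: comp false u + comp false v)
  (k *: comp true u + comp true v) (k *: u + v).
- by apply: homog_lin; exact: comp_homog.
- by apply: homog_lin; exact: comp_homog.
- by rewrite {1}[u]compE {1}[v]compE scalerDr addrACA.
by case: p.
Qed.

Lemma comp_id p v : homog p v -> comp p v = v.
Proof.
move=> hv; case: p hv => hv.
  by have [] := comp_uniq (homog0 _ _) hv (esym (add0r _)).
by have [] := comp_uniq hv (homog0 _ _) (esym (addr0 _)).
Qed.

Lemma comp_0 p v : homog (~~ p) v -> comp p v = 0.
Proof.
move=> hv; case: p hv => hv.
  by have [] := comp_uniq hv (homog0 _ _) (esym (addr0 _)).
by have [] := comp_uniq (homog0 _ _) hv (esym (add0r _)).
Qed.

End Components.

Section PurelyEven.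
Variables (K : fieldType) (V : lmodType K).

(* V concentrated in even degree: only 0 is odd. *)
Definition even_homog (p : bool) (v : V) : Prop := p -> v = 0.

Fact even_homog0 p : even_homog p 0. Proof. by []. Qed.
Fact even_homog_lin p k u v :
  even_homog p u -> even_homog p v -> even_homog p (k *: u + v).
Proof. by move=> hu hv hp; rewrite hu // hv // scaler0 addr0. Qed.
Fact even_homog_dec v : exists u0 u1,
  [/\ even_homog false u0, even_homog true u1 & v = u0 + u1].
Proof. by exists v, 0; split=> //; rewrite addr0. Qed.
Fact even_homog_cap v : even_homog false v -> even_homog true v -> v = 0.
Proof. by move=> _ ->. Qed.

Definition purely_even : superspace K :=
  Superspace even_homog0 even_homog_lin even_homog_dec even_homog_cap.

End PurelyEven.

Section DirectSum.
Variables (K : fieldType) (U V : superspace K).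

Definition dsum_homog (p : bool) (x : U * V) : Prop :=
  homog p x.1 /\ homog p x.2.

Fact dsum_homog0 p : dsum_homog p 0.
Proof. by split; exact: homog0. Qed.
Fact dsum_homog_lin p k x y :
  dsum_homog p x -> dsum_homog p y -> dsum_homog p (k *: x + y).
Proof. by move=> [? ?] [? ?]; split; exact: homog_lin. Qed.
Fact dsum_homog_dec x : exists u0 u1,
  [/\ dsum_homog false u0, dsum_homog true u1 & x = u0 + u1].
Proof.
exists (comp false x.1, comp false x.2), (comp true x.1, comp true x.2).
split; try by split; exact: comp_homog.
by case: x => u v /=; congr pair; exact: compE.
Qed.
Fact dsum_homog_cap x : dsum_homog false x -> dsum_homog true x -> x = 0.
Proof. by case: x => u v [/= ? ?] [/= ? ?]; congr pair; exact: homog_cap. Qed.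

Definition dsum : superspace K :=
  Superspace dsum_homog0 dsum_homog_lin dsum_homog_dec dsum_homog_cap.

End DirectSum.

Section Span.
Variables (K : fieldType) (V : lmodType K).

Definition span (S : V -> Prop) (v : V) : Prop :=
  exists s : seq (K * V),
    (forall x, x \in s -> S x.2) /\ v = \sum_(x <- s) x.1 *: x.2.

Variable S : V -> Prop.

Lemma span_gen v : S v -> span S v.
Proof.
move=> Sv; exists [:: (1, v)]; split; last by rewrite big_seq1 scale1r.
by move=> x; rewrite inE => /eqP ->.
Qed.

Lemma span0 : span S 0.
Proof. by exists [::]; rewrite big_nil. Qed.

Lemma span_lin k u v : span S u -> span S v -> span S (k *: u + v).
Proof.
move=> [s [Ss ->]] [t [St ->]]; exists ([seq (k * x.1, x.2) | x <- s] ++ t).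
split=> [x|].
  by rewrite mem_cat => /orP[/mapP[y /Ss Sy ->]|/St].
rewrite big_cat big_map /= scaler_sumr; congr (_ + _).
by apply: eq_bigr => x _; rewrite scalerA.
Qed.

Lemma span_ind (P : V -> Prop) : P 0 ->
  (forall k u v, S u -> P v -> P (k *: u + v)) -> forall v, span S v -> P v.
Proof.
move=> P0 PD v [s [Ss ->]]; elim: s Ss => [|x s IH] Ss; first by rewrite big_nil.
rewrite big_cons; apply: PD; first by apply: Ss; rewrite mem_head.
by apply: IH => y ys; apply: Ss; rewrite inE ys orbT.
Qed.

Definition spanb : {pred V} := fun v => `[< span S v >].

Lemma spanbP v : reflect (span S v) (v \in spanb).
Proof. exact: asboolP. Qed.

Fact spanb_submod : submod_closed spanb.
Proof.
split; first by apply/spanbP; exact: span0.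
by move=> k u v /spanbP hu /spanbP hv; apply/spanbP; exact: span_lin.
Qed.
HB.instance Definition _ := GRing.isSubmodClosed.Build K V spanb spanb_submod.

End Span.

Section QuotientModule.
Variables (K : fieldType) (V : lmodType K) (S : V -> Prop).

(* The quotient of V by the linear span of S. *)
Definition quotmod := Quotient.quot (spanb S).
HB.instance Definition _ := GRing.Zmodule.on quotmod.

Definition qclass (v : V) : quotmod := \pi_(quotmod) v.

Lemma qclassP u v : qclass u = qclass v <-> span S (u - v).
Proof.
rewrite /qclass; split.
  by move/eqP; rewrite -Quotient.idealrBE => /spanbP.
by move=> h; apply/eqP; rewrite -Quotient.idealrBE; apply/spanbP.
Qed.

Lemma qclass_repr q : qclass (repr q) = q.
Proof. by rewrite /qclass reprK. Qed.

Lemma qclassD : {morph qclass : u v / u + v}.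
Proof. by move=> u v; rewrite /qclass !piE. Qed.

Definition qscale (k : K) (q : quotmod) : quotmod := qclass (k *: repr q).

Lemma qscaleE k v : qscale k (qclass v) = qclass (k *: v).
Proof.
apply/qclassP; rewrite -scalerBr -[_ *: _]addr0.
apply: span_lin (span0 _); apply/qclassP; exact: qclass_repr.
Qed.

Fact qscaleA a b q : qscale a (qscale b q) = qscale (a * b) q.
Proof. by rewrite -(qclass_repr q) !qscaleE scalerA. Qed.
Fact qscale1 : left_id 1 qscale.
Proof. by move=> q; rewrite -(qclass_repr q) qscaleE scale1r. Qed.
Fact qscaleDr : right_distributive qscale +%R.
Proof.
move=> k q r; rewrite -(qclass_repr q) -(qclass_repr r) -qclassD !qscaleE.
by rewrite -qclassD scalerDr.
Qed.
Fact qscaleDl q : {morph qscale^~ q : a b / a + b}.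
Proof. by move=> a b; rewrite -(qclass_repr q) !qscaleE -qclassD scalerDl. Qed.

HB.instance Definition _ :=
  GRing.Zmodule_isLmodule.Build K quotmod qscaleA qscale1 qscaleDr qscaleDl.

Lemma qclass_linear : linear qclass.
Proof. by move=> k u v; rewrite qclassD; congr (_ + _); rewrite -qscaleE. Qed.

Lemma qclass0 : qclass 0 = 0.
Proof. by apply: (addrI (qclass 0)); rewrite -qclassD !addr0. Qed.

Lemma qlift_linear (T : lmodType K) (f : V -> T) : linear f ->
  (forall s, S s -> f s = 0) ->
  linear (f \o (repr : quotmod -> V)) /\
  forall v, f (repr (qclass v)) = f v.
Proof.
move=> flin fS.
have f0 : f 0 = 0.
  by apply: (addrI (f 0)); rewrite -{1}[f 0]scale1r -flin scaler0 !addr0.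
have fB u v : f (u - v) = f u - f v.
  by rewrite addrC -scaleN1r flin scaleN1r addrC.
have fspan v : span S v -> f v = 0.
  by apply: (span_ind (P := fun v => f v = 0)) => // k u w Su fw; rewrite flin fw fS // scaler0 addr0.
have E v : f (repr (qclass v)) = f v.
  have /qclassP/fspan := qclass_repr (qclass v).
  by rewrite fB => /eqP; rewrite subr_eq0 => /eqP.
split=> // k q r /=.
by rewrite -flin -[in LHS](qclass_repr q) -[in LHS](qclass_repr r)
  -qclass_linear E.
Qed.

End QuotientModule.

Section QuotientSuperspace.
Variables (K : fieldType) (V : superspace K) (S : V -> Prop).
Hypothesis S_homog : forall s, S s -> exists p, homog p s.

Definition quot_homog (p : bool) (q : quotmod S) : Prop :=
  exists2 v, homog p v & q = qclass S v.

Fact quot_homog0 p : quot_homog p 0.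
Proof.
by exists 0; [exact: homog0|rewrite qclass0].
Qed.
Fact quot_homog_lin p k q r :
  quot_homog p q -> quot_homog p r -> quot_homog p (k *: q + r).
Proof.
move=> [u hu ->] [v hv ->]; exists (k *: u + v); first exact: homog_lin.
by rewrite qclass_linear.
Qed.
Fact quot_homog_dec q : exists u0 u1,
  [/\ quot_homog false u0, quot_homog true u1 & q = u0 + u1].
Proof.
exists (qclass S (comp false (repr q))), (qclass S (comp true (repr q))).
split; [by exists (comp false (repr q)); [exact: comp_homog|]|
  by exists (comp true (repr q)); [exact: comp_homog|]|].
by rewrite -qclassD -compE qclass_repr.
Qed.

Lemma span_comp p v : span S v -> span S (comp p v).
Proof.
have c0 : comp p (0 : V) = 0 by apply: comp_id; exact: homog0.
apply: (span_ind (P := fun v => span S (comp p v))) => [|k u w Su IH]; first by rewrite c0; exact: span0.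
rewrite comp_linear; apply: span_lin IH.
have [p' hu] := S_homog Su; have [E|N] := eqVneq p p'.
  by rewrite E comp_id //; exact: span_gen.
rewrite comp_0; first exact: span0.
by case: p p' N hu {c0} => -[].
Qed.

Fact quot_homog_cap q : quot_homog false q -> quot_homog true q -> q = 0.
Proof.
move=> [u hu ->] [v hv /qclassP h].
have := span_comp false h.
have E : u - v = (-1) *: v + u by rewrite scaleN1r addrC.
rewrite E comp_linear (comp_id hu) (@comp_0 _ _ false v hv) scaler0 add0r => hs.
by rewrite -qclass0; apply/qclassP; rewrite subr0.
Qed.

Definition quot_superspace : superspace K :=
  Superspace quot_homog0 quot_homog_lin quot_homog_dec quot_homog_cap.

End QuotientSuperspace.

Section TensorProduct.
Variables (K : fieldType) (U W : lmodType K).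

Definition tensor_gen (u : U) (w : W) : {freeg (U * W)%type / K} := << (u, w) >>.

Inductive tensor_rel : {freeg (U * W)%type / K} -> Prop :=
| TensorRelL k u u' w : tensor_rel
    (tensor_gen (k *: u + u') w - (k *: tensor_gen u w + tensor_gen u' w))
| TensorRelR k u w w' : tensor_rel
    (tensor_gen u (k *: w + w') - (k *: tensor_gen u w + tensor_gen u w')).

Definition tensor_mod := quotmod tensor_rel.
HB.instance Definition _ := GRing.Lmodule.on tensor_mod.

Definition tensor (u : U) (w : W) : tensor_mod := qclass tensor_rel (tensor_gen u w).

(* The linear map induced by f, meaningful only for bilinear f, see
   [tensor_liftP]. *)
Definition tensor_lift (T : lmodType K) (f : U -> W -> T) (t : tensor_mod) : T :=
  fglift (fun x : U * W => f x.1 x.2) (repr t).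

Lemma tensor_bilin : bilin tensor.
Proof.
by split=> [w k u u'|u k w w']; rewrite /tensor -qclass_linear; apply/qclassP/span_gen;
  constructor.
Qed.

Lemma fglift_linear (X : choiceType) (T : lmodType K) (f : X -> T) :
  linear (fglift f : {freeg X / K} -> T).
Proof.
have fgB := lift_is_additive f.
have fg0 : fglift f 0 = 0 by rewrite -(subrr (0 : {freeg X / K})) fgB subrr.
have fgD (D E : {freeg X / K}) : fglift f (D + E) = fglift f D + fglift f E.
  by rewrite -{1}[E]opprK fgB -[- E]add0r fgB fg0 sub0r opprK.
have fgS (r : seq X) (c : X -> K) :
    fglift f (\sum_(x <- r) << c x *g x >>) = \sum_(x <- r) c x *: f x.
  by elim/big_rec2: _ => // x y1 y2 _ <-; rewrite fgD liftU.
move=> k D E; rewrite fgD; congr (_ + _).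
rewrite [k *: D]/(fgscale k D) /fgscale fgS -[in RHS](freeg_sumE D) fgS scaler_sumr.
by apply: eq_bigr => x _; rewrite scalerA.
Qed.

Lemma tensor_liftP (T : lmodType K) (f : U -> W -> T) : bilin f ->
  linear (tensor_lift f) /\ forall u w, tensor_lift f (tensor u w) = f u w.
Proof.
move=> [fl fr]; pose g := fun x : U * W => f x.1 x.2.
have glin := fglift_linear g.
have gE u w : fglift g (tensor_gen u w) = f u w by rewrite liftU scale1r.
have gB D E : fglift g (D - E) = fglift g D - fglift g E by exact: lift_is_additive.
have [] := @qlift_linear _ _ tensor_rel _ _ glin.
  by move=> _ [] *; rewrite gB glin !gE ?fl ?fr subrr.
by move=> L E; split=> // u w; rewrite /tensor_lift E gE.
Qed.

Lemma tensor_span t : span (fun t => exists u w, t = tensor u w) t.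
Proof.
rewrite -(qclass_repr t) -(freeg_sumE (repr t)).
elim/big_rec: _ => [|x y _ IH]; first by rewrite qclass0; exact: span0.
have -> : << coeff x (repr t) *g x >> = coeff x (repr t) *: tensor_gen x.1 x.2.
  apply/eqP/freeg_eqP => z; rewrite coeffZ !coeffU mul1r -surjective_pairing //.
rewrite qclass_linear; apply: span_lin IH; apply: span_gen.
by exists x.1, x.2.
Qed.

End TensorProduct.

Notation "u ⊗ w" := (tensor u w) (at level 40, left associativity).

Section TensorSuperspace.
Variables (K : fieldType) (U W : superspace K).

Definition tensor_homog (p : bool) : tensor_mod U W -> Prop :=
  span (fun t => exists q r u w,
    [/\ homog q u, homog r w, q (+) r = p & t = u ⊗ w]).

Fact tensor_homog0 p : tensor_homog p 0.
Proof. exact: span0. Qed.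
Fact tensor_homog_lin p k s t :
  tensor_homog p s -> tensor_homog p t -> tensor_homog p (k *: s + t).
Proof. exact: span_lin. Qed.

Lemma tensor_homog_gen q r (u : U) (w : W) :
  homog q u -> homog r w -> tensor_homog (q (+) r) (u ⊗ w).
Proof. by move=> hu hw; apply: span_gen; exists q, r, u, w. Qed.

Lemma tensorDl (u u' : U) (w : W) : (u + u') ⊗ w = u ⊗ w + u' ⊗ w.
Proof. by rewrite -[u]scale1r (tensor_bilin U W).1 !scale1r. Qed.
Lemma tensorDr (u : U) (w w' : W) : u ⊗ (w + w') = u ⊗ w + u ⊗ w'.
Proof. by rewrite -[w]scale1r (tensor_bilin U W).2 !scale1r. Qed.
Lemma tensor0l (w : W) : (0 : U) ⊗ w = 0.
Proof. by apply: (addrI (0 ⊗ w)); rewrite -tensorDl !addr0. Qed.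
Lemma tensor0r (u : U) : u ⊗ (0 : W) = 0.
Proof. by apply: (addrI (u ⊗ 0)); rewrite -tensorDr !addr0. Qed.

Fact tensor_homog_dec t : exists t0 t1,
  [/\ tensor_homog false t0, tensor_homog true t1 & t = t0 + t1].
Proof.
have := tensor_span t; move: t.
apply: (span_ind (P := fun t => exists t0 t1,
  [/\ tensor_homog false t0, tensor_homog true t1 & t = t0 + t1])).
  by exists 0, 0; split; rewrite ?addr0 //; exact: tensor_homog0.
move=> k _ t [u [w ->]] [t0 [t1 [h0 h1 ->]]].
pose c p q := comp p u ⊗ comp q w.
have hc p q : tensor_homog (p (+) q) (c p q).
  by apply: tensor_homog_gen; exact: comp_homog.
exists (k *: c false false + (k *: c true true + t0)),
       (k *: c false true + (k *: c true false + t1)).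
split.
- by apply: tensor_homog_lin (hc false false) _; exact: tensor_homog_lin (hc true true) h0.
- by apply: tensor_homog_lin (hc false true) _; exact: tensor_homog_lin (hc true false) h1.
have -> : u ⊗ w = c false false + c false true + (c true false + c true true).
  by rewrite {1}[u]compE {1}[w]compE tensorDl !tensorDr.
rewrite !scalerDr.
rewrite [RHS]addrACA [X in _ = _ + X]addrACA.
by rewrite [X in _ = _ + (X + _)]addrC [RHS]addrA.
Qed.

Definition tensor_proj p (u : U) (w : W) : tensor_mod U W :=
  comp false u ⊗ comp p w + comp true u ⊗ comp (~~ p) w.

Lemma tensor_proj_bilin p : bilin (tensor_proj p).
Proof.
have [tl tr] := tensor_bilin U W.
by split=> [w k u u'|u k w w'];
  rewrite /tensor_proj !comp_linear ?tl ?tr scalerDr addrACA.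
Qed.

Lemma tensor_projE p q r (u : U) (w : W) : homog q u -> homog r w ->
  tensor_proj p u w = if q (+) r == p then u ⊗ w else 0.
Proof.
move=> hu hw; rewrite /tensor_proj.
have cu b : comp b u = if b == q then u else 0.
  by case: eqP => [->|/eqP N]; [exact: comp_id|apply: comp_0; case: b q N hu => -[]].
have cw b : comp b w = if b == r then w else 0.
  by case: eqP => [->|/eqP N]; [exact: comp_id|apply: comp_0; case: b r N hw => -[]].
by rewrite !cu !cw; case: p q r {hu hw cu cw} => -[] [];
  rewrite /= ?tensor0l ?tensor0r ?addr0 ?add0r.
Qed.

Lemma tensor_lift_proj p q t : tensor_homog q t ->
  tensor_lift (tensor_proj p) t = if q == p then t else 0.
Proof.
have [L E] := tensor_liftP (tensor_proj_bilin p).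
have L0 : tensor_lift (tensor_proj p) 0 = 0.
  by rewrite -[X in tensor_lift _ X](tensor0l 0) E
    (tensor_projE _ (homog0 _ false) (homog0 _ false)) tensor0l if_same.
move: t; apply: (span_ind
  (P := fun t => tensor_lift (tensor_proj p) t = if q == p then t else 0)).
  by rewrite if_same.
move=> k _ t [i [j [u [w [hu hw <- ->]]]]] IH.
rewrite L IH E (tensor_projE _ hu hw).
by case: ifP => // _; rewrite scaler0 addr0.
Qed.

Fact tensor_homog_cap t : tensor_homog false t -> tensor_homog true t -> t = 0.
Proof.
by move=> /(tensor_lift_proj false)/= + /(tensor_lift_proj false)/= => -> <-.
Qed.

Definition tensor_superspace : superspace K :=
  Superspace tensor_homog0 tensor_homog_lin tensor_homog_dec tensor_homog_cap.

End TensorSuperspace.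

Section SL2.
Variable K : fieldType.

Definition tr0 : pred 'M[K]_2 := fun x => \tr x == 0.
Fact tr0_submod : submod_closed tr0.
Proof.
split=> [|k x y]; rewrite /in_mem /= /tr0; first by rewrite mxtrace0.
by move=> /eqP hx /eqP hy; rewrite mxtraceD mxtraceZ hx hy mulr0 addr0.
Qed.
HB.instance Definition _ := GRing.isSubmodClosed.Build K 'M[K]_2 tr0 tr0_submod.

Record sl2 := Sl2 { sl2_mx :> 'M[K]_2; _ : tr0 sl2_mx }.

HB.instance Definition _ := [isSub for sl2_mx].
HB.instance Definition _ := [Choice of sl2 by <:].
HB.instance Definition _ := [SubChoice_isSubZmodule of sl2 by <:].
HB.instance Definition _ := [SubZmodule_isSubLmodule of sl2 by <:].

Fact sl2_bracket_subproof (x y : sl2) : tr0 (x *m y - y *m x).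
Proof. by rewrite /tr0 linearB /= mxtrace_mulC subrr. Qed.
Definition sl2_bracket (x y : sl2) : sl2 := Sl2 (sl2_bracket_subproof x y).

Fact sl2_e_subproof : tr0 (delta_mx 0 1 : 'M[K]_2).
Proof. by rewrite /tr0 /mxtrace big_ord_recl big_ord1 !mxE /= addr0. Qed.
Fact sl2_f_subproof : tr0 (delta_mx 1 0 : 'M[K]_2).
Proof. by rewrite /tr0 /mxtrace big_ord_recl big_ord1 !mxE /= addr0. Qed.
Fact sl2_h_subproof : tr0 (delta_mx 0 0 - delta_mx 1 1 : 'M[K]_2).
Proof. by rewrite /tr0 /mxtrace big_ord_recl big_ord1 !mxE /= subr0 sub0r subrr. Qed.

Definition sl2_e : sl2 := Sl2 sl2_e_subproof.
Definition sl2_f : sl2 := Sl2 sl2_f_subproof.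
Definition sl2_h : sl2 := Sl2 sl2_h_subproof.

Definition kappa (x y : sl2) : K := 4 * \tr (x *m y).

Definition natV := 'cV[K]_2.

Definition natV_act (x : sl2) (v : natV) : natV := sl2_mx x *m v.

Definition detV (v w : natV) : K := \det (row_mx v w : 'M[K]_(2, 1 + 1)).

(* The product V ⊗ V -> sl2, written in coordinates; its values on the standard
   basis are given by [odotV_basis]. *)
Definition odotV (v w : natV) : sl2 :=
  (v 0 0 * w 0 0) *: sl2_e
  - (2^-1 * (v 0 0 * w 1 0 + v 1 0 * w 0 0)) *: sl2_h
  - (v 1 0 * w 1 0) *: sl2_f.

Definition e1 : natV := delta_mx 0 0.
Definition e2 : natV := delta_mx 1 0.

Lemma odotV_basis :
  [/\ odotV e1 e1 = sl2_e, odotV e1 e2 = - 2^-1 *: sl2_h,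
      odotV e2 e1 = - 2^-1 *: sl2_h & odotV e2 e2 = - sl2_f].
Proof.
by split; rewrite /odotV !mxE /= !(mulr0, mul0r, addr0, add0r, mulr1, scale0r,
  subr0, scale1r, oppr0, sub0r, scaleNr).
Qed.

Lemma detV_basis : detV e1 e2 = 1.
Proof.
rewrite /detV -[RHS](det1 K 2); congr determinant.
apply/matrixP => i j; rewrite !mxE.
by case: splitP => k /= E; rewrite !mxE -!val_eqE /= E (ord1 k); case: i => -[|[|]].
Qed.

End SL2.

Section Jordan.
Variables (K : fieldType) (J M : superspace K).
Notation sg n := (sgn K n).

Definition Jordan_superalgebra (mul : J -> J -> J) : Prop :=
  [/\ even_bilinear mul,
      forall (pa pb : bool) a b, homog pa a -> homog pb b ->
        mul a b = sg (pa * pb) *: mul b a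
    & forall (pa pb pc pd : bool) a b c d,
        homog pa a -> homog pb b -> homog pc c -> homog pd d ->
        mul (mul a b) (mul c d)
        + sg (pb * pc) *: mul (mul a c) (mul b d)
        + sg (pb * pd + pc * pd) *: mul (mul a d) (mul b c)
        = mul (mul (mul a b) c) d
          + sg (pb * pc + pb * pd + pc * pd) *: mul (mul (mul a d) c) b
          + sg (pa * pb + pa * pc + pa * pd + pc * pd)
              *: mul (mul (mul b d) c) a].

Definition special_supermodule (mul : J -> J -> J) (act : J -> M -> M) : Prop :=
  even_bilinear act /\
  forall (pa pb : bool) a b m, homog pa a -> homog pb b ->
    act (mul a b) m
    = 2^-1 *: (act a (act b m) + sg (pa * pb) *: act b (act a m)).

Definition even_trilinear (tri : M -> M -> M -> M) : Prop :=
  [/\ forall n r, linear (fun m => tri m n r),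
      forall m r, linear (fun n => tri m n r),
      forall m n, linear (tri m n)
    & forall (pm pn pr : bool) m n r, homog pm m -> homog pn n -> homog pr r ->
        homog (pm (+) pn (+) pr) (tri m n r)].

Record ternary_superalgebra := TernarySuperalgebra {
  jmul : J -> J -> J;
  jact : J -> M -> M;
  mstar : M -> M -> J;
  mtri : M -> M -> M -> M;
  jmul_jordan : Jordan_superalgebra jmul;
  jact_special : special_supermodule jmul jact;
  mstar_even : even_bilinear mstar;
  mstar_anti : forall (pm pn : bool) m n, homog pm m -> homog pn n ->
    mstar m n = - (sg (pm * pn) *: mstar n m);
  mtri_even : even_trilinear mtri;
  sjt1 : forall (pa pm pn : bool) a m n,
    homog pa a -> homog pm m -> homog pn n ->
    jmul a (mstar m n)
    = 2^-1 *: (mstar (jact a m) n + sg (pa * pm) *: mstar m (jact a n));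
  sjt2 : forall (pa pm pn ps : bool) a m n s,
    homog pa a -> homog pm m -> homog pn n -> homog ps s ->
    jact a (mtri m n s)
    = mtri (jact a m) n s
      - sg (pa * pm) *: mtri m (jact a n) s
      + sg (pa * (pm + pn)) *: mtri m n (jact a s);
  sjt3 : forall (pm pn ps : bool) m n s,
    homog pm m -> homog pn n -> homog ps s ->
    mtri m n s
    = sg (pm * (pn + ps) + pn * ps) *: mtri s n m
      - sg (pn * ps) *: jact (mstar m s) n;
  sjt4 : forall (pm pn ps : bool) m n s,
    homog pm m -> homog pn n -> homog ps s ->
    mtri m n s = sg (pm * pn) *: mtri n m s + jact (mstar m n) s;
  sjt5 : forall (pm pn pr ps : bool) m n r s,
    homog pm m -> homog pn n -> homog pr r -> homog ps s ->
    mstar (mtri m n r) s + sg (pr * (pm + pn)) *: mstar r (mtri m n s)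
    = sg (pn * (pr + ps)) *: mstar m (jact (mstar r s) n);
  sjt6 : forall (pm pn pr ps pt : bool) m n r s t,
    homog pm m -> homog pn n -> homog pr r -> homog ps s -> homog pt t ->
    mtri m n (mtri r s t)
    = mtri (mtri m n r) s t
      + sg (pr * (pm + pn) + pm * pn) *: mtri r (mtri n m s) t
      + sg ((pm + pn) * (pr + ps)) *: mtri r s (mtri m n t) }.

End Jordan.

Section InnerDerivations.
Variables (K : fieldType) (J M : superspace K) (T : ternary_superalgebra J M).
Notation sg n := (sgn K n).
Notation "a ·j b" := (jmul T a b) (at level 40).
Notation "a • m" := (jact T a m) (at level 40).
Notation "m ⋆ n" := (mstar T m n) (at level 40).

(* The operators <a, b> and ∂_{m,n} on homogeneous arguments; the leading
   boolean arguments are the parities of the elements they are named after. *)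
Definition angleJ (pa pb : bool) (a b c : J) : J :=
  a ·j (b ·j c) - sg (pa * pb) *: (b ·j (a ·j c)).

Definition angleM (pa pb : bool) (a b : J) (m : M) : M :=
  4^-1 *: (a • (b • m) - sg (pa * pb) *: (b • (a • m))).

Definition partialJ (pm pn pa : bool) (m n : M) (a : J) : J :=
  2^-1 *: (sg (pa * (pm + pn)) *: ((a • m) ⋆ n) - sg (pa * pn) *: (m ⋆ (a • n))).

Definition partialM (m n r : M) : M := 2^-1 *: ((m ⋆ n) • r) - mtri T m n r.

Definition JJMM : superspace K :=
  dsum (tensor_superspace J J) (tensor_superspace M M).

Definition jj (a b : J) : JJMM := (a ⊗ b, 0).
Definition mm (m n : M) : JJMM := (0, m ⊗ n).

(* The generators of R^s(J, M). *)
Inductive Rs : JJMM -> Prop :=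
| Rs_ab (pa pb : bool) a b : homog pa a -> homog pb b ->
    Rs (jj a b + sg (pa * pb) *: jj b a)
| Rs_mn (pm pn : bool) m n : homog pm m -> homog pn n ->
    Rs (mm m n - sg (pm * pn) *: mm n m)
| Rs_abc (pa pb pc : bool) a b c : homog pa a -> homog pb b -> homog pc c ->
    Rs (sg (pa * pc) *: jj (a ·j b) c
        + sg (pa * pb) *: jj (b ·j c) a
        + sg (pb * pc) *: jj (c ·j a) b)
| Rs_amn (pa pm pn : bool) a m n : homog pa a -> homog pm m -> homog pn n ->
    Rs (mm (a • m) n - sg (pa * pm) *: mm m (a • n)
        - (sg (pa * (pm + pn)) * 2) *: jj (m ⋆ n) a)
| Rs_mnrs (pm pn pr ps : bool) m n r s :
    homog pm m -> homog pn n -> homog pr r -> homog ps s ->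
    Rs (mm (partialM m n r) s
        + sg ((pm + pn) * pr) *: mm r (partialM m n s)
        + sg ((pm + pn) * (pr + ps)) *: mm (partialM r s m) n
        + sg ((pr + ps) * pn) *: mm m (partialM r s n)).

Lemma jj_homog p q a b : homog p a -> homog q b -> homog (p (+) q) (jj a b).
Proof. by move=> *; split; [exact: tensor_homog_gen|exact: homog0]. Qed.
Lemma mm_homog p q m n : homog p m -> homog q n -> homog (p (+) q) (mm m n).
Proof. by move=> *; split; [exact: homog0|exact: tensor_homog_gen]. Qed.

Lemma partialM_homog pm pn pr m n r : homog pm m -> homog pn n -> homog pr r ->
  homog (pm (+) pn (+) pr) (partialM m n r).
Proof.
have [[_ act_h] _] := jact_special T; have [_ star_h] := mstar_even T.
have [_ _ _ tri_h] := mtri_even T.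
move=> hm hn hr; apply: homogB; last exact: tri_h.
by apply/homogZ/act_h => //; exact: star_h.
Qed.

Fact Rs_homog s : Rs s -> exists p, homog p s.
Proof.
have [[_ act_h] _] := jact_special T; have [_ star_h] := mstar_even T.
have [[_ mul_h] _ _] := jmul_jordan T.
case=> [pa pb a b ha hb|pm pn m n hm hn|pa pb pc a b c ha hb hc
  |pa pm pn a m n ha hm hn|pm pn pr q m n r t hm hn hr ht].
- exists (pa (+) pb); apply: homogD; first exact: jj_homog.
  by rewrite addbC; apply/homogZ/jj_homog.
- exists (pm (+) pn); apply: homogB; first exact: mm_homog.
  by rewrite addbC; apply/homogZ/mm_homog.
- exists (pa (+) pb (+) pc); apply: homogD; [apply: homogD|]; apply: homogZ.
  + by apply: jj_homog => //; exact: mul_h.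
  + by rewrite -addbA addbC; apply: jj_homog => //; exact: mul_h.
  + by rewrite addbC addbA; apply: jj_homog => //; exact: mul_h.
- exists (pa (+) pm (+) pn); apply: homogB; [apply: homogB|].
  + by apply: mm_homog => //; exact: act_h.
  + rewrite [pa (+) pm]addbC -addbA; apply/homogZ/mm_homog => //; exact: act_h.
  + by rewrite -addbA addbC; apply/homogZ/jj_homog => //; exact: star_h.
- exists (pm (+) pn (+) pr (+) q).
  apply: homogD; [apply: homogD; [apply: homogD|]|].
  + by apply: mm_homog => //; exact: partialM_homog.
  + rewrite [_ (+) pr]addbC -addbA; apply/homogZ/mm_homog => //.
    exact: partialM_homog.
  + rewrite -addbA [pm (+) pn]addbC -addbA addbC addbC.
    have -> : pn (+) (pm (+) (pr (+) q)) = (pr (+) q (+) pm) (+) pn.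
      by case: pm pn pr q {hm hn hr ht} => -[] [] [].
    by apply/homogZ/mm_homog => //; exact: partialM_homog.
  + have -> : pm (+) pn (+) pr (+) q = pm (+) (pr (+) q (+) pn).
      by case: pm pn pr q {hm hn hr ht} => -[] [] [].
    by apply/homogZ/mm_homog => //; exact: partialM_homog.
Qed.

Definition Bs : superspace K := quot_superspace Rs_homog.

(* The classes {a ⊗ b} and {m ⊗ n}. *)
Definition clJ (a b : J) : Bs := qclass Rs (jj a b).
Definition clM (m n : M) : Bs := qclass Rs (mm m n).

(* The action D({z1 ⊗ z2}) = {D(z1) ⊗ z2} + (-1)^(|D||z1|) {z1 ⊗ D(z2)} of a
   homogeneous operator D of parity pD, for z1 of parity pz in J or in M. *)
Definition der_clJ (pD : bool) (D : J -> J) (pz : bool) (z1 z2 : J) : Bs :=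
  clJ (D z1) z2 + sg (pD * pz) *: clJ z1 (D z2).
Definition der_clM (pD : bool) (D : M -> M) (pz : bool) (z1 z2 : M) : Bs :=
  clM (D z1) z2 + sg (pD * pz) *: clM z1 (D z2).

End InnerDerivations.

Section ShortLie.
Variable K : fieldType.
Notation sg n := (sgn K n).

Definition super_anticommutative (L : superspace K) (br : L -> L -> L) : Prop :=
  forall (pu pv : bool) u v, homog pu u -> homog pv v ->
    br u v = - (sg (pu * pv) *: br v u).

Definition Lie_superalgebra (L : superspace K) (br : L -> L -> L) : Prop :=
  [/\ even_bilinear br, super_anticommutative br
    & forall (pu pv : bool) u v w, homog pu u -> homog pv v ->
        br u (br v w) = br (br u v) w + sg (pu * pv) *: br v (br u w)].

Section ShortModule.
Variables J M D : superspace K.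

Definition short_module : superspace K :=
  dsum (dsum (tensor_superspace (purely_even (sl2 K)) J)
             (tensor_superspace (purely_even (natV K)) M)) D.

Definition slJ (x : sl2 K) (a : J) : short_module := ((x ⊗ a, 0), 0).
Definition VM (v : natV K) (m : M) : short_module := ((0, v ⊗ m), 0).
Definition inD (d : D) : short_module := ((0, 0), d).

(* The values on pure tensors are given by [short_actionE]. *)
Definition short_action (x : sl2 K) (u : short_module) : short_module :=
  ((tensor_lift (fun (y : sl2 K) (a : J) => sl2_bracket x y ⊗ a) u.1.1,
    tensor_lift (fun (v : natV K) (m : M) => natV_act x v ⊗ m) u.1.2), 0).

Lemma short_actionE x y v a m d :
  [/\ short_action x (slJ y a) = slJ (sl2_bracket x y) a,
      short_action x (VM v m) = VM (natV_act x v) m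
    & short_action x (inD d) = 0].
Proof.
have [sll slr] := tensor_bilin (purely_even (sl2 K)) J.
have [vl vr] := tensor_bilin (purely_even (natV K)) M.
have B1 : bilin (fun (y : sl2 K) (a : J) =>
    (sl2_bracket x y ⊗ a : tensor_superspace (purely_even (sl2 K)) J)).
  split=> [b k y1 y2|y1]; last exact: slr.
  rewrite -sll; congr tensor; apply/val_inj => /=.
  by rewrite mulmxDr mulmxDl -scalemxAr -scalemxAl scalerBr opprD addrACA.
have B2 : bilin (fun (w : natV K) (n : M) =>
    (natV_act x w ⊗ n : tensor_superspace (purely_even (natV K)) M)).
  split=> [b k v1 v2|v1]; last exact: vr.
  by rewrite -vl; congr tensor; rewrite /natV_act mulmxDr -scalemxAr.
have [L1 E1] := tensor_liftP B1; have [L2 E2] := tensor_liftP B2.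
have lin0 (U W : lmodType K) (f : U -> W) : linear f -> f 0 = 0.
  by move=> L; apply: (addrI (f 0)); rewrite -{1}[f 0]scale1r -L scaler0 !addr0.
split; rewrite /short_action /slJ /VM /inD /= ?E1 ?E2 ?(lin0 _ _ _ L1) //.
- by rewrite (lin0 _ _ _ L2).
- by rewrite (lin0 _ _ _ L2).
Qed.

End ShortModule.

Definition acts_by_even_derivations (L : superspace K) (br : L -> L -> L)
    (act : sl2 K -> L -> L) : Prop :=
  [/\ bilin act,
      forall x y u, act (sl2_bracket x y) u = act x (act y u) - act y (act x u),
      forall x p u, homog p u -> homog p (act x u)
    & forall x u v, act x (br u v) = br (act x u) v + br u (act x v)].

Definition short_sl2_Lie_superalgebra (L : superspace K) (br : L -> L -> L)
    (act : sl2 K -> L -> L) : Prop :=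
  [/\ Lie_superalgebra br, acts_by_even_derivations br act
    & exists (J M D : superspace K) (phi : short_module J M D -> L),
        [/\ even_linear phi, bijective phi
          & forall x u, phi (short_action x u) = act x (phi u)]].

End ShortLie.

Section TAG.
Variables (K : fieldType) (J M : superspace K) (T : ternary_superalgebra J M).

Definition TAG : superspace K := short_module J M (Bs T).

(* x ⊗ a, v ⊗ m and elements of B^s, as elements of TAG(J, M). *)
Definition TAG_sl (x : sl2 K) (a : J) : TAG := slJ M (Bs T) x a.
Definition TAG_V (v : natV K) (m : M) : TAG := VM J (Bs T) v m.
Definition TAG_B (b : Bs T) : TAG := inD J M b.

(* The defining formulas of the bracket.  Where signs occur they are stated on
   homogeneous elements; the remaining brackets are determined by bilinearity
   and super-anticommutativity. *)
Record TAG_bracket (br : TAG -> TAG -> TAG) : Prop := {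
  TAG_bilin : bilin br;
  TAG_anti : super_anticommutative br;
  TAG_abcd : forall (pa pb pc : bool) a b c d,
    homog pa a -> homog pb b -> homog pc c ->
    br (TAG_B (clJ T a b)) (TAG_B (clJ T c d))
    = TAG_B (der_clJ T (pa (+) pb) (angleJ T pa pb a b) pc c d);
  TAG_abmn : forall (pa pb pm : bool) a b m n,
    homog pa a -> homog pb b -> homog pm m ->
    br (TAG_B (clJ T a b)) (TAG_B (clM T m n))
    = TAG_B (der_clM T (pa (+) pb) (angleM T pa pb a b) pm m n);
  TAG_mnrs : forall (pm pn pr : bool) m n r s,
    homog pm m -> homog pn n -> homog pr r ->
    br (TAG_B (clM T m n)) (TAG_B (clM T r s))
    = TAG_B (der_clM T (pm (+) pn) (partialM T m n) pr r s);
  TAG_abxc : forall (pa pb : bool) a b x c, homog pa a -> homog pb b ->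
    br (TAG_B (clJ T a b)) (TAG_sl x c) = TAG_sl x (angleJ T pa pb a b c);
  TAG_mnxc : forall (pm pn pc : bool) m n x c,
    homog pm m -> homog pn n -> homog pc c ->
    br (TAG_B (clM T m n)) (TAG_sl x c) = TAG_sl x (partialJ T pm pn pc m n c);
  TAG_abvm : forall (pa pb : bool) a b v m, homog pa a -> homog pb b ->
    br (TAG_B (clJ T a b)) (TAG_V v m) = TAG_V v (angleM T pa pb a b m);
  TAG_mnvr : forall m n v r,
    br (TAG_B (clM T m n)) (TAG_V v r) = TAG_V v (partialM T m n r);
  TAG_xayb : forall x y a b,
    br (TAG_sl x a) (TAG_sl y b)
    = TAG_sl (sl2_bracket x y) (jmul T a b)
      + TAG_B ((2^-1 * kappa x y) *: clJ T a b);
  TAG_xavm : forall x v a m,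
    br (TAG_sl x a) (TAG_V v m) = TAG_V (natV_act x v) (jact T a m);
  TAG_vmwn : forall v w m n,
    br (TAG_V v m) (TAG_V w n)
    = TAG_sl (odotV v w) (mstar T m n) + TAG_B (detV v w *: clM T m n) }.

End TAG.

(* Main.v *)
From mathcomp Require Import all_boot all_order all_algebra reals ring.
From mathcomp.real_closed Require Import complex.
Require Import Defs.

Set Implicit Arguments.
Unset Strict Implicit.
Unset Printing Implicit Defensive.

Import GRing.Theory Num.Theory.
Local Open Scope ring_scope.

(** TAG(J, M) is a Lie superalgebra because the operators <a, b> and ∂_{m,n} are
   superderivations of all four products of (J, M) and the relations defining
   the space B = B^s(J, M) are exactly those that the Jacobi identity asks for.

   Superderivations. That <a, b> respects the product of J is the Jordan
   identity compared with itself after a permutation of its arguments; on M the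
   operator <a, b> is a quarter of the supercommutator of the actions of a and b,
   and SJT1, SJT2 describe how a single action passes through ⋆ and the triple
   product ([angle_jmul], [angle_jact], [angle_mstar], [angle_mtri]). For
   ∂_{m,n} the properties come from SJT1, SJT5, SJT6 and from
   [mtri_jact_exchange], which is SJT2 applied to SJT4 ([partial_jmul],
   [partial_jact], [partial_mstar], [partial_mtri]).

   The space B. A superderivation D satisfies [D, <a, b>] = <Da, b> ± <a, Db>,
   and likewise for ∂. So I_{m,n,r,s} acts on J and M as [D, E] + [E, D] up to
   sign, that is, as 0; the other generators of R^s act as 0 by identities in
   (J, M). Hence B acts on J and M by superderivations ([superder_B]).
   A superderivation maps generators of R^s to sums of such generators
   ([respects_Rs_der]), so that B also acts on itself, and this action [B_actB]
   is a representation ([B_actB_B]). It is super-anticommutative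
   ([B_actB_anti]): I_{a,b,c} gives this on J ⊗ J, I_{a,m,n} between J ⊗ J and
   M ⊗ M, and I_{m,n,r,s} on M ⊗ M.

   The Jacobi identity. The bracket [TAG_br] is bilinear, and every identity to
   be proved is checked on the homogeneous elements x ⊗ a, v ⊗ m and those of B,
   which span TAG(J, M). The Jacobi identity is stable under permutations of its
   arguments, so ten of the twenty-seven combinations suffice. Those with an
   argument in B say that B acts by derivations and is a representation. The
   four others reduce to identities for 2 × 2 matrices: with k = κ/2,
   - [x, [y, z]] = k(x, y) z - k(x, z) y turns the identity on sl2 ⊗ J into the
     definition of <a, b> and I_{a,b,c};
   - xy = [x, y]/2 + k(x, y)/4 turns it, with one argument in V ⊗ M, into the
     special module axiom and the definition of <a, b> on M;
   - xv ⊙ w = ([x, v ⊙ w] - det(v, w) x)/2 turns it, with two arguments in V ⊗ M,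
     into SJT1, the definition of ∂ on J and I_{a,m,n};
   - the linear relation between three vectors of V turns it, with three
     arguments in V ⊗ M, into SJT3 and SJT4 ([mtri_cycle]).

   Signs. All these identities are linear consequences of the axioms, with
   coefficients made of halves and Koszul signs. Each proof names the
   coefficients ([add_eq]); the remaining identity between formal linear
   combinations is checked by computation for all parities ([signed_module]). *)

(** * Linear identities with Koszul signs, by reflection *)

Section SignedScalars.
Variable K : fieldType.

(** Parities of homogeneous elements, and below the exponents and coefficients
   built from them. *)
Inductive bexp := BVar of nat | BConst of bool | BXor of bexp & bexp.

Fixpoint beval (bs : seq bool) b := match b with
  | BVar i => nth false bs i
  | BConst c => c
  | BXor b1 b2 => beval bs b1 (+) beval bs b2
  end.

Inductive nexp := NBool of bexp | NAdd of nexp & nexp | NMul of nexp & nexp.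

Fixpoint neval (bs : seq bool) n : nat := match n with
  | NBool b => beval bs b
  | NAdd n1 n2 => (neval bs n1 + neval bs n2)%N
  | NMul n1 n2 => (neval bs n1 * neval bs n2)%N
  end.

Fixpoint nparity (bs : seq bool) n : bool := match n with
  | NBool b => beval bs b
  | NAdd n1 n2 => nparity bs n1 (+) nparity bs n2
  | NMul n1 n2 => nparity bs n1 && nparity bs n2
  end.

Inductive sexp := SNat of nat | SHalf | SQuarter | SSgn of nexp
  | SAdd of sexp & sexp | SOpp of sexp | SMul of sexp & sexp.

Fixpoint seval (bs : seq bool) s : K := match s with
  | SNat n => n%:R
  | SHalf => 2^-1
  | SQuarter => 4^-1
  | SSgn n => sgn K (neval bs n)
  | SAdd s1 s2 => seval bs s1 + seval bs s2
  | SOpp s1 => - seval bs s1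
  | SMul s1 s2 => seval bs s1 * seval bs s2
  end.

(** A pair (n, k) stands for the dyadic number n / 2 ^ k. *)
Definition dyadic := (int * nat)%type.
Definition dyadic_val (d : dyadic) : K := d.1%:~R * 2^-1 ^+ d.2.
Definition dyadic_add (d e : dyadic) : dyadic :=
  let k := maxn d.2 e.2 in
  (d.1 * (2 ^ (k - d.2))%N%:Z + e.1 * (2 ^ (k - e.2))%N%:Z, k).
Definition dyadic_mul (d e : dyadic) : dyadic := (d.1 * e.1, (d.2 + e.2)%N).
Definition dyadic_eq (d e : dyadic) : bool :=
  d.1 * (2 ^ e.2)%N%:Z == e.1 * (2 ^ d.2)%N%:Z.

Fixpoint sdyadic (bs : seq bool) s : dyadic := match s with
  | SNat n => (n%:Z, 0%N)
  | SHalf => (1, 1%N)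
  | SQuarter => (1, 2%N)
  | SSgn n => (if nparity bs n then -1 else 1, 0%N)
  | SAdd s1 s2 => dyadic_add (sdyadic bs s1) (sdyadic bs s2)
  | SOpp s1 => let d := sdyadic bs s1 in (- d.1, d.2)
  | SMul s1 s2 => dyadic_mul (sdyadic bs s1) (sdyadic bs s2)
  end.

Lemma odd_neval bs n : odd (neval bs n) = nparity bs n.
Proof.
by elim: n => [b|n IHn m IHm|n IHn m IHm] /=; rewrite ?oddb ?oddD ?oddM ?IHn ?IHm.
Qed.

Hypothesis two_neq0 : 2 != 0 :> K.

Let half_pow m k : (m <= k)%N -> (2 ^ (k - m))%N%:R * 2^-1 ^+ k = 2^-1 ^+ m :> K.
Proof.
move=> le; rewrite -{2}(subnK le) exprD natrX exprVn mulrA divff ?mul1r //.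
by rewrite expf_eq0 negb_and two_neq0 orbT.
Qed.

(** A sign depends on its exponent only through the parity of the latter, so a
   coefficient becomes a dyadic number once the parities are fixed. *)
Lemma sdyadicE bs s : seval bs s = dyadic_val (sdyadic bs s).
Proof.
rewrite /dyadic_val.
elim: s => [n||| n|s IHs t IHt|s IHs|s IHs t IHt] /=.
- by rewrite expr0 mulr1.
- by rewrite expr1 mul1r.
- by rewrite exprVn -natrX mul1r.
- by rewrite expr0 mulr1 /sgn -signr_odd odd_neval; case: nparity.
- rewrite IHs IHt rmorphD !rmorphM mulrDl -!mulrA /=.
  by rewrite -!pmulrn !half_pow ?leq_maxl ?leq_maxr.
- by rewrite IHs rmorphN mulNr.
- by rewrite IHs IHt rmorphM exprD mulrACA.
Qed.

Lemma dyadic_eqP d e : dyadic_eq d e -> dyadic_val d = dyadic_val e.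
Proof.
have pow_neq0 k : 2 ^+ k != 0 :> K by rewrite expf_eq0 negb_and two_neq0 orbT.
case: d e => [a k] [b l] /eqP /(congr1 (fun z : int => z%:~R : K)) /=.
rewrite !rmorphM /= -!pmulrn !natrX /dyadic_val /= !exprVn => h.
apply: (mulIf (pow_neq0 k)); apply: (mulIf (pow_neq0 l)).
by rewrite mulfVK // h mulrAC mulfVK.
Qed.

Lemma four_neq0 : 4 != 0 :> K.
Proof. by rewrite (_ : 4 = 2 * 2 :> K) ?mulf_neq0 //; ring. Qed.

End SignedScalars.

Lemma sgnE (K : fieldType) n : sgn K n = if odd n then -1 else 1.
Proof. by rewrite /sgn -signr_odd; case: odd. Qed.

Section ModuleExpressions.
Variables (K : fieldType) (V : lmodType K).

Section Syntax.
Variable S : Type.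
Inductive mexp := MVar of nat | MZero | MAdd of mexp & mexp | MOpp of mexp
  | MScale of S & mexp.

Variable scal : S -> K.
Fixpoint meval (vs : seq V) e : V := match e with
  | MVar i => nth 0 vs i
  | MZero => 0
  | MAdd e1 e2 => meval vs e1 + meval vs e2
  | MOpp e1 => - meval vs e1
  | MScale s e1 => scal s *: meval vs e1
  end.

Fixpoint mcoef e (i : nat) : K := match e with
  | MVar j => if Nat.eqb j i then 1 else 0
  | MZero => 0
  | MAdd e1 e2 => mcoef e1 i + mcoef e2 i
  | MOpp e1 => - mcoef e1 i
  | MScale s e1 => scal s * mcoef e1 i
  end.

Lemma mevalE vs e : meval vs e = \sum_(i < size vs) mcoef e i *: nth 0 vs i.
Proof.
have eqbP i j : Nat.eqb i j = (i == j).
  by apply/idP/eqP => /PeanoNat.Nat.eqb_eq.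
elim: e => [j||e IHe f IHf|e IHe|s e IHe] /=.
- have [lt|ge] := ltnP j (size vs).
    rewrite (bigD1 (Ordinal lt)) //= eqbP eqxx scale1r big1 ?addr0 // => i ne.
    by rewrite eqbP eq_sym -[j]/(val (Ordinal lt)) val_eqE (negbTE ne) scale0r.
  rewrite nth_default // big1 // => i _; rewrite eqbP.
  by case: eqP ge => [->|_ _]; [rewrite leqNgt ltn_ord | rewrite scale0r].
- by rewrite big1 // => i _; rewrite scale0r.
- by rewrite IHe IHf -big_split; apply: eq_bigr => i _; rewrite scalerDl.
- by rewrite IHe -sumrN; apply: eq_bigr => i _; rewrite scaleNr.
- by rewrite IHe scaler_sumr; apply: eq_bigr => i _; rewrite scalerA.
Qed.

Fixpoint mcoefs_eq n e f : Prop := match n with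
  | 0 => True
  | n'.+1 => mcoef e n' = mcoef f n' /\ mcoefs_eq n' e f
  end.

Lemma mcoefs_eqP n e f :
  mcoefs_eq n e f <-> (forall i, (i < n)%N -> mcoef e i = mcoef f i).
Proof.
elim: n => //= n IH; split=> [[h /IH h'] i|h].
  by rewrite ltnS leq_eqVlt => /orP[/eqP->|/h'].
by split; [exact: h | apply/IH => i lt; apply/h/leqW].
Qed.

Lemma meval_eq vs e f : mcoefs_eq (size vs) e f -> meval vs e = meval vs f.
Proof.
by move/mcoefs_eqP => h; rewrite !mevalE; apply: eq_bigr => i _; rewrite h.
Qed.

End Syntax.

Fixpoint mscalar (e : mexp sexp) (i : nat) : sexp := match e with
  | MVar j => SNat (Nat.eqb j i)
  | MZero => SNat 0
  | MAdd e1 e2 => SAdd (mscalar e1 i) (mscalar e2 i)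
  | MOpp e1 => SOpp (mscalar e1 i)
  | MScale s e1 => SMul s (mscalar e1 i)
  end.

Lemma mscalarE bs e i : mcoef (seval K bs) e i = seval K bs (mscalar e i).
Proof.
by elim: e => [j||e IHe f IHf|e IHe|s e IHe] //=; rewrite ?IHe ?IHf //; case: Nat.eqb.
Qed.

Fixpoint all_signs (n : nat) : seq (seq bool) := match n with
  | 0 => [:: [::]]
  | n'.+1 => [seq false :: bs | bs <- all_signs n'] ++ [seq true :: bs | bs <- all_signs n']
  end.

Lemma mem_all_signs bs : bs \in all_signs (size bs).
Proof.
elim: bs => //= b bs IH; rewrite mem_cat.
by case: b; rewrite map_f ?orbT.
Qed.

Definition signed_eq (nb nv : nat) (e f : mexp sexp) : bool :=
  all (fun bs => all (fun i =>
      dyadic_eq (sdyadic bs (mscalar e i)) (sdyadic bs (mscalar f i)))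
    (iota 0 nv)) (all_signs nb).

Hypothesis two_neq0 : 2 != 0 :> K.

(** The values of the vectors and of the parities being arbitrary, comparing
   finitely many dyadic numbers proves an identity for all of them. *)
Lemma signed_eqP bs vs e f : signed_eq (size bs) (size vs) e f ->
  meval (seval K bs) vs e = meval (seval K bs) vs f.
Proof.
move=> /allP/(_ _ (mem_all_signs bs))/allP h; apply: meval_eq.
apply/mcoefs_eqP => i lt; rewrite !mscalarE !sdyadicE //.
by apply: dyadic_eqP => //; apply: h; rewrite mem_iota.
Qed.

End ModuleExpressions.

Arguments MVar {S}.
Arguments MZero {S}.

(** The step of a linear combination: c times a known equation x = y is added to
   the goal. After the last step both sides are formally equal. *)
Lemma add_eq (K : fieldType) (V : lmodType K) (c : K) (x y l r : V) :
  x = y -> l + c *: y = r + c *: x -> l = r.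
Proof. by move=> -> /addIr. Qed.
Arguments add_eq {K V} c {x y l r}.

Ltac index_of x xs := lazymatch xs with
  | x :: _ => constr:(0%N)
  | _ :: ?xs' => let n := index_of x xs' in constr:(S n)
  end.

Ltac insert x xs := let rec mem ys := lazymatch ys with
    | nil => constr:(x :: xs)
    | x :: _ => xs
    | _ :: ?ys' => mem ys'
    end in mem xs.

Ltac vectors t vs := lazymatch t with
  | 0%R => vs
  | (?a + ?b)%R => let vs' := vectors b vs in vectors a vs'
  | (- ?a)%R => vectors a vs
  | (_ *: ?a)%R => vectors a vs
  | _ => insert t vs
  end.

Ltac bool_vars b bs := lazymatch b with
  | true => bs
  | false => bs
  | ?p (+) ?q => let bs' := bool_vars p bs in bool_vars q bs'
  | _ => insert b bs
  end.

Ltac nat_bools n bs := lazymatch n with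
  | (?a + ?b)%N => let bs' := nat_bools a bs in nat_bools b bs'
  | (?a * ?b)%N => let bs' := nat_bools a bs in nat_bools b bs'
  | nat_of_bool ?b => bool_vars b bs
  end.

Ltac scalar_bools s bs := lazymatch s with
  | sgn _ ?n => nat_bools n bs
  | (?a + ?b)%R => let bs' := scalar_bools a bs in scalar_bools b bs'
  | (?a * ?b)%R => let bs' := scalar_bools a bs in scalar_bools b bs'
  | (- ?a)%R => scalar_bools a bs
  | _ => bs
  end.

Ltac vector_bools t bs := lazymatch t with
  | (?a + ?b)%R => let bs' := vector_bools a bs in vector_bools b bs'
  | (- ?a)%R => vector_bools a bs
  | (?s *: ?a)%R => let bs' := scalar_bools s bs in vector_bools a bs'
  | _ => bs
  end.

Ltac reify_bool b bs := lazymatch b with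
  | true => constr:(BConst true)
  | false => constr:(BConst false)
  | ?p (+) ?q => let p' := reify_bool p bs in let q' := reify_bool q bs in
      constr:(BXor p' q')
  | _ => let i := index_of b bs in constr:(BVar i)
  end.

Ltac reify_nat n bs := lazymatch n with
  | (?a + ?b)%N => let a' := reify_nat a bs in let b' := reify_nat b bs in
      constr:(NAdd a' b')
  | (?a * ?b)%N => let a' := reify_nat a bs in let b' := reify_nat b bs in
      constr:(NMul a' b')
  | nat_of_bool ?b => let b' := reify_bool b bs in constr:(NBool b')
  end.

Ltac reify_scalar bs s := lazymatch s with
  | (2^-1)%R => constr:(SHalf)
  | (4^-1)%R => constr:(SQuarter)
  | (?n%:R)%R => constr:(SNat n)
  | 1%R => constr:(SNat 1)
  | sgn _ ?n => let n' := reify_nat n bs in constr:(SSgn n')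
  | (?a + ?b)%R => let a' := reify_scalar bs a in let b' := reify_scalar bs b in
      constr:(SAdd a' b')
  | (?a * ?b)%R => let a' := reify_scalar bs a in let b' := reify_scalar bs b in
      constr:(SMul a' b')
  | (- ?a)%R => let a' := reify_scalar bs a in constr:(SOpp a')
  end.

Ltac reify_vector S reify_scalar t vs := lazymatch t with
  | 0%R => constr:(@MZero S)
  | (?a + ?b)%R => let a' := reify_vector S reify_scalar a vs in
      let b' := reify_vector S reify_scalar b vs in constr:(MAdd a' b')
  | (- ?a)%R => let a' := reify_vector S reify_scalar a vs in constr:(MOpp a')
  | (?k *: ?a)%R => let k' := reify_scalar k in
      let a' := reify_vector S reify_scalar a vs in constr:(MScale k' a')
  | _ => let i := index_of t vs in constr:(@MVar S i)
  end.

(** Closes an equation between linear combinations whose coefficients are built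
   from integers, halves and Koszul signs, for all values of the parities. *)
Ltac signed_module two_neq0 := lazymatch goal with |- @eq ?V ?l ?r =>
  let vs := vectors l (@nil V) in let vs := vectors r vs in
  let bs := vector_bools l (@nil bool) in let bs := vector_bools r bs in
  let rs := reify_scalar bs in
  let l' := reify_vector sexp rs l vs in
  let r' := reify_vector sexp rs r vs in
  apply: (@signed_eqP _ _ two_neq0 bs vs l' r'); vm_compute; reflexivity
  end.

(** Reduces an equation between linear combinations with arbitrary
   coefficients to the equality of the coefficients of each vector. *)
Ltac module_coefs K := lazymatch goal with |- @eq ?V ?l ?r =>
  let vs := vectors l (@nil V) in let vs := vectors r vs in
  let rs k := k in
  let l' := reify_vector K rs l vs in
  let r' := reify_vector K rs r vs in
  apply: (@meval_eq _ _ K (fun k => k) vs l' r');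
  cbn [mcoefs_eq mcoef size Nat.eqb]; repeat split
  end.

(** The variant for coefficients that also contain scalars other than signs and
   dyadic numbers; [cases] is to destruct the parities. *)
Ltac signed_coefs K two_neq0 cases :=
  module_coefs K; rewrite ?sgnE ?(oddD, oddM, oddb); cases; rewrite /=;
  by field; rewrite ?two_neq0 ?(four_neq0 two_neq0).

(** * Linear, bilinear and homogeneous extension *)

Section Linear.
Variables (K : fieldType) (U W : lmodType K) (f : U -> W).
Hypothesis hf : linear f.

Lemma linear_0 : f 0 = 0.
Proof. by have := hf (-1) 0 0; rewrite !scaleN1r !addNr. Qed.

Lemma linear_D : {morph f : u v / u + v}.
Proof. by move=> u v; rewrite -[u]scale1r hf !scale1r. Qed.

Lemma linear_Z k : {morph f : u / k *: u}.
Proof. by move=> u; rewrite -[_ *: _]addr0 hf linear_0 addr0. Qed.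

Lemma linear_N : {morph f : u / - u}.
Proof. by move=> u; rewrite -!scaleN1r linear_Z. Qed.

End Linear.

Lemma linear_comb (K : fieldType) (U W : lmodType K) (k : K) (f g : U -> W) :
  linear f -> linear g -> linear (fun u => k *: f u + g u).
Proof.
by move=> hf hg l u v; rewrite hf hg !scalerDr !scalerA mulrC addrACA.
Qed.

Lemma linear_scale (K : fieldType) (V W : lmodType K) (k : K) (f : V -> W) :
  linear f -> linear (fun v => k *: f v).
Proof. by move=> hf l u v; rewrite hf scalerDr !scalerA mulrC. Qed.

Lemma linear_comp (K : fieldType) (U V W : lmodType K) (f : V -> W) (g : U -> V) :
  linear f -> linear g -> linear (fun u => f (g u)).
Proof. by move=> hf hg k u v; rewrite hg hf. Qed.

Section Bilinear.
Variables (K : fieldType) (U V W : lmodType K) (f : U -> V -> W).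
Hypothesis hf : bilin f.

Lemma bilin0l v : f 0 v = 0. Proof. exact: linear_0 (hf.1 v). Qed.
Lemma bilin0r u : f u 0 = 0. Proof. exact: linear_0 (hf.2 u). Qed.
Lemma bilinDl u u' v : f (u + u') v = f u v + f u' v.
Proof. exact: linear_D (hf.1 v) _ _. Qed.
Lemma bilinDr u v v' : f u (v + v') = f u v + f u v'.
Proof. exact: linear_D (hf.2 u) _ _. Qed.
Lemma bilinZl k u v : f (k *: u) v = k *: f u v.
Proof. exact: linear_Z (hf.1 v) _ _. Qed.
Lemma bilinZr k u v : f u (k *: v) = k *: f u v.
Proof. exact: linear_Z (hf.2 u) _ _. Qed.
Lemma bilinNl u v : f (- u) v = - f u v.
Proof. exact: linear_N (hf.1 v) _. Qed.
Lemma bilinNr u v : f u (- v) = - f u v.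
Proof. exact: linear_N (hf.2 u) _. Qed.

Definition bilinE := (bilin0l, bilin0r, bilinDl, bilinDr, bilinZl, bilinZr,
  bilinNl, bilinNr).

End Bilinear.

Lemma bilin_comp (K : fieldType) (U V W X Y Z : lmodType K) (f : U -> V -> W)
    (g : W -> X) (h : Y -> U) (k : Z -> V) :
  bilin f -> linear g -> linear h -> linear k ->
  bilin (fun y z => g (f (h y) (k z))).
Proof.
move=> hf hg hh hk; split=> [z|y] l t t'.
  by rewrite hh hf.1 hg.
by rewrite hk hf.2 hg.
Qed.

Lemma bilin_add (K : fieldType) (U V W : lmodType K) (f g : U -> V -> W) :
  bilin f -> bilin g -> bilin (fun u v => f u v + g u v).
Proof.
move=> hf hg; split=> [v|u] l t t'.
  by rewrite hf.1 hg.1 scalerDr addrACA.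
by rewrite hf.2 hg.2 scalerDr addrACA.
Qed.

Lemma bilin_opp (K : fieldType) (U V W : lmodType K) (f : U -> V -> W) :
  bilin f -> bilin (fun u v => - f u v).
Proof.
by move=> hf; split=> [v|u] k z z'; rewrite (hf.1, hf.2) opprD scalerN.
Qed.

Lemma bilin_scale (K : fieldType) (V : lmodType K) :
  bilin (fun (k : K^o) (v : V) => (k : K) *: v).
Proof.
split=> [v l k k'|k l v v']; first by rewrite scalerDl scalerA.
by rewrite scalerDr !scalerA mulrC.
Qed.

Lemma span_eq (K : fieldType) (V W : lmodType K) (S : V -> Prop) (f g : V -> W) :
  linear f -> linear g -> (forall v, S v -> f v = g v) ->
  forall v, span S v -> f v = g v.
Proof.
move=> hf hg h; apply: (span_ind (P := fun v => f v = g v)).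
  by rewrite !linear_0.
by move=> k u v Su IH; rewrite hf hg IH h.
Qed.

Lemma span_image (K : fieldType) (V W : lmodType K) (S : V -> Prop) (S' : W -> Prop)
    (f : V -> W) :
  linear f -> (forall v, S v -> S' (f v)) -> forall v, span S v -> span S' (f v).
Proof.
move=> hf h; apply: (span_ind (P := fun v => span S' (f v))).
  by rewrite linear_0 //; exact: span0.
by move=> k u v /h Su IH; rewrite hf; apply: span_lin IH; exact: span_gen.
Qed.

(** * Identities in a J-ternary superalgebra *)

Section Identities.
Variables (K : fieldType) (J M : superspace K) (T : ternary_superalgebra J M).
Hypothesis two_neq0 : 2 != 0 :> K.
Notation sg n := (sgn K n).
Notation "a ·j b" := (jmul T a b) (at level 40).
Notation "a • m" := (jact T a m) (at level 40).
Notation "m ⋆ n" := (mstar T m n) (at level 40).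
Notation tri := (mtri T).

Lemma jmul_bilin : bilin (jmul T).
Proof. by have [[]] := jmul_jordan T. Qed.
Lemma jact_bilin : bilin (jact T).
Proof. by have [[]] := jact_special T. Qed.
Lemma mstar_bilin : bilin (mstar T).
Proof. by have [] := mstar_even T. Qed.
Lemma mtri_bilin12 r : bilin (fun m n => tri m n r).
Proof. by have [h1 h2 _ _] := mtri_even T; split=> [n|m]; [exact: h1|exact: h2]. Qed.
Lemma mtri_bilin23 m : bilin (tri m).
Proof. by have [_ h2 h3 _] := mtri_even T; split=> [n|r]; [exact: h2|exact: h3]. Qed.

Definition ternaryE := (bilinE jmul_bilin, bilinE jact_bilin, bilinE mstar_bilin,
  (fun r m n n' => bilinDl (mtri_bilin12 r) m n n'),
  (fun r k m n => bilinZl (mtri_bilin12 r) k m n),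
  (fun r m n => bilinNl (mtri_bilin12 r) m n),
  (fun m n n' r => bilinDl (mtri_bilin23 m) n n' r),
  (fun m k n r => bilinZl (mtri_bilin23 m) k n r),
  (fun m n r => bilinNl (mtri_bilin23 m) n r),
  (fun m n r r' => bilinDr (mtri_bilin23 m) n r r'),
  (fun m k n r => bilinZr (mtri_bilin23 m) k n r),
  (fun m n r => bilinNr (mtri_bilin23 m) n r)).

Implicit Types (pa pb pc pd pm pn pr ps pt : bool) (a b c d : J) (m n r s t : M).

Lemma jmul_homog pa pb a b : homog pa a -> homog pb b -> homog (pa (+) pb) (a ·j b).
Proof. by have [[_ h] _ _] := jmul_jordan T; exact: h. Qed.
Lemma jact_homog pa pm a m : homog pa a -> homog pm m -> homog (pa (+) pm) (a • m).
Proof. by have [[_ h] _] := jact_special T; exact: h. Qed.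
Lemma mstar_homog pm pn m n : homog pm m -> homog pn n -> homog (pm (+) pn) (m ⋆ n).
Proof. by have [_ h] := mstar_even T; exact: h. Qed.
Lemma mtri_homog pm pn pr m n r : homog pm m -> homog pn n -> homog pr r ->
  homog (pm (+) pn (+) pr) (tri m n r).
Proof. by have [_ _ _ h] := mtri_even T; exact: h. Qed.

Lemma jmulC pa pb a b : homog pa a -> homog pb b -> a ·j b = sg (pa * pb) *: (b ·j a).
Proof. by have [_ h _] := jmul_jordan T; exact: h. Qed.

Lemma jordan_identity pa pb pc pd a b c d :
  homog pa a -> homog pb b -> homog pc c -> homog pd d ->
  (a ·j b) ·j (c ·j d) + sg (pb * pc) *: ((a ·j c) ·j (b ·j d))
  + sg (pb * pd + pc * pd) *: ((a ·j d) ·j (b ·j c))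
  = ((a ·j b) ·j c) ·j d
    + sg (pb * pc + pb * pd + pc * pd) *: (((a ·j d) ·j c) ·j b)
    + sg (pa * pb + pa * pc + pa * pd + pc * pd) *: (((b ·j d) ·j c) ·j a).
Proof. by have [_ _ h] := jmul_jordan T; exact: h. Qed.

Lemma jactM pa pb a b m : homog pa a -> homog pb b ->
  (a ·j b) • m = 2^-1 *: (a • (b • m) + sg (pa * pb) *: (b • (a • m))).
Proof. by have [_ h] := jact_special T; exact: h. Qed.

(** The left side of the Jordan identity is symmetric in all arguments, up to
   sign, whereas the third argument is singled out on the right: the instances
   with b and with a in this place have equal right sides, and their difference
   is the derivation property. *)
Lemma angle_jmul pa pb pc pd a b c d :
  homog pa a -> homog pb b -> homog pc c -> homog pd d ->
  angleJ T pa pb a b (c ·j d)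
  = angleJ T pa pb a b c ·j d + sg ((pa (+) pb) * pc) *: (c ·j angleJ T pa pb a b d).
Proof.
move=> ha hb hc hd; rewrite /angleJ !ternaryE.
have hbc := jmul_homog hb hc; have hac := jmul_homog ha hc.
have had := jmul_homog ha hd; have hbd := jmul_homog hb hd.
have hcd := jmul_homog hc hd.
rewrite (jmulC hb hcd) !ternaryE (jmulC ha (jmul_homog hcd hb)).
rewrite (jmulC ha hcd) !ternaryE (jmulC hb (jmul_homog hcd ha)).
rewrite (jmulC ha hbc) (jmulC hb hac) !ternaryE.
rewrite (jmulC ha hbd) (jmulC hb had) !ternaryE.
rewrite (jmulC hc (jmul_homog hbd ha)) (jmulC hc (jmul_homog had hb)).
have e1 := jordan_identity ha hc hb hd.
have e2 := jordan_identity hb hc ha hd.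
rewrite (jmulC hb ha) (jmulC hc ha) !ternaryE (jmulC hbc had) (jmulC hbd hac) in e2.
rewrite (jmulC hc hb) !ternaryE in e1.
apply: (add_eq (- sg (pb * pc)) e1).
apply: (add_eq (sg (pa * pb + pa * pc)) e2).
signed_module two_neq0.
Qed.

(** On M, a · (b · c) - b · (a · c) acts as [[a, b], c]/4. *)
Lemma angle_jact pa pb pc a b c m :
  homog pa a -> homog pb b -> homog pc c ->
  angleM T pa pb a b (c • m)
  = angleJ T pa pb a b c • m + sg ((pa (+) pb) * pc) *: (c • angleM T pa pb a b m).
Proof.
move=> ha hb hc; rewrite /angleJ /angleM !ternaryE.
rewrite !(jactM _ ha (jmul_homog hb hc)) !(jactM _ hb (jmul_homog ha hc)).
rewrite !(jactM _ hb hc) !(jactM _ ha hc) !ternaryE.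
signed_module two_neq0.
Qed.

(** By SJT1, twice the multiplication by a acts on m ⋆ n by the sum of the actions
   on m and on n; these two supercommute for a and b, so that only the
   supercommutators on each argument survive. *)
Lemma angle_mstar pa pb pm pn a b m n :
  homog pa a -> homog pb b -> homog pm m -> homog pn n ->
  angleJ T pa pb a b (m ⋆ n)
  = angleM T pa pb a b m ⋆ n + sg ((pa (+) pb) * pm) *: (m ⋆ angleM T pa pb a b n).
Proof.
move=> ha hb hm hn; rewrite /angleJ /angleM.
rewrite (sjt1 T ha hm hn) (sjt1 T hb hm hn) !ternaryE.
rewrite (sjt1 T ha (jact_homog hb hm) hn) (sjt1 T ha hm (jact_homog hb hn)).
rewrite (sjt1 T hb (jact_homog ha hm) hn) (sjt1 T hb hm (jact_homog ha hn)).
signed_module two_neq0.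
Qed.

(** As for ⋆: by SJT2 the action of a is an alternating sum of its actions on the
   three arguments, and only the supercommutators on each of them survive. *)
Lemma angle_mtri pa pb pm pn pr a b m n r :
  homog pa a -> homog pb b -> homog pm m -> homog pn n -> homog pr r ->
  angleM T pa pb a b (tri m n r)
  = tri (angleM T pa pb a b m) n r
    + sg ((pa (+) pb) * pm) *: tri m (angleM T pa pb a b n) r
    + sg ((pa (+) pb) * (pm + pn)) *: tri m n (angleM T pa pb a b r).
Proof.
move=> ha hb hm hn hr; rewrite /angleM.
rewrite (sjt2 T ha hm hn hr) (sjt2 T hb hm hn hr) !ternaryE.
rewrite (sjt2 T ha (jact_homog hb hm) hn hr) (sjt2 T ha hm (jact_homog hb hn) hr).
rewrite (sjt2 T ha hm hn (jact_homog hb hr)).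
rewrite (sjt2 T hb (jact_homog ha hm) hn hr) (sjt2 T hb hm (jact_homog ha hn) hr).
rewrite (sjt2 T hb hm hn (jact_homog ha hr)).
signed_module two_neq0.
Qed.

Lemma partial_jmul pm pn pa pb m n a b :
  homog pm m -> homog pn n -> homog pa a -> homog pb b ->
  partialJ T pm pn (pa (+) pb) m n (a ·j b)
  = partialJ T pm pn pa m n a ·j b
    + sg ((pm (+) pn) * pa) *: (a ·j partialJ T pm pn pb m n b).
Proof.
move=> hm hn ha hb; rewrite /partialJ !(jactM _ ha hb) !ternaryE.
have ham := jact_homog ha hm; have han := jact_homog ha hn.
have hbm := jact_homog hb hm; have hbn := jact_homog hb hn.
rewrite (jmulC (mstar_homog ham hn) hb) (jmulC (mstar_homog hm han) hb).
rewrite (sjt1 T hb ham hn) (sjt1 T hb hm han) (sjt1 T ha hbm hn) (sjt1 T ha hm hbn).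
signed_module two_neq0.
Qed.

(** Acting by a on SJT4 for m, n, r and expanding with SJT2 gives triple products
   in which a has moved to one argument; SJT4 for these makes the two sides
   comparable. The resulting formula yields both the derivation property of
   ∂_{m,n} for the action and the vanishing of I_{a,m,n} on M. *)
Lemma mtri_jact_exchange pm pn pa pr m n a r :
  homog pm m -> homog pn n -> homog pa a -> homog pr r ->
  2 *: (sg (pa * (pm + pn)) *: tri (a • m) n r - sg (pa * pn) *: tri m (a • n) r)
  = sg (pa * (pm + pn)) *: (a • ((m ⋆ n) • r)) - (m ⋆ n) • (a • r)
    + sg (pa * (pm + pn)) *: (((a • m) ⋆ n) • r) - sg (pa * pn) *: ((m ⋆ (a • n)) • r).
Proof.
move=> hm hn ha hr; pose S := sg (pa * (pm + pn)).
have e3 := f_equal (jact T a) (sjt4 T hm hn hr); rewrite !ternaryE in e3.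
apply: (add_eq (- S) (sjt2 T ha hm hn hr)).
apply: (add_eq (S * sg (pm * pn)) (sjt2 T ha hn hm hr)).
apply: (add_eq S e3).
apply: (add_eq S (sjt4 T (jact_homog ha hm) hn hr)).
apply: (add_eq (- sg (pa * pn)) (sjt4 T hm (jact_homog ha hn) hr)).
apply: (add_eq (- 1) (sjt4 T hm hn (jact_homog ha hr))).
rewrite /S; signed_module two_neq0.
Qed.

Lemma partial_jact pm pn pa pr m n a r :
  homog pm m -> homog pn n -> homog pa a -> homog pr r ->
  partialM T m n (a • r)
  = partialJ T pm pn pa m n a • r + sg ((pm (+) pn) * pa) *: (a • partialM T m n r).
Proof.
move=> hm hn ha hr; rewrite /partialM /partialJ !ternaryE (sjt2 T ha hm hn hr).
apply: (add_eq 2^-1 (mtri_jact_exchange hm hn ha hr)).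
signed_module two_neq0.
Qed.

(** SJT5 replaces the two triple products in ∂(r) ⋆ s ± r ⋆ ∂(s) by one term in
   r ⋆ s; the other half of ∂_{m,n}(r ⋆ s) comes from (m ⋆ n) · (r ⋆ s), computed by
   SJT1 in both orders. *)
Lemma partial_mstar pm pn pr ps m n r s :
  homog pm m -> homog pn n -> homog pr r -> homog ps s ->
  partialJ T pm pn (pr (+) ps) m n (r ⋆ s)
  = partialM T m n r ⋆ s + sg ((pm (+) pn) * pr) *: (r ⋆ partialM T m n s).
Proof.
move=> hm hn hr hs; rewrite /partialM /partialJ !ternaryE.
have hmn := mstar_homog hm hn; have hrs := mstar_homog hr hs.
apply: (add_eq 1 (sjt5 T hm hn hr hs)).
apply: (add_eq 1 (sjt1 T hmn hr hs)).
apply: (add_eq (- 1) (jmulC hmn hrs)).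
apply: (add_eq (- sg ((pm (+) pn) * (pr (+) ps))) (sjt1 T hrs hm hn)).
signed_module two_neq0.
Qed.

(** In SJT6 the operator (m, n, -) acts on the middle argument as (n, m, -); the
   sum of both is therefore a derivation. *)
Lemma partialM_sym pm pn pr m n r : homog pm m -> homog pn n -> homog pr r ->
  partialM T m n r = - 2^-1 *: (tri m n r + sg (pm * pn) *: tri n m r).
Proof.
move=> hm hn hr; rewrite /partialM.
apply: (add_eq (- 2^-1) (sjt4 T hm hn hr)); signed_module two_neq0.
Qed.

Lemma partial_mtri pm pn pr ps pt m n r s t :
  homog pm m -> homog pn n -> homog pr r -> homog ps s -> homog pt t ->
  partialM T m n (tri r s t)
  = tri (partialM T m n r) s t
    + sg ((pm (+) pn) * pr) *: tri r (partialM T m n s) t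
    + sg ((pm (+) pn) * (pr + ps)) *: tri r s (partialM T m n t).
Proof.
move=> hm hn hr hs ht.
rewrite (partialM_sym hm hn (mtri_homog hr hs ht)) (partialM_sym hm hn hr).
rewrite (partialM_sym hm hn hs) (partialM_sym hm hn ht) !ternaryE.
rewrite (sjt6 T hm hn hr hs ht) (sjt6 T hn hm hr hs ht).
signed_module two_neq0.
Qed.

Lemma angleJ_anti pa pb a b c :
  angleJ T pa pb a b c = - sg (pa * pb) *: angleJ T pb pa b a c.
Proof. by rewrite /angleJ; signed_module two_neq0. Qed.

Lemma angleM_anti pa pb a b m :
  angleM T pa pb a b m = - sg (pa * pb) *: angleM T pb pa b a m.
Proof. by rewrite /angleM; signed_module two_neq0. Qed.

Lemma partialJ_symm pm pn pa m n a : homog pm m -> homog pn n -> homog pa a ->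
  partialJ T pm pn pa m n a = sg (pm * pn) *: partialJ T pn pm pa n m a.
Proof.
move=> hm hn ha; rewrite /partialJ (mstar_anti T hm (jact_homog ha hn)).
rewrite (mstar_anti T (jact_homog ha hm) hn); signed_module two_neq0.
Qed.

Lemma partialM_symm pm pn pr m n r : homog pm m -> homog pn n -> homog pr r ->
  partialM T m n r = sg (pm * pn) *: partialM T n m r.
Proof.
move=> hm hn hr; rewrite (partialM_sym hm hn hr) (partialM_sym hn hm hr).
signed_module two_neq0.
Qed.

(** The Jordan identity for a, b, c with the argument d in third place. *)
Lemma angleJ_cycle pa pb pc pd a b c d :
  homog pa a -> homog pb b -> homog pc c -> homog pd d ->
  sg (pa * pc) *: angleJ T (pa (+) pb) pc (a ·j b) c d
  + sg (pa * pb) *: angleJ T (pb (+) pc) pa (b ·j c) a d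
  + sg (pb * pc) *: angleJ T (pc (+) pa) pb (c ·j a) b d = 0.
Proof.
move=> ha hb hc hd; rewrite /angleJ.
have hab := jmul_homog ha hb; have hbc := jmul_homog hb hc.
rewrite (jmulC hc ha) !ternaryE; have hac := jmul_homog ha hc.
rewrite (jmulC hc (jmul_homog hab hd)) (jmulC ha (jmul_homog hbc hd)).
rewrite (jmulC hb (jmul_homog hac hd)).
have e := jordan_identity ha hb hd hc.
rewrite (jmulC hd hc) (jmulC (jmul_homog ha hd) hbc) !ternaryE in e.
apply: (add_eq (sg (pa * pc + pc * pd)) e).
signed_module two_neq0.
Qed.

Lemma angleM_cycle pa pb pc a b c m :
  homog pa a -> homog pb b -> homog pc c ->
  sg (pa * pc) *: angleM T (pa (+) pb) pc (a ·j b) c m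
  + sg (pa * pb) *: angleM T (pb (+) pc) pa (b ·j c) a m
  + sg (pb * pc) *: angleM T (pc (+) pa) pb (c ·j a) b m = 0.
Proof.
move=> ha hb hc; rewrite /angleM !(jactM _ ha hb) !(jactM _ hb hc) !(jactM _ hc ha).
rewrite !ternaryE; signed_module two_neq0.
Qed.

(** The element I_{a,m,n} acts on J as 0. *)
Lemma partialJ_jact pa pm pn pc a m n c :
  homog pa a -> homog pm m -> homog pn n -> homog pc c ->
  partialJ T (pa (+) pm) pn pc (a • m) n c
  - sg (pa * pm) *: partialJ T pm (pa (+) pn) pc m (a • n) c
  = (sg (pa * (pm + pn)) * 2) *: angleJ T (pm (+) pn) pa (m ⋆ n) a c.
Proof.
move=> ha hm hn hc; rewrite /angleJ /partialJ.
have hmn := mstar_homog hm hn.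
rewrite (jmulC hmn (jmul_homog ha hc)) (jmulC hmn hc) !ternaryE.
rewrite (sjt1 T (jmul_homog ha hc) hm hn) (sjt1 T hc hm hn) !ternaryE.
rewrite !(jactM _ ha hc) !ternaryE.
have hcm := jact_homog hc hm; have hcn := jact_homog hc hn.
rewrite (sjt1 T ha hcm hn) (sjt1 T ha hm hcn).
signed_module two_neq0.
Qed.

(** The element I_{a,m,n} acts on M as 0. *)
Lemma partialM_jact pa pm pn pr a m n r :
  homog pa a -> homog pm m -> homog pn n -> homog pr r ->
  partialM T (a • m) n r - sg (pa * pm) *: partialM T m (a • n) r
  = (sg (pa * (pm + pn)) * 2) *: angleM T (pm (+) pn) pa (m ⋆ n) a r.
Proof.
move=> ha hm hn hr; rewrite /angleM /partialM.
apply: (add_eq (- 2^-1 * sg (pa * (pm + pn))) (mtri_jact_exchange hm hn ha hr)).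
signed_module two_neq0.
Qed.

End Identities.

Section HomogeneousExtension.
Variables (K : fieldType) (U : superspace K).

Lemma homog_ind (P : U -> Prop) : (forall u v, P u -> P v -> P (u + v)) ->
  (forall p u, homog p u -> P u) -> forall u, P u.
Proof. by move=> PD Ph u; rewrite [u]compE; apply: PD; apply: Ph (comp_homog _ _). Qed.

(** Formulas with signs make sense for homogeneous vectors; this is the linear map
   that such a formula defines. *)
Definition hext (W : lmodType K) (f : bool -> U -> W) (u : U) : W :=
  f false (comp false u) + f true (comp true u).

Lemma hext_linear (W : lmodType K) (f : bool -> U -> W) :
  (forall p, linear (f p)) -> linear (hext f).
Proof.
by move=> hf k u v; rewrite /hext !comp_linear !hf scalerDr addrACA.
Qed.

Lemma hextE (W : lmodType K) (f : bool -> U -> W) p u :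
  (forall p, linear (f p)) -> homog p u -> hext f u = f p u.
Proof.
move=> hf hu; rewrite /hext; case: p hu => hu; rewrite (comp_id hu).
  by rewrite (@comp_0 _ _ false u hu) linear_0 ?add0r.
by rewrite (@comp_0 _ _ true u hu) linear_0 ?addr0.
Qed.

(** The sign (-1)^(p q) for an operator of parity p that passes a vector of
   parity q. *)
Definition parity_twist (p : bool) : U -> U := hext (fun q u => sgn K (p * q) *: u).

Lemma parity_twist_linear p : linear (parity_twist p).
Proof. by apply: hext_linear => q k u v; rewrite scalerDr !scalerA mulrC. Qed.

Lemma parity_twistE p q u : homog q u -> parity_twist p u = sgn K (p * q) *: u.
Proof. by apply: hextE => r k v w; rewrite scalerDr !scalerA mulrC. Qed.

End HomogeneousExtension.

Lemma homog_eq2 (K : fieldType) (U V : superspace K) (W : lmodType K) (f g : U -> V -> W) :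
  bilin f -> bilin g ->
  (forall p q u v, homog p u -> homog q v -> f u v = g u v) ->
  forall u v, f u v = g u v.
Proof.
move=> hf hg e; apply: homog_ind => [u u' IH IH' v|p u hu].
  by rewrite (bilinDl hf) (bilinDl hg) IH IH'.
apply: homog_ind => [v v' IH IH'|q v hv]; last exact: e hu hv.
by rewrite (bilinDr hf) (bilinDr hg) IH IH'.
Qed.

Section BilinearExtension.
Variables (K : fieldType) (U V : superspace K) (W : lmodType K).

Definition hext2 (f : bool -> bool -> U -> V -> W) (u : U) (v : V) : W :=
  hext (fun p u => hext (fun q v => f p q u v) v) u.

Lemma hext2_bilin f : (forall p q, bilin (f p q)) -> bilin (hext2 f).
Proof.
move=> hf; split=> [v|u].
  apply: hext_linear => p k u u'; rewrite /hext !(hf _ _).1 scalerDr addrACA //.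
move=> k v v'; rewrite /hext2 /hext !comp_linear !(hf _ _).2.
by rewrite ![_ *: _ + _ + (_ *: _ + _)]addrACA -!scalerDr [LHS]addrACA -scalerDr.
Qed.

Lemma hext2E f p q u v : (forall p q, bilin (f p q)) -> homog p u -> homog q v ->
  hext2 f u v = f p q u v.
Proof.
move=> hf hu hv; rewrite /hext2 (hextE _ hu); first by rewrite (hextE _ hv) // => r; case: (hf p r).
by move=> r k w w'; rewrite /hext !(hf _ _).1 scalerDr addrACA.
Qed.

End BilinearExtension.

(** * Superderivations and the inner derivations *)

Section Operators.
Variables (K : fieldType) (J M : superspace K) (T : ternary_superalgebra J M).
Hypothesis two_neq0 : 2 != 0 :> K.
Notation sg n := (sgn K n).
Notation "a ·j b" := (jmul T a b) (at level 40).
Notation "a • m" := (jact T a m) (at level 40).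
Notation "m ⋆ n" := (mstar T m n) (at level 40).
Notation tri := (mtri T).
Implicit Types (p q pa pb pc pd pm pn pr ps pt : bool) (a b c d : J) (m n r s t : M).

(** A superderivation of J ⊕ M is kept as the pair of its restrictions. *)
Record superder (p : bool) (DJ : J -> J) (DM : M -> M) : Prop := {
  sd_linJ : linear DJ;
  sd_linM : linear DM;
  sd_homogJ : forall q a, homog q a -> homog (p (+) q) (DJ a);
  sd_homogM : forall q m, homog q m -> homog (p (+) q) (DM m);
  sd_jmul : forall pa pb a b, homog pa a -> homog pb b ->
    DJ (a ·j b) = DJ a ·j b + sg (p * pa) *: (a ·j DJ b);
  sd_jact : forall pa pm a m, homog pa a -> homog pm m ->
    DM (a • m) = DJ a • m + sg (p * pa) *: (a • DM m);
  sd_mstar : forall pm pn m n, homog pm m -> homog pn n ->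
    DJ (m ⋆ n) = DM m ⋆ n + sg (p * pm) *: (m ⋆ DM n);
  sd_mtri : forall pm pn pr m n r, homog pm m -> homog pn n -> homog pr r ->
    DM (tri m n r) = tri (DM m) n r + sg (p * pm) *: tri m (DM n) r
      + sg (p * (pm + pn)) *: tri m n (DM r) }.

Lemma superder_comb p k DJ DM EJ EM FJ FM :
  superder p DJ DM -> superder p EJ EM ->
  (forall a, FJ a = k *: DJ a + EJ a) -> (forall m, FM m = k *: DM m + EM m) ->
  superder p FJ FM.
Proof.
move=> hD hE eJ eM.
have lin_ext (V W : lmodType K) (f g h : V -> W) : linear f -> linear g ->
    (forall v, h v = k *: f v + g v) -> linear h.
  by move=> hf hg e l u v; rewrite !e; exact: linear_comb.
split.
- exact: lin_ext (sd_linJ hD) (sd_linJ hE) eJ.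
- exact: lin_ext (sd_linM hD) (sd_linM hE) eM.
- move=> q a ha; rewrite eJ.
  exact: homog_lin (sd_homogJ hD ha) (sd_homogJ hE ha).
- move=> q m hm; rewrite eM.
  exact: homog_lin (sd_homogM hD hm) (sd_homogM hE hm).
- move=> pa pb a b ha hb; rewrite !eJ (sd_jmul hD ha hb) (sd_jmul hE ha hb).
  rewrite !(ternaryE T) !scalerDr !scalerA mulrC; exact: addrACA.
- move=> pa pm a m ha hm; rewrite !eJ !eM (sd_jact hD ha hm) (sd_jact hE ha hm).
  rewrite !(ternaryE T) !scalerDr !scalerA mulrC; exact: addrACA.
- move=> pm pn m n hm hn; rewrite !eJ !eM (sd_mstar hD hm hn) (sd_mstar hE hm hn).
  rewrite !(ternaryE T) !scalerDr !scalerA mulrC; exact: addrACA.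
- move=> pm pn pr m n r hm hn hr; rewrite !eM (sd_mtri hD hm hn hr) (sd_mtri hE hm hn hr).
  rewrite !(ternaryE T); module_coefs K; ring.
Qed.

Lemma superder_0 p : superder p (fun=> 0) (fun=> 0).
Proof.
have lin0 (U W : lmodType K) : linear (fun _ : U => 0 : W).
  by move=> k u v; rewrite scaler0 addr0.
split=> //= *; try exact: homog0.
- by rewrite !(ternaryE T) scaler0 addr0.
- by rewrite !(ternaryE T) scaler0 addr0.
- by rewrite !(ternaryE T) scaler0 addr0.
- by rewrite (bilin0l (mtri_bilin12 T _)) (bilin0r (mtri_bilin12 T _))
    (bilin0r (mtri_bilin23 T _)) !scaler0 !addr0.
Qed.

Lemma angleJ_bilin pa pb c : bilin (fun a b => angleJ T pa pb a b c).
Proof.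
by split=> [b k a a'|a k b b']; rewrite /angleJ !(ternaryE T); module_coefs K; ring.
Qed.
Lemma angleJ_linear pa pb a b : linear (angleJ T pa pb a b).
Proof. by move=> k c d; rewrite /angleJ !(ternaryE T); module_coefs K; ring. Qed.
Lemma angleM_bilin pa pb m : bilin (fun a b => angleM T pa pb a b m).
Proof.
by split=> [b k a a'|a k b b']; rewrite /angleM !(ternaryE T); module_coefs K; ring.
Qed.
Lemma angleM_linear pa pb a b : linear (angleM T pa pb a b).
Proof. by move=> k m n; rewrite /angleM !(ternaryE T); module_coefs K; ring. Qed.
Lemma partialJ_bilin pm pn pa a : bilin (fun m n => partialJ T pm pn pa m n a).
Proof.
by split=> [n k m m'|m k n n']; rewrite /partialJ !(ternaryE T); module_coefs K; ring.
Qed.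
Lemma partialJ_linear pm pn pa m n : linear (partialJ T pm pn pa m n).
Proof. by move=> k a b; rewrite /partialJ !(ternaryE T); module_coefs K; ring. Qed.
Lemma partialM_bilin r : bilin (fun m n => partialM T m n r).
Proof.
by split=> [n k m m'|m k n n']; rewrite /partialM !(ternaryE T); module_coefs K; ring.
Qed.
Lemma partialM_linear m n : linear (partialM T m n).
Proof. by move=> k r s; rewrite /partialM !(ternaryE T); module_coefs K; ring. Qed.

Lemma angleJ_homog pa pb pc a b c : homog pa a -> homog pb b -> homog pc c ->
  homog (pa (+) pb (+) pc) (angleJ T pa pb a b c).
Proof.
move=> ha hb hc; apply: homogB; first by rewrite -addbA; do !apply: jmul_homog.
by rewrite [pa (+) pb]addbC -addbA; apply: homogZ; do !apply: jmul_homog.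
Qed.
Lemma angleM_homog pa pb pm a b m : homog pa a -> homog pb b -> homog pm m ->
  homog (pa (+) pb (+) pm) (angleM T pa pb a b m).
Proof.
move=> ha hb hc; apply: homogZ.
apply: homogB; first by rewrite -addbA; do !apply: jact_homog.
by rewrite [pa (+) pb]addbC -addbA; apply: homogZ; do !apply: jact_homog.
Qed.
Lemma partialJ_homog pm pn pa m n a : homog pm m -> homog pn n -> homog pa a ->
  homog (pm (+) pn (+) pa) (partialJ T pm pn pa m n a).
Proof.
move=> hm hn ha; apply/homogZ/homogB; apply: homogZ.
  by rewrite addbC addbA; apply: mstar_homog => //; apply: jact_homog.
rewrite -addbA [pn (+) pa]addbC; apply: mstar_homog => //; exact: jact_homog.
Qed.

(** The operators extended bilinearly to arguments without a parity. *)
Definition ext_angleJ a b c := hext2 (fun pa pb a b => angleJ T pa pb a b c) a b.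
Definition ext_angleM a b m := hext2 (fun pa pb a b => angleM T pa pb a b m) a b.
Definition ext_partialJ m n a :=
  hext2 (fun pm pn m n => hext (fun pa => partialJ T pm pn pa m n) a) m n.

Lemma ext_angleJ_bilin c : bilin (fun a b => ext_angleJ a b c).
Proof. by apply: hext2_bilin => p q; exact: angleJ_bilin. Qed.
Lemma ext_angleM_bilin m : bilin (fun a b => ext_angleM a b m).
Proof. by apply: hext2_bilin => p q; exact: angleM_bilin. Qed.

Let hext_partialJ_bilin p q a :
  bilin (fun m n => hext (fun pa => partialJ T p q pa m n) a).
Proof.
by split=> [n k m m'|m k n n']; rewrite /hext;
  rewrite !(partialJ_bilin _ _ _ _).1 + rewrite !(partialJ_bilin _ _ _ _).2;
  rewrite scalerDr addrACA.
Qed.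

Lemma ext_partialJ_bilin a : bilin (fun m n => ext_partialJ m n a).
Proof. by apply: hext2_bilin => p q; exact: hext_partialJ_bilin. Qed.

Lemma ext_angleJE pa pb a b c : homog pa a -> homog pb b ->
  ext_angleJ a b c = angleJ T pa pb a b c.
Proof. by apply: hext2E => p q; exact: angleJ_bilin. Qed.
Lemma ext_angleME pa pb a b m : homog pa a -> homog pb b ->
  ext_angleM a b m = angleM T pa pb a b m.
Proof. by apply: hext2E => p q; exact: angleM_bilin. Qed.
Lemma ext_partialJE pm pn pa m n a : homog pm m -> homog pn n -> homog pa a ->
  ext_partialJ m n a = partialJ T pm pn pa m n a.
Proof.
move=> hm hn ha; rewrite /ext_partialJ (hext2E (fun p q => hext_partialJ_bilin p q a) hm hn).
by apply: hextE ha => p; exact: partialJ_linear.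
Qed.

Lemma ext_angleJ_linear a b : linear (ext_angleJ a b).
Proof.
by move=> k c d; rewrite /ext_angleJ /hext2 /hext !angleJ_linear; module_coefs K; ring.
Qed.
Lemma ext_angleM_linear a b : linear (ext_angleM a b).
Proof.
by move=> k c d; rewrite /ext_angleM /hext2 /hext !angleM_linear; module_coefs K; ring.
Qed.
Lemma ext_partialJ_linear m n : linear (ext_partialJ m n).
Proof.
move=> k a b; rewrite /ext_partialJ /hext2 /hext !comp_linear !partialJ_linear.
by module_coefs K; ring.
Qed.

Lemma superder_angle pa pb a b : homog pa a -> homog pb b ->
  superder (pa (+) pb) (ext_angleJ a b) (ext_angleM a b).
Proof.
move=> ha hb.
have eJ c := ext_angleJE c ha hb; have eM m := ext_angleME m ha hb.
split.
- exact: ext_angleJ_linear.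
- exact: ext_angleM_linear.
- by move=> q c hc; rewrite eJ; apply: angleJ_homog.
- by move=> q m hm; rewrite eM; apply: angleM_homog.
- by move=> pc pd c d hc hd; rewrite !eJ (angle_jmul T two_neq0 ha hb hc hd).
- by move=> pc pm c m hc hm; rewrite eJ !eM (angle_jact T two_neq0 m ha hb hc).
- by move=> pm pn m n hm hn; rewrite eJ !eM (angle_mstar T two_neq0 ha hb hm hn).
- by move=> pm pn pr m n r hm hn hr; rewrite !eM (angle_mtri T two_neq0 ha hb hm hn hr).
Qed.

Lemma superder_partial pm pn m n : homog pm m -> homog pn n ->
  superder (pm (+) pn) (ext_partialJ m n) (partialM T m n).
Proof.
move=> hm hn; have eJ pa a (ha : homog pa a) := ext_partialJE hm hn ha.
split.
- exact: ext_partialJ_linear.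
- exact: partialM_linear.
- by move=> q c hc; rewrite (eJ _ _ hc); apply: partialJ_homog.
- by move=> q r hr; apply: partialM_homog.
- move=> pa pb a b ha hb.
  rewrite (eJ _ _ (jmul_homog T ha hb)) (eJ _ _ ha) (eJ _ _ hb).
  exact: (partial_jmul T two_neq0 hm hn ha hb).
- by move=> pa pr a r ha hr; rewrite (eJ _ _ ha) (partial_jact T two_neq0 hm hn ha hr).
- move=> pr ps r s hr hs.
  by rewrite (eJ _ _ (mstar_homog T hr hs)) (partial_mstar T two_neq0 hm hn hr hs).
- by move=> pr ps pt r s t hr hs ht; exact: (partial_mtri T two_neq0 hm hn hr hs ht).
Qed.

(** The four formulas below expand [D, <a, b>] and [D, ∂_{m,n}] for a superderivation
   D. They are why R^s is stable under D and why I_{m,n,r,s} acts as 0. *)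
Lemma superder_angleJ p DJ DM pa pb pc a b c : superder p DJ DM ->
  homog pa a -> homog pb b -> homog pc c ->
  DJ (angleJ T pa pb a b c)
  = angleJ T (p (+) pa) pb (DJ a) b c + sg (p * pa) *: angleJ T pa (p (+) pb) a (DJ b) c
    + sg (p * (pa + pb)) *: angleJ T pa pb a b (DJ c).
Proof.
move=> hD ha hb hc; have hL := sd_linJ hD; rewrite /angleJ.
rewrite (linear_D hL) (linear_N hL) (linear_Z hL).
rewrite (sd_jmul hD ha (jmul_homog T hb hc)) (sd_jmul hD hb (jmul_homog T ha hc)).
rewrite (sd_jmul hD hb hc) (sd_jmul hD ha hc) !(ternaryE T).
signed_module two_neq0.
Qed.

Lemma superder_angleM p DJ DM pa pb pm a b m : superder p DJ DM ->
  homog pa a -> homog pb b -> homog pm m ->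
  DM (angleM T pa pb a b m)
  = angleM T (p (+) pa) pb (DJ a) b m + sg (p * pa) *: angleM T pa (p (+) pb) a (DJ b) m
    + sg (p * (pa + pb)) *: angleM T pa pb a b (DM m).
Proof.
move=> hD ha hb hm; have hL := sd_linM hD; rewrite /angleM.
rewrite (linear_Z hL) (linear_D hL) (linear_N hL) (linear_Z hL).
rewrite (sd_jact hD ha (jact_homog T hb hm)) (sd_jact hD hb (jact_homog T ha hm)).
rewrite (sd_jact hD hb hm) (sd_jact hD ha hm) !(ternaryE T).
signed_module two_neq0.
Qed.

Lemma superder_partialJ p DJ DM pm pn pa m n a : superder p DJ DM ->
  homog pm m -> homog pn n -> homog pa a ->
  DJ (partialJ T pm pn pa m n a)
  = partialJ T (p (+) pm) pn pa (DM m) n a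
    + sg (p * pm) *: partialJ T pm (p (+) pn) pa m (DM n) a
    + sg (p * (pm + pn)) *: partialJ T pm pn (p (+) pa) m n (DJ a).
Proof.
move=> hD hm hn ha; have hL := sd_linJ hD; rewrite /partialJ.
rewrite (linear_Z hL) (linear_D hL) (linear_N hL) !(linear_Z hL).
rewrite (sd_mstar hD (jact_homog T ha hm) hn) (sd_mstar hD hm (jact_homog T ha hn)).
rewrite (sd_jact hD ha hm) (sd_jact hD ha hn) !(ternaryE T).
signed_module two_neq0.
Qed.

Lemma superder_partialM p DJ DM pm pn pr m n r : superder p DJ DM ->
  homog pm m -> homog pn n -> homog pr r ->
  DM (partialM T m n r)
  = partialM T (DM m) n r + sg (p * pm) *: partialM T m (DM n) r
    + sg (p * (pm + pn)) *: partialM T m n (DM r).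
Proof.
move=> hD hm hn hr; have hL := sd_linM hD; rewrite /partialM.
rewrite (linear_D hL) (linear_N hL) (linear_Z hL) (sd_mtri hD hm hn hr).
rewrite (sd_jact hD (mstar_homog T hm hn) hr) (sd_mstar hD hm hn) !(ternaryE T).
signed_module two_neq0.
Qed.

End Operators.

(** * The action of the space B on J, M and itself *)

Section MapsFromB.
Variables (K : fieldType) (J M : superspace K) (T : ternary_superalgebra J M).
Hypothesis two_neq0 : 2 != 0 :> K.
Notation sg n := (sgn K n).
Notation "a ·j b" := (jmul T a b) (at level 40).
Notation "a • m" := (jact T a m) (at level 40).
Notation "m ⋆ n" := (mstar T m n) (at level 40).
Implicit Types (p pa pb pc pd pm pn pr ps pt : bool) (a b c d : J) (m n r s t : M).

Lemma jj_bilin : bilin (@jj K J M).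
Proof.
have [hl hr] := tensor_bilin J J.
by split=> [b k a a'|a k b b']; apply: injective_projections;
  rewrite /= ?hl ?hr ?scaler0 ?addr0.
Qed.
Lemma mm_bilin : bilin (@mm K J M).
Proof.
have [hl hr] := tensor_bilin M M.
by split=> [b k a a'|a k b b']; apply: injective_projections;
  rewrite /= ?hl ?hr ?scaler0 ?addr0.
Qed.
Lemma clJ_bilin : bilin (clJ T).
Proof.
by split=> [b k a a'|a k b b']; rewrite /clJ -qclass_linear; congr qclass;
  rewrite ?jj_bilin.1 ?jj_bilin.2.
Qed.
Lemma clM_bilin : bilin (clM T).
Proof.
by split=> [b k a a'|a k b b']; rewrite /clM -qclass_linear; congr qclass;
  rewrite ?mm_bilin.1 ?mm_bilin.2.
Qed.

Inductive B_gen (p : bool) : Bs T -> Prop :=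
  | B_genJ pa pb a b : homog pa a -> homog pb b -> pa (+) pb = p -> B_gen p (clJ T a b)
  | B_genM pm pn m n : homog pm m -> homog pn n -> pm (+) pn = p -> B_gen p (clM T m n).

Lemma B_span p q : homog p q -> span (B_gen p) q.
Proof.
case=> -[t u] [/= ht hu] ->.
have inclJ k (v w : tensor_superspace J J) : qclass (Rs T) (k *: v + w, 0)
    = k *: qclass (Rs T) (v, 0) + qclass (Rs T) (w, 0).
  rewrite -qclass_linear; congr qclass.
  by apply: injective_projections; rewrite //= scaler0 addr0.
have inclM k (v w : tensor_superspace M M) : qclass (Rs T) (0, k *: v + w)
    = k *: qclass (Rs T) (0, v) + qclass (Rs T) (0, w).
  rewrite -qclass_linear; congr qclass.
  by apply: injective_projections; rewrite //= scaler0 addr0.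
have -> : qclass (Rs T) (t, u) = 1 *: qclass (Rs T) (t, 0) + qclass (Rs T) (0, u).
  rewrite -qclass_linear scale1r; congr qclass.
  by apply: injective_projections; rewrite /= ?addr0 ?add0r.
apply: span_lin.
  move: t ht; refine (span_ind (P := fun x => span (B_gen p) (qclass (Rs T) (x, 0))) _ _).
    by rewrite qclass0; exact: span0.
  move=> k _ x [pa [pb [a [b [ha hb e ->]]]]] IH; rewrite inclJ.
  by apply: span_lin IH; apply: span_gen; apply: B_genJ ha hb e.
move: u hu; refine (span_ind (P := fun x => span (B_gen p) (qclass (Rs T) (0, x))) _ _).
  by rewrite qclass0; exact: span0.
move=> k _ x [pa [pb [a [b [ha hb e ->]]]]] IH; rewrite inclM.
by apply: span_lin IH; apply: span_gen; apply: B_genM ha hb e.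
Qed.

Lemma B_eq (W : lmodType K) (f g : Bs T -> W) : linear f -> linear g ->
  (forall p q, B_gen p q -> f q = g q) -> f =1 g.
Proof.
move=> hf hg h; apply: homog_ind => [u v eu ev|p q /B_span].
  by rewrite !linear_D // eu ev.
by apply: span_eq => // v; exact: h.
Qed.

(** A linear map on B is given by f on J ⊗ J and g on M ⊗ M that respect the
   relations. The instances are the actions on J and M, the classes themselves,
   and the actions of derivations on classes. *)
Record respects_Rs (W : lmodType K) (f : J -> J -> W) (g : M -> M -> W) : Prop := {
  rRs_ab : forall pa pb a b, homog pa a -> homog pb b ->
    f a b + sg (pa * pb) *: f b a = 0;
  rRs_mn : forall pm pn m n, homog pm m -> homog pn n ->
    g m n - sg (pm * pn) *: g n m = 0;
  rRs_abc : forall pa pb pc a b c, homog pa a -> homog pb b -> homog pc c ->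
    sg (pa * pc) *: f (a ·j b) c + sg (pa * pb) *: f (b ·j c) a
    + sg (pb * pc) *: f (c ·j a) b = 0;
  rRs_amn : forall pa pm pn a m n, homog pa a -> homog pm m -> homog pn n ->
    g (a • m) n - sg (pa * pm) *: g m (a • n)
    - (sg (pa * (pm + pn)) * 2) *: f (m ⋆ n) a = 0;
  rRs_mnrs : forall pm pn pr ps m n r s,
    homog pm m -> homog pn n -> homog pr r -> homog ps s ->
    g (partialM T m n r) s + sg ((pm + pn) * pr) *: g r (partialM T m n s)
    + sg ((pm + pn) * (pr + ps)) *: g (partialM T r s m) n
    + sg ((pr + ps) * pn) *: g m (partialM T r s n) = 0 }.

Lemma respects_Rs_D (W : lmodType K) (f f' f'' : J -> J -> W) (g g' g'' : M -> M -> W) :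
  respects_Rs f g -> respects_Rs f' g' ->
  (forall a b, f'' a b = f a b + f' a b) -> (forall m n, g'' m n = g m n + g' m n) ->
  respects_Rs f'' g''.
Proof.
move=> h h' ef eg; split.
- move=> pa pb a b ha hb; rewrite !ef.
  apply: (add_eq 1 (rRs_ab h ha hb)); apply: (add_eq 1 (rRs_ab h' ha hb)).
  signed_module two_neq0.
- move=> pm pn m n hm hn; rewrite !eg.
  apply: (add_eq 1 (rRs_mn h hm hn)); apply: (add_eq 1 (rRs_mn h' hm hn)).
  signed_module two_neq0.
- move=> pa pb pc a b c ha hb hc; rewrite !ef.
  apply: (add_eq 1 (rRs_abc h ha hb hc)); apply: (add_eq 1 (rRs_abc h' ha hb hc)).
  signed_module two_neq0.
- move=> pa pm pn a m n ha hm hn; rewrite !ef !eg.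
  apply: (add_eq 1 (rRs_amn h ha hm hn)); apply: (add_eq 1 (rRs_amn h' ha hm hn)).
  signed_module two_neq0.
- move=> pm pn pr ps m n r s hm hn hr hs; rewrite !eg.
  apply: (add_eq 1 (rRs_mnrs h hm hn hr hs)); apply: (add_eq 1 (rRs_mnrs h' hm hn hr hs)).
  signed_module two_neq0.
Qed.

(* Locked, lest its values be unfolded into sums by the rewriting of sums. *)
Definition B_lift (W : lmodType K) (f : J -> J -> W) (g : M -> M -> W) : Bs T -> W :=
  locked (fun q => let x : JJMM J M := repr (q : quotmod (Rs T)) in
                   tensor_lift f x.1 + tensor_lift g x.2).

Lemma B_liftP (W : lmodType K) (f : J -> J -> W) (g : M -> M -> W) :
  bilin f -> bilin g -> respects_Rs f g ->
  [/\ linear (B_lift f g), forall a b, B_lift f g (clJ T a b) = f a b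
    & forall m n, B_lift f g (clM T m n) = g m n].
Proof.
move=> hf hg h; have [Lf Ef] := tensor_liftP hf; have [Lg Eg] := tensor_liftP hg.
pose F (x : JJMM J M) := tensor_lift f x.1 + tensor_lift g x.2.
have LF : linear F.
  by move=> k u v; rewrite /F /= Lf Lg scalerDr addrACA.
have FJ a b : F (jj M a b) = f a b by rewrite /F /= Ef (linear_0 Lg) addr0.
have FM m n : F (mm J m n) = g m n by rewrite /F /= Eg (linear_0 Lf) add0r.
have F0 x : Rs T x -> F x = 0.
  case=> [pa pb a b ha hb|pm pn m n hm hn|pa pb pc a b c ha hb hc
    |pa pm pn a m n ha hm hn|pm pn pr q m n r t hm hn hr ht];
  rewrite !(linear_D LF, linear_N LF, linear_Z LF) !(FJ, FM).
  - exact: rRs_ab h _ _ _ _ ha hb.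
  - exact: rRs_mn h _ _ _ _ hm hn.
  - exact: rRs_abc h _ _ _ _ _ _ ha hb hc.
  - exact: rRs_amn h _ _ _ _ _ _ ha hm hn.
  - exact: rRs_mnrs h _ _ _ _ _ _ _ _ hm hn hr ht.
have [L E] := qlift_linear LF F0.
by rewrite /B_lift -lock; split=> [|a b|m n]; [exact: L|rewrite -FJ -E|rewrite -FM -E].
Qed.

(** The last relation is [D, E] + [E, D] = 0 up to sign, for D = ∂_{m,n} and
   E = ∂_{r,s}. *)
Lemma respects_Rs_J c :
  respects_Rs (fun a b => ext_angleJ T a b c) (fun m n => ext_partialJ T m n c).
Proof.
move: c; apply: homog_ind => [c d hc hd|pc c hc].
  apply: respects_Rs_D hc hd _ _ => *.
    exact: linear_D (ext_angleJ_linear T _ _) _ _.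
  exact: linear_D (ext_partialJ_linear T _ _) _ _.
split.
- move=> pa pb a b ha hb; rewrite (ext_angleJE T c ha hb) (ext_angleJE T c hb ha).
  by rewrite (angleJ_anti T two_neq0 pa pb); signed_module two_neq0.
- move=> pm pn m n hm hn; rewrite (ext_partialJE T hm hn hc) (ext_partialJE T hn hm hc).
  by rewrite (partialJ_symm T two_neq0 hm hn hc) subrr.
- move=> pa pb pd a b d ha hb hd.
  rewrite (ext_angleJE T c (jmul_homog T ha hb) hd) (ext_angleJE T c (jmul_homog T hb hd) ha).
  by rewrite (ext_angleJE T c (jmul_homog T hd ha) hb) (angleJ_cycle T two_neq0 ha hb hd hc).
- move=> pa pm pn a m n ha hm hn.
  rewrite (ext_partialJE T (jact_homog T ha hm) hn hc).
  rewrite (ext_partialJE T hm (jact_homog T ha hn) hc).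
  rewrite (partialJ_jact T two_neq0 ha hm hn hc).
  by rewrite (ext_angleJE T c (mstar_homog T hm hn) ha) subrr.
- move=> pm pn pr ps m n r s hm hn hr hs.
  have D1 := superder_partial T two_neq0 hm hn; have D2 := superder_partial T two_neq0 hr hs.
  have e1 := superder_partialJ two_neq0 D1 hr hs hc.
  have e2 := superder_partialJ two_neq0 D2 hm hn hc.
  have h1 := sd_homogM D1; have h2 := sd_homogM D2.
  rewrite (ext_partialJE T (h1 _ _ hr) hs hc) (ext_partialJE T hr (h1 _ _ hs) hc).
  rewrite (ext_partialJE T (h2 _ _ hm) hn hc) (ext_partialJE T hm (h2 _ _ hn) hc).
  have hrs := partialJ_homog T hr hs hc; have hmn := partialJ_homog T hm hn hc.
  rewrite (ext_partialJE T hm hn hrs) (ext_partialJE T hm hn hc) in e1.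
  rewrite (ext_partialJE T hr hs hmn) (ext_partialJE T hr hs hc) in e2.
  apply: (add_eq (- 1) e1).
  apply: (add_eq (- sg ((pm + pn) * (pr + ps))) e2).
  signed_module two_neq0.
Qed.

Lemma respects_Rs_M r :
  respects_Rs (fun a b => ext_angleM T a b r) (fun m n => partialM T m n r).
Proof.
move: r; apply: homog_ind => [r s hr hs|pt t ht].
  apply: respects_Rs_D hr hs _ _ => *.
    exact: linear_D (ext_angleM_linear T _ _) _ _.
  exact: linear_D (partialM_linear T _ _) _ _.
split.
- move=> pa pb a b ha hb; rewrite (ext_angleME T t ha hb) (ext_angleME T t hb ha).
  by rewrite (angleM_anti T two_neq0 pa pb); signed_module two_neq0.
- by move=> pm pn m n hm hn; rewrite (partialM_symm T two_neq0 hm hn ht) subrr.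
- move=> pa pb pd a b d ha hb hd.
  rewrite (ext_angleME T t (jmul_homog T ha hb) hd) (ext_angleME T t (jmul_homog T hb hd) ha).
  by rewrite (ext_angleME T t (jmul_homog T hd ha) hb) (angleM_cycle T two_neq0 t ha hb hd).
- move=> pa pm pn a m n ha hm hn.
  rewrite (partialM_jact T two_neq0 ha hm hn ht).
  by rewrite (ext_angleME T t (mstar_homog T hm hn) ha) subrr.
- move=> pm pn pr ps m n r s hm hn hr hs.
  have D1 := superder_partial T two_neq0 hm hn; have D2 := superder_partial T two_neq0 hr hs.
  apply: (add_eq (- 1) (superder_partialM two_neq0 D1 hr hs ht)).
  apply: (add_eq (- sg ((pm + pn) * (pr + ps))) (superder_partialM two_neq0 D2 hm hn ht)).
  signed_module two_neq0.
Qed.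

Definition B_actJ (q : Bs T) (c : J) : J :=
  B_lift (fun a b => ext_angleJ T a b c) (fun m n => ext_partialJ T m n c) q.
Definition B_actM (q : Bs T) (r : M) : M :=
  B_lift (fun a b => ext_angleM T a b r) (fun m n => partialM T m n r) q.

Lemma B_actJE c : [/\ linear (B_actJ^~ c),
    forall a b, B_actJ (clJ T a b) c = ext_angleJ T a b c
  & forall m n, B_actJ (clM T m n) c = ext_partialJ T m n c].
Proof.
exact: B_liftP (ext_angleJ_bilin T c) (ext_partialJ_bilin T c) (respects_Rs_J c).
Qed.

Lemma B_actME r : [/\ linear (B_actM^~ r),
    forall a b, B_actM (clJ T a b) r = ext_angleM T a b r
  & forall m n, B_actM (clM T m n) r = partialM T m n r].
Proof.
exact: B_liftP (ext_angleM_bilin T r) (partialM_bilin T r) (respects_Rs_M r).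
Qed.

Lemma B_actJ_linl c : linear (B_actJ^~ c).
Proof. by case: (B_actJE c). Qed.
Lemma B_actM_linl r : linear (B_actM^~ r).
Proof. by case: (B_actME r). Qed.
Lemma B_actJ_clJ a b c : B_actJ (clJ T a b) c = ext_angleJ T a b c.
Proof. by case: (B_actJE c). Qed.
Lemma B_actJ_clM m n c : B_actJ (clM T m n) c = ext_partialJ T m n c.
Proof. by case: (B_actJE c). Qed.
Lemma B_actM_clJ a b r : B_actM (clJ T a b) r = ext_angleM T a b r.
Proof. by case: (B_actME r). Qed.
Lemma B_actM_clM m n r : B_actM (clM T m n) r = partialM T m n r.
Proof. by case: (B_actME r). Qed.

Lemma B_actJ_bilin : bilin B_actJ.
Proof.
split=> [c|q]; first exact: B_actJ_linl.
move=> k c d; move: q; apply: B_eq.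
- exact: B_actJ_linl.
- by apply: linear_comb; exact: B_actJ_linl.
- move=> p _ [pa pb a b _ _ _|pm pn m n _ _ _].
    by rewrite !B_actJ_clJ ext_angleJ_linear.
  by rewrite !B_actJ_clM ext_partialJ_linear.
Qed.

Lemma B_actM_bilin : bilin B_actM.
Proof.
split=> [r|q]; first exact: B_actM_linl.
move=> k r s; move: q; apply: B_eq.
- exact: B_actM_linl.
- by apply: linear_comb; exact: B_actM_linl.
- move=> p _ [pa pb a b _ _ _|pm pn m n _ _ _].
    by rewrite !B_actM_clJ ext_angleM_linear.
  by rewrite !B_actM_clM partialM_linear.
Qed.

(** The spanning classes act by inner derivations, which are superderivations. *)
Lemma superder_B p q : homog p q -> superder T p (B_actJ q) (B_actM q).
Proof.
move/B_span; move: q; apply: (span_ind (P := fun q => superder T p (B_actJ q) (B_actM q))).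
  apply: (superder_comb (k := 0) (superder_0 T p) (superder_0 T p)) => [c|r].
    by rewrite scaler0 addr0 (bilin0l B_actJ_bilin).
  by rewrite scaler0 addr0 (bilin0l B_actM_bilin).
move=> k u v hu hv.
suff hu' : superder T p (B_actJ u) (B_actM u).
  apply: (superder_comb (k := k) hu' hv) => [c|r]; [exact: B_actJ_linl|exact: B_actM_linl].
case: hu => [pa pb a b ha hb <-|pm pn m n hm hn <-].
  have hD := superder_angle T two_neq0 ha hb.
  apply: (superder_comb (k := 0) hD hD) => [c|r]; rewrite scale0r add0r.
    exact: B_actJ_clJ.
  exact: B_actM_clJ.
have hD := superder_partial T two_neq0 hm hn.
apply: (superder_comb (k := 0) hD hD) => [c|r]; rewrite scale0r add0r.
  exact: B_actJ_clM.
exact: B_actM_clM.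
Qed.

Lemma respects_Rs_cl : respects_Rs (clJ T) (clM T).
Proof.
have L := @qclass_linear K (JJMM J M) (Rs T).
have cl0 x : Rs T x -> qclass (Rs T) x = 0.
  by move=> hx; rewrite -(qclass0 (Rs T)); apply/qclassP; rewrite subr0; exact: span_gen.
split.
- move=> pa pb a b ha hb; move: (cl0 _ (Rs_ab T ha hb)).
  by rewrite !(linear_D L, linear_N L, linear_Z L).
- move=> pm pn m n hm hn; move: (cl0 _ (Rs_mn T hm hn)).
  by rewrite !(linear_D L, linear_N L, linear_Z L).
- move=> pa pb pc a b c ha hb hc; move: (cl0 _ (Rs_abc T ha hb hc)).
  by rewrite !(linear_D L, linear_N L, linear_Z L).
- move=> pa pm pn a m n ha hm hn; move: (cl0 _ (Rs_amn T ha hm hn)).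
  by rewrite !(linear_D L, linear_N L, linear_Z L).
- move=> pm pn pr ps m n r s hm hn hr hs; move: (cl0 _ (Rs_mnrs T hm hn hr hs)).
  by rewrite !(linear_D L, linear_N L, linear_Z L).
Qed.

Definition clE := (bilinE clJ_bilin, bilinE clM_bilin).

(** The action D({z1 ⊗ z2}) = {D(z1) ⊗ z2} + (-1)^(|D||z1|) {z1 ⊗ D(z2)}, for z1
   without a parity. *)
Definition B_der (p : bool) (DJ : J -> J) (DM : M -> M) : Bs T -> Bs T :=
  B_lift (fun c d => clJ T (DJ c) d + clJ T (parity_twist p c) (DJ d))
         (fun r s => clM T (DM r) s + clM T (parity_twist p r) (DM s)).

Section Derivation.
Variables (p : bool) (DJ : J -> J) (DM : M -> M).
Hypothesis hD : superder T p DJ DM.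

Let twist (V : superspace K) q (v : V) (hv : homog q v) := parity_twistE p hv.

(** A superderivation maps each generator of R^s to a sum of generators of the
   same kind, one for each argument. *)
Lemma respects_Rs_der :
  respects_Rs (fun c d => clJ T (DJ c) d + clJ T (parity_twist p c) (DJ d))
    (fun r s => clM T (DM r) s + clM T (parity_twist p r) (DM s)).
Proof.
have h := respects_Rs_cl; have hJ := sd_homogJ hD; have hM := sd_homogM hD.
split.
- move=> pa pb a b ha hb; rewrite (twist ha) (twist hb) !clE.
  apply: (add_eq 1 (rRs_ab h (hJ _ _ ha) hb)).
  apply: (add_eq (sg (p * pa)) (rRs_ab h ha (hJ _ _ hb))).
  signed_module two_neq0.
- move=> pm pn m n hm hn; rewrite (twist hm) (twist hn) !clE.
  apply: (add_eq 1 (rRs_mn h (hM _ _ hm) hn)).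
  apply: (add_eq (sg (p * pm)) (rRs_mn h hm (hM _ _ hn))).
  signed_module two_neq0.
- move=> pa pb pc a b c ha hb hc.
  rewrite (twist (jmul_homog T ha hb)) (twist (jmul_homog T hb hc)).
  rewrite (twist (jmul_homog T hc ha)).
  rewrite (sd_jmul hD ha hb) (sd_jmul hD hb hc) (sd_jmul hD hc ha) !clE.
  apply: (add_eq (sg (p * pc)) (rRs_abc h (hJ _ _ ha) hb hc)).
  apply: (add_eq (sg (p * pa)) (rRs_abc h ha (hJ _ _ hb) hc)).
  apply: (add_eq (sg (p * pb)) (rRs_abc h ha hb (hJ _ _ hc))).
  signed_module two_neq0.
- move=> pa pm pn a m n ha hm hn.
  rewrite (twist (jact_homog T ha hm)) (twist hm) (twist (mstar_homog T hm hn)).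
  rewrite (sd_jact hD ha hm) (sd_jact hD ha hn) (sd_mstar hD hm hn) !clE.
  apply: (add_eq 1 (rRs_amn h (hJ _ _ ha) hm hn)).
  apply: (add_eq (sg (p * pa)) (rRs_amn h ha (hM _ _ hm) hn)).
  apply: (add_eq (sg (p * (pa + pm))) (rRs_amn h ha hm (hM _ _ hn))).
  signed_module two_neq0.
- move=> pm pn pr ps m n r s hm hn hr hs.
  rewrite (twist (partialM_homog T hm hn hr)) (twist (partialM_homog T hr hs hm)).
  rewrite (twist hr) (twist hm).
  rewrite (superder_partialM two_neq0 hD hm hn hr) (superder_partialM two_neq0 hD hm hn hs).
  rewrite (superder_partialM two_neq0 hD hr hs hm) (superder_partialM two_neq0 hD hr hs hn).
  have em := rRs_mnrs h (hM _ _ hm) hn hr hs; have en := rRs_mnrs h hm (hM _ _ hn) hr hs.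
  have er := rRs_mnrs h hm hn (hM _ _ hr) hs; have es := rRs_mnrs h hm hn hr (hM _ _ hs).
  (* Once generalized, the inner derivations are not unfolded into sums. *)
  move: (partialM T) em en er es => P em en er es; rewrite !clE.
  apply: (add_eq 1 em); apply: (add_eq (sg (p * pm)) en).
  apply: (add_eq (sg (p * (pm + pn))) er); apply: (add_eq (sg (p * (pm + pn + pr))) es).
  signed_module two_neq0.
Qed.

Lemma B_derE : [/\ linear (B_der p DJ DM),
    forall q a b, homog q a ->
      B_der p DJ DM (clJ T a b) = clJ T (DJ a) b + sg (p * q) *: clJ T a (DJ b)
  & forall q m n, homog q m ->
      B_der p DJ DM (clM T m n) = clM T (DM m) n + sg (p * q) *: clM T m (DM n)].
Proof.
have lin_twist (V W : superspace K) (f : V -> V -> W) (D : V -> V) : bilin f ->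
    linear D -> bilin (fun u v => f (D u) v + f (parity_twist p u) (D v)).
  move=> hf hDl; split=> [v k u u'|u k v v'].
    by rewrite hDl parity_twist_linear !(bilinE hf); module_coefs K; ring.
  by rewrite hDl !(bilinE hf); module_coefs K; ring.
have [L EJ EM] := B_liftP (lin_twist _ _ _ _ clJ_bilin (sd_linJ hD))
  (lin_twist _ _ _ _ clM_bilin (sd_linM hD)) respects_Rs_der.
split=> // [q a b ha|q m n hm].
  by rewrite /B_der EJ (twist ha) (bilinZl clJ_bilin).
by rewrite /B_der EM (twist hm) (bilinZl clM_bilin).
Qed.

Lemma B_der_linear : linear (B_der p DJ DM). Proof. by case: B_derE. Qed.
Lemma B_der_clJ q a b : homog q a ->
  B_der p DJ DM (clJ T a b) = clJ T (DJ a) b + sg (p * q) *: clJ T a (DJ b).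
Proof. by case: B_derE => _ h _; exact: h. Qed.
Lemma B_der_clM q m n : homog q m ->
  B_der p DJ DM (clM T m n) = clM T (DM m) n + sg (p * q) *: clM T m (DM n).
Proof. by case: B_derE => _ _ h; exact: h. Qed.

Lemma clJ_homog pa pb a b : homog pa a -> homog pb b -> homog (pa (+) pb) (clJ T a b).
Proof. by move=> ha hb; exists (jj M a b) => //; exact: jj_homog. Qed.
Lemma clM_homog pm pn m n : homog pm m -> homog pn n -> homog (pm (+) pn) (clM T m n).
Proof. by move=> hm hn; exists (mm J m n) => //; exact: mm_homog. Qed.

Lemma B_der_homog q x : homog q x -> homog (p (+) q) (B_der p DJ DM x).
Proof.
move/B_span; move: x.
apply: (span_ind (P := fun x => homog (p (+) q) (B_der p DJ DM x))).
  by rewrite (linear_0 B_der_linear); exact: homog0.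
move=> k x y hx IH; rewrite B_der_linear; apply: homog_lin IH.
case: hx => [pa pb a b ha hb <-|pm pn m n hm hn <-].
  rewrite (B_der_clJ b ha); apply: homogD.
    by rewrite addbA; apply: clJ_homog hb; exact: sd_homogJ hD _ _ ha.
  rewrite addbCA; apply/homogZ/clJ_homog => //; exact: sd_homogJ hD _ _ hb.
rewrite (B_der_clM n hm); apply: homogD.
  by rewrite addbA; apply: clM_homog hn; exact: sd_homogM hD _ _ hm.
rewrite addbCA; apply/homogZ/clM_homog => //; exact: sd_homogM hD _ _ hn.
Qed.

(** Expanding D on a class of B is taking the supercommutator with D. *)
Lemma B_actJ_der q x c : homog q x ->
  B_actJ (B_der p DJ DM x) c
  = DJ (B_actJ x c) - sg (p * q) *: B_actJ x (DJ c).
Proof.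
move=> hx; move: c; apply: homog_ind => [c d IHc IHd|pc c hc].
  rewrite (linear_D (sd_linJ hD)) !(bilinDr B_actJ_bilin) IHc IHd.
  by rewrite (linear_D (sd_linJ hD)); signed_module two_neq0.
move/B_span: hx; move: x; apply: span_eq.
- exact: linear_comp (B_actJ_linl c) B_der_linear.
- move=> k x y; rewrite !(bilinDl B_actJ_bilin) !(bilinZl B_actJ_bilin).
  rewrite (linear_D (sd_linJ hD)) (linear_Z (sd_linJ hD)); module_coefs K; ring.
move=> _ [pa pb a b ha hb <-|pm pn m n hm hn <-].
  rewrite (B_der_clJ b ha) !(bilinE B_actJ_bilin) !B_actJ_clJ.
  have hDa := sd_homogJ hD ha; have hDb := sd_homogJ hD hb.
  rewrite (ext_angleJE T _ hDa hb) (ext_angleJE T _ ha hDb) !(ext_angleJE T _ ha hb).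
  rewrite (superder_angleJ two_neq0 hD ha hb hc); signed_module two_neq0.
rewrite (B_der_clM n hm) !(bilinE B_actJ_bilin) !B_actJ_clM.
have hDm := sd_homogM hD hm; have hDn := sd_homogM hD hn; have hDc := sd_homogJ hD hc.
rewrite (ext_partialJE T hDm hn hc) (ext_partialJE T hm hDn hc).
rewrite (ext_partialJE T hm hn hc) (ext_partialJE T hm hn hDc).
rewrite (superder_partialJ two_neq0 hD hm hn hc); signed_module two_neq0.
Qed.

Lemma B_actM_der q x r : homog q x ->
  B_actM (B_der p DJ DM x) r
  = DM (B_actM x r) - sg (p * q) *: B_actM x (DM r).
Proof.
move=> hx; move: r; apply: homog_ind => [r s IHr IHs|pr r hr].
  rewrite (linear_D (sd_linM hD)) !(bilinDr B_actM_bilin) IHr IHs.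
  by rewrite (linear_D (sd_linM hD)); signed_module two_neq0.
move/B_span: hx; move: x; apply: span_eq.
- exact: linear_comp (B_actM_linl r) B_der_linear.
- move=> k x y; rewrite !(bilinDl B_actM_bilin) !(bilinZl B_actM_bilin).
  rewrite (linear_D (sd_linM hD)) (linear_Z (sd_linM hD)); module_coefs K; ring.
move=> _ [pa pb a b ha hb <-|pm pn m n hm hn <-].
  rewrite (B_der_clJ b ha) !(bilinE B_actM_bilin) !B_actM_clJ.
  have hDa := sd_homogJ hD ha; have hDb := sd_homogJ hD hb.
  rewrite (ext_angleME T _ hDa hb) (ext_angleME T _ ha hDb) !(ext_angleME T _ ha hb).
  rewrite (superder_angleM two_neq0 hD ha hb hr); signed_module two_neq0.
rewrite (B_der_clM n hm) !(bilinE B_actM_bilin) !B_actM_clM.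
rewrite (superder_partialM two_neq0 hD hm hn hr); signed_module two_neq0.
Qed.

End Derivation.

End MapsFromB.

(** * The bracket of B *)

Section BracketOfB.
Variables (K : fieldType) (J M : superspace K) (T : ternary_superalgebra J M).
Hypothesis two_neq0 : 2 != 0 :> K.
Notation sg n := (sgn K n).
Notation "a ·j b" := (jmul T a b) (at level 40).
Notation "a • m" := (jact T a m) (at level 40).
Notation "m ⋆ n" := (mstar T m n) (at level 40).
Notation actJ := (@B_actJ K J M T).
Notation actM := (@B_actM K J M T).
Implicit Types (p pa pb pc pd pm pn pr ps : bool) (a b c d : J) (m n r s : M)
  (x y z : Bs T).

Lemma B_der_act0 p y : B_der p (actJ 0) (actM 0) y = 0.
Proof.
have hD := superder_B two_neq0 (homog0 (Bs T) p).
move: y; apply: (@B_eq _ _ _ _ _ _ (fun=> 0)); first exact: B_der_linear.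
  by move=> k u v; rewrite scaler0 addr0.
have z1 := bilin0l (B_actJ_bilin T two_neq0); have z2 := bilin0l (B_actM_bilin T two_neq0).
move=> q _ [pa pb a b ha hb _|pm pn m n hm hn _].
  by rewrite (B_der_clJ two_neq0 hD b ha) !z1 !(bilinE (clJ_bilin T)) scaler0 addr0.
by rewrite (B_der_clM two_neq0 hD n hm) !z2 !(bilinE (clM_bilin T)) scaler0 addr0.
Qed.

(* Locked for the same reason as [B_lift]. *)
Definition B_actB : Bs T -> Bs T -> Bs T :=
  locked (fun x y => hext (fun p x => B_der p (actJ x) (actM x) y) x).

Let B_actB_ext x y : B_actB x y = hext (fun p x => B_der p (actJ x) (actM x) y) x.
Proof. by rewrite /B_actB -lock. Qed.

Lemma B_actBE p x y : homog p x -> B_actB x y = B_der p (actJ x) (actM x) y.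
Proof.
move=> hx; rewrite !B_actB_ext /hext; case: p hx => hx; rewrite (comp_id hx).
  by rewrite (@comp_0 _ _ false x hx) B_der_act0 add0r.
by rewrite (@comp_0 _ _ true x hx) B_der_act0 addr0.
Qed.

Let hcomp p x := superder_B two_neq0 (comp_homog p x).

Lemma B_actB_linr x : linear (B_actB x).
Proof.
move=> k y z; rewrite !B_actB_ext /hext !(B_der_linear two_neq0 (hcomp _ _)).
by module_coefs K; ring.
Qed.

Lemma B_actB_clJ_ext q x a b : homog q a -> B_actB x (clJ T a b)
  = hext (fun p x => clJ T (actJ x a) b + sg (p * q) *: clJ T a (actJ x b)) x.
Proof. by move=> ha; rewrite !B_actB_ext /hext !(B_der_clJ two_neq0 (hcomp _ _) _ ha). Qed.

Lemma B_actB_clM_ext q x m n : homog q m -> B_actB x (clM T m n)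
  = hext (fun p x => clM T (actM x m) n + sg (p * q) *: clM T m (actM x n)) x.
Proof. by move=> hm; rewrite !B_actB_ext /hext !(B_der_clM two_neq0 (hcomp _ _) _ hm). Qed.

Lemma B_actB_bilin : bilin B_actB.
Proof.
split; last exact: B_actB_linr.
move=> y k u v; move: y; apply: B_eq; first exact: B_actB_linr.
  by apply: linear_comb; exact: B_actB_linr.
move=> q _ [pa pb a b ha hb _|pm pn m n hm hn _].
  rewrite !(B_actB_clJ_ext _ _ ha); apply: hext_linear => p {}k {}u {}v.
  rewrite !(bilinE (B_actJ_bilin T two_neq0)) !(bilinE (clJ_bilin T)).
  by module_coefs K; ring.
rewrite !(B_actB_clM_ext _ _ hm); apply: hext_linear => p {}k {}u {}v.
rewrite !(bilinE (B_actM_bilin T two_neq0)) !(bilinE (clM_bilin T)).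
by module_coefs K; ring.
Qed.

Lemma B_actB_clJ p q x a b : homog p x -> homog q a -> B_actB x (clJ T a b)
  = clJ T (actJ x a) b + sg (p * q) *: clJ T a (actJ x b).
Proof.
by move=> hx ha; rewrite (B_actBE _ hx) (B_der_clJ two_neq0 (superder_B two_neq0 hx) _ ha).
Qed.

Lemma B_actB_clM p q x m n : homog p x -> homog q m -> B_actB x (clM T m n)
  = clM T (actM x m) n + sg (p * q) *: clM T m (actM x n).
Proof.
by move=> hx hm; rewrite (B_actBE _ hx) (B_der_clM two_neq0 (superder_B two_neq0 hx) _ hm).
Qed.

Lemma B_actB_homog p q x y : homog p x -> homog q y -> homog (p (+) q) (B_actB x y).
Proof.
move=> hx hy; rewrite (B_actBE _ hx).
exact: (B_der_homog two_neq0 (superder_B two_neq0 hx) hy).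
Qed.

Lemma B_actJ_B p q x y c : homog p x -> homog q y ->
  actJ (B_actB x y) c = actJ x (actJ y c) - sg (p * q) *: actJ y (actJ x c).
Proof.
move=> hx hy; rewrite (B_actBE _ hx).
exact: (B_actJ_der two_neq0 (superder_B two_neq0 hx) c hy).
Qed.

Lemma B_actM_B p q x y r : homog p x -> homog q y ->
  actM (B_actB x y) r = actM x (actM y r) - sg (p * q) *: actM y (actM x r).
Proof.
move=> hx hy; rewrite (B_actBE _ hx).
exact: (B_actM_der two_neq0 (superder_B two_neq0 hx) r hy).
Qed.

(** The action on B is determined by those on J and M, where the supercommutator
   is already known ([B_actJ_B], [B_actM_B]). *)
Lemma B_actB_B p q x y z : homog p x -> homog q y ->
  B_actB (B_actB x y) z = B_actB x (B_actB y z) - sg (p * q) *: B_actB y (B_actB x z).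
Proof.
move=> hx hy; have hxy := B_actB_homog hx hy.
have hJx := sd_homogJ (superder_B two_neq0 hx); have hJy := sd_homogJ (superder_B two_neq0 hy).
have hMx := sd_homogM (superder_B two_neq0 hx); have hMy := sd_homogM (superder_B two_neq0 hy).
move: z; apply: B_eq; first exact: B_actB_linr.
  move=> k u v; rewrite !(bilinE B_actB_bilin); module_coefs K; ring.
move=> q' _ [pa pb a b ha hb _|pm pn m n hm hn _].
  rewrite (B_actB_clJ _ hxy ha) !(B_actJ_B _ hx hy).
  rewrite (B_actB_clJ _ hx ha) (B_actB_clJ _ hy ha) !(bilinE B_actB_bilin).
  rewrite (B_actB_clJ _ hx (hJy _ _ ha)) (B_actB_clJ _ hy (hJx _ _ ha)).
  rewrite !(B_actB_clJ _ hx ha) !(B_actB_clJ _ hy ha) !(bilinE (clJ_bilin T)).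
  signed_module two_neq0.
rewrite (B_actB_clM _ hxy hm) !(B_actM_B _ hx hy).
rewrite (B_actB_clM _ hx hm) (B_actB_clM _ hy hm) !(bilinE B_actB_bilin).
rewrite (B_actB_clM _ hx (hMy _ _ hm)) (B_actB_clM _ hy (hMx _ _ hm)).
rewrite !(B_actB_clM _ hx hm) !(B_actB_clM _ hy hm) !(bilinE (clM_bilin T)).
signed_module two_neq0.
Qed.

Lemma clJ_anti pa pb a b : homog pa a -> homog pb b ->
  clJ T a b = - sg (pa * pb) *: clJ T b a.
Proof.
move=> ha hb; apply: (add_eq 1 (rRs_ab (respects_Rs_cl T) ha hb)).
signed_module two_neq0.
Qed.

Lemma clM_symm pm pn m n : homog pm m -> homog pn n ->
  clM T m n = sg (pm * pn) *: clM T n m.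
Proof.
move=> hm hn; apply: (add_eq 1 (rRs_mn (respects_Rs_cl T) hm hn)).
signed_module two_neq0.
Qed.

(** I_{a,bc,d} moves d in {a(bc) ⊗ d}: it becomes -{(bc)d ⊗ a} - {da ⊗ bc}. After this is
   done for the four terms of the left side, the classes of two products cancel
   in pairs and the others assemble to the right side. *)
Lemma B_anti_JJ pa pb pc pd a b c d :
  homog pa a -> homog pb b -> homog pc c -> homog pd d ->
  B_actB (clJ T a b) (clJ T c d)
  = - sg ((pa (+) pb) * (pc (+) pd)) *: B_actB (clJ T c d) (clJ T a b).
Proof.
move=> ha hb hc hd.
rewrite (B_actB_clJ d (clJ_homog T ha hb) hc) (B_actB_clJ b (clJ_homog T hc hd) ha).
rewrite !(B_actJ_clJ T two_neq0) !(ext_angleJE T _ ha hb) !(ext_angleJE T _ hc hd) /angleJ.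
have hbc := jmul_homog T hb hc; have hac := jmul_homog T ha hc.
have hbd := jmul_homog T hb hd; have had := jmul_homog T ha hd.
have cyc := rRs_abc (respects_Rs_cl T).
have e1 := cyc _ _ _ _ _ _ ha hbc hd; have e2 := cyc _ _ _ _ _ _ hb hac hd.
have e3 := cyc _ _ _ _ _ _ ha hbd hc; have e4 := cyc _ _ _ _ _ _ hb had hc.
have e5 := clJ_anti hc (jmul_homog T ha hbd).
have e6 := clJ_anti hc (jmul_homog T hb had).
have e7 := clJ_anti had hbc; have e8 := clJ_anti hbd hac.
have e9 := clJ_anti ha (jmul_homog T hbc hd).
have e10 := clJ_anti ha (jmul_homog T hbd hc).
rewrite (jmulC T hd ha) (bilinZl (clJ_bilin T)) in e1.
rewrite (jmulC T hd hb) (bilinZl (clJ_bilin T)) in e2.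
rewrite (jmulC T hc ha) (bilinZl (clJ_bilin T)) in e3.
rewrite (jmulC T hc hb) (bilinZl (clJ_bilin T)) in e4.
rewrite (jmulC T hd ha) (jmulC T hd hb) (jmulC T hc ha) (jmulC T hc hb).
rewrite !(bilinE (jmul_bilin T)) (jmulC T hd hac) (jmulC T hd hbc).
rewrite (jmulC T hc had) (jmulC T hc hbd) !(bilinE (clJ_bilin T)).
(* e1 - e4 move the factors, e7 and e8 cancel the products in pairs, and the
   other equations restore the order of the tensor factors. *)
apply: (add_eq (sg (pa * pd)) e1).
apply: (add_eq (- sg (pa * pb + pb * pd)) e2).
apply: (add_eq (- sg (pc * pd + pa * pc)) e3).
apply: (add_eq (sg (pa * pb + pc * pd + pb * pc)) e4).
apply: (add_eq (sg ((pa + pb) * pc)) e5).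
apply: (add_eq (- sg ((pa + pb) * pc + pa * pb)) e6).
apply: (add_eq (- sg ((pb + pc) * pd)) e7).
apply: (add_eq (sg (pa * pb + (pa + pc) * pd)) e8).
apply: (add_eq (- 1) e9).
apply: (add_eq (sg (pc * pd)) e10).
signed_module two_neq0.
Qed.

(** I_{a,m,n} moves an action from one tensor factor to the other. Moving a and b
   one after the other in {abm ⊗ n} - {bam ⊗ n} leaves {m ⊗ [b, a]n}, and the correction
   terms are those of ∂_{m,n}. *)
Lemma B_anti_JM pa pb pm pn a b m n :
  homog pa a -> homog pb b -> homog pm m -> homog pn n ->
  B_actB (clJ T a b) (clM T m n)
  = - sg ((pa (+) pb) * (pm (+) pn)) *: B_actB (clM T m n) (clJ T a b).
Proof.
move=> ha hb hm hn.
rewrite (B_actB_clM n (clJ_homog T ha hb) hm) (B_actB_clJ b (clM_homog T hm hn) ha).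
rewrite !(B_actM_clJ T two_neq0) !(ext_angleME T _ ha hb) !(B_actJ_clM T two_neq0).
rewrite (ext_partialJE T hm hn ha) (ext_partialJE T hm hn hb) /angleM /partialJ.
have ham := jact_homog T ha hm; have hbm := jact_homog T hb hm.
have han := jact_homog T ha hn; have hbn := jact_homog T hb hn.
have amn := rRs_amn (respects_Rs_cl T).
rewrite !(bilinE (clJ_bilin T)) !(bilinE (clM_bilin T)).
apply: (add_eq 4^-1 (amn _ _ _ _ _ _ ha hbm hn)).
apply: (add_eq (- 4^-1 * sg (pa * pb)) (amn _ _ _ _ _ _ hb ham hn)).
apply: (add_eq (4^-1 * sg (pa * (pb + pm))) (amn _ _ _ _ _ _ hb hm han)).
apply: (add_eq (- 4^-1 * sg (pb * pm)) (amn _ _ _ _ _ _ ha hm hbn)).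
apply: (add_eq 2^-1 (clJ_anti ha (mstar_homog T hbm hn))).
apply: (add_eq (- 2^-1 * sg (pb * pm)) (clJ_anti ha (mstar_homog T hm hbn))).
signed_module two_neq0.
Qed.

Lemma B_anti_MM pm pn pr ps m n r s :
  homog pm m -> homog pn n -> homog pr r -> homog ps s ->
  B_actB (clM T m n) (clM T r s)
  = - sg ((pm (+) pn) * (pr (+) ps)) *: B_actB (clM T r s) (clM T m n).
Proof.
move=> hm hn hr hs.
rewrite (B_actB_clM s (clM_homog T hm hn) hr) (B_actB_clM n (clM_homog T hr hs) hm).
rewrite !(B_actM_clM T two_neq0).
apply: (add_eq 1 (rRs_mnrs (respects_Rs_cl T) hm hn hr hs)).
signed_module two_neq0.
Qed.

Lemma B_actB_anti p q x y : homog p x -> homog q y ->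
  B_actB x y = - sg (p * q) *: B_actB y x.
Proof.
move=> /B_span hx /B_span hy; move: y hy.
have lin z : linear (fun y => - sg (p * q) *: B_actB y z).
  by move=> k u v; rewrite !(bilinE B_actB_bilin); module_coefs K; ring.
have lin' z : linear (fun x => - sg (p * q) *: B_actB z x).
  by move=> k u v; rewrite !(bilinE B_actB_bilin); module_coefs K; ring.
apply: span_eq => [||y hy]; [exact: B_actB_linr|exact: lin|].
move: x hx; apply: span_eq => [||x hx]; [exact: (B_actB_bilin.1 y)|exact: lin'|].
case: hx => [pa pb a b ha hb <-|pm pn m n hm hn <-];
  case: hy => [pc pd c d hc hd <-|pr ps r s hr hs <-].
- exact: B_anti_JJ.
- exact: B_anti_JM.
- apply: (add_eq (sg ((pm (+) pn) * (pc (+) pd))) (B_anti_JM hc hd hm hn)).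
  signed_module two_neq0.
- exact: B_anti_MM.
Qed.

End BracketOfB.

(** * The Lie algebra sl2 and its natural module *)

Section SL2Facts.
Variable K : fieldType.
Hypothesis two_neq0 : 2 != 0 :> K.
Implicit Types (x y z : sl2 K) (u v w : natV K).

Lemma sum_ord2 (f : 'I_2 -> K) : \sum_i f i = f 0 + f 1.
Proof. by rewrite big_ord_recl big_ord1; congr (_ + f _); apply: val_inj. Qed.

Lemma ord2_ind (P : 'I_2 -> Prop) : P 0 -> P 1 -> forall i, P i.
Proof.
by move=> P0 P1 [[|[|//]] h]; [apply: eq_ind P0 _ _|apply: eq_ind P1 _ _]; apply: val_inj.
Qed.

Lemma sl2_11 x : x 1 1 = - x 0 0.
Proof.
by case: x => x /= /eqP; rewrite /mxtrace sum_ord2 addrC => /eqP; rewrite addr_eq0 => /eqP.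
Qed.

Lemma sl2_eq x y : x 0 0 = y 0 0 -> x 0 1 = y 0 1 -> x 1 0 = y 1 0 -> x = y.
Proof.
move=> e00 e01 e10; apply/val_inj/matrixP => /=.
by apply: ord2_ind; apply: ord2_ind => //; rewrite !sl2_11 e00.
Qed.

Lemma natV_eq v w : v 0 0 = w 0 0 -> v 1 0 = w 1 0 -> v = w.
Proof.
move=> e0 e1; apply/matrixP => i j; rewrite (ord1 j); move: i.
exact: ord2_ind.
Qed.

Lemma sl2D x y i j : (x + y) i j = x i j + y i j. Proof. by rewrite mxE. Qed.
Lemma sl2N x i j : (- x) i j = - x i j. Proof. by rewrite mxE. Qed.
Lemma sl2Z k x i j : (k *: x) i j = k * x i j. Proof. by rewrite mxE. Qed.
Lemma sl2_bracketE x y i j : sl2_bracket x y i j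
  = x i 0 * y 0 j + x i 1 * y 1 j - (y i 0 * x 0 j + y i 1 * x 1 j).
Proof. by rewrite !mxE !sum_ord2. Qed.

Lemma kappaE x y : kappa x y
  = 4 * (x 0 0 * y 0 0 + x 0 1 * y 1 0 + (x 1 0 * y 0 1 + x 1 1 * y 1 1)).
Proof. by rewrite /kappa /mxtrace sum_ord2 !mxE !sum_ord2. Qed.

Lemma natV_actE x v i : natV_act x v i 0 = x i 0 * v 0 0 + x i 1 * v 1 0.
Proof. by rewrite mxE sum_ord2. Qed.

Lemma detVE v w : detV v w = v 0 0 * w 1 0 - v 1 0 * w 0 0.
Proof.
have s0 (i : 'I_1) (k : 'I_(1 + 1)) : val k = val i -> split k = inl i.
  by move=> e; rewrite -(unsplitK (inl i)); congr split; exact: val_inj.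
have s1 (i : 'I_1) (k : 'I_(1 + 1)) : val k = 1%N + val i -> split k = inr i.
  by move=> e; rewrite -(unsplitK (inr i)); congr split; exact: val_inj.
rewrite /detV (expand_det_row _ 0) sum_ord2 /cofactor !det_mx11 !mxE.
rewrite (s0 0 0) // (s1 0 (lift 0 0)) // (s1 0 1) // (s0 0 (lift 1 0)) //.
have -> : lift 0 0 = 1 :> 'I_2 by exact: val_inj.
by rewrite /= expr0 expr1; ring.
Qed.

Lemma odotVE v w : [/\ odotV v w 0 0 = - (2^-1 * (v 0 0 * w 1 0 + v 1 0 * w 0 0)),
  odotV v w 0 1 = v 0 0 * w 0 0 & odotV v w 1 0 = - (v 1 0 * w 1 0)].
Proof.
split; rewrite /odotV !sl2D !sl2N !sl2Z /sl2_e /sl2_f /sl2_h /= !mxE /=; ring.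
Qed.

Lemma natV0 i : (0 : natV K) i 0 = 0. Proof. by rewrite mxE. Qed.
Lemma natVD v w i : (v + w) i 0 = v i 0 + w i 0. Proof. by rewrite mxE. Qed.
Lemma natVN v i : (- v) i 0 = - v i 0. Proof. by rewrite mxE. Qed.
Lemma natVZ k v i : (k *: v) i 0 = k * v i 0. Proof. by rewrite mxE. Qed.

Lemma odotV00 v w : odotV v w 0 0 = - (2^-1 * (v 0 0 * w 1 0 + v 1 0 * w 0 0)).
Proof. by case: (odotVE v w). Qed.
Lemma odotV01 v w : odotV v w 0 1 = v 0 0 * w 0 0.
Proof. by case: (odotVE v w). Qed.
Lemma odotV10 v w : odotV v w 1 0 = - (v 1 0 * w 1 0).
Proof. by case: (odotVE v w). Qed.

Let coordE := (sl2D, sl2N, sl2Z, sl2_bracketE, natV0, natVD, natVN, natVZ, natV_actE,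
  odotV00, odotV01, odotV10, kappaE, detVE, sl2_11).

Ltac by_coordinates := rewrite ?coordE; by field; rewrite ?two_neq0 ?four_neq0.
Ltac sl2_coordinates := apply: sl2_eq; by_coordinates.
Ltac natV_coordinates := apply: natV_eq; by_coordinates.

Lemma sl2_bracket_bilin : bilin (@sl2_bracket K).
Proof. by split=> [z k x y|z k x y]; sl2_coordinates. Qed.

Lemma natV_act_bilin : bilin (@natV_act K).
Proof. by split=> [v k x y|x k v w]; natV_coordinates. Qed.

Lemma odotV_bilin : bilin (@odotV K).
Proof. by split=> [u k v w|u k v w]; sl2_coordinates. Qed.

Lemma kappaDl k x y z : kappa (k *: x + y) z = k * kappa x z + kappa y z.
Proof. by_coordinates. Qed.
Lemma kappaC x y : kappa x y = kappa y x.
Proof. by_coordinates. Qed.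
Lemma kappaDr k x y z : kappa z (k *: x + y) = k * kappa z x + kappa z y.
Proof. by_coordinates. Qed.
Lemma kappa_bracket x y z : kappa (sl2_bracket x y) z = kappa x (sl2_bracket y z).
Proof. by_coordinates. Qed.

Lemma detVDl k u v w : detV (k *: u + v) w = k * detV u w + detV v w.
Proof. by_coordinates. Qed.
Lemma detVDr k u v w : detV w (k *: u + v) = k * detV w u + detV w v.
Proof. by_coordinates. Qed.
Lemma detVC v w : detV v w = - detV w v.
Proof. by_coordinates. Qed.
Lemma detV_act x v w : detV v (natV_act x w) = - detV (natV_act x v) w.
Proof. by_coordinates. Qed.
Lemma odotVC v w : odotV v w = odotV w v.
Proof. sl2_coordinates. Qed.

Lemma sl2_bracketC x y : sl2_bracket x y = - sl2_bracket y x.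
Proof. sl2_coordinates. Qed.

(** The form by which {a ⊗ b} enters the bracket of x ⊗ a and y ⊗ b. *)
Definition half_kappa x y : K := 2^-1 * kappa x y.

Lemma half_kappaC x y : half_kappa x y = half_kappa y x.
Proof. by rewrite /half_kappa kappaC. Qed.

Lemma half_kappaNl x y : half_kappa (- x) y = - half_kappa x y.
Proof. rewrite /half_kappa; by_coordinates. Qed.

Lemma half_kappa_bracket x y z : half_kappa x (sl2_bracket y z) = half_kappa (sl2_bracket x y) z.
Proof. by rewrite /half_kappa kappa_bracket. Qed.

Lemma half_kappa_odotV x v w : half_kappa x (odotV v w) = - 2 * detV (natV_act x v) w.
Proof. rewrite /half_kappa; by_coordinates. Qed.

Lemma sl2_bracket2r x y z : sl2_bracket x (sl2_bracket y z)
  = half_kappa x y *: z - half_kappa x z *: y.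
Proof. rewrite /half_kappa; sl2_coordinates. Qed.

Lemma sl2_bracket2l x y z : sl2_bracket (sl2_bracket x y) z
  = half_kappa y z *: x - half_kappa x z *: y.
Proof. rewrite /half_kappa; sl2_coordinates. Qed.

Lemma natV_act2 x y v : natV_act x (natV_act y v)
  = 2^-1 *: natV_act (sl2_bracket x y) v + (4^-1 * half_kappa x y) *: v.
Proof. rewrite /half_kappa; natV_coordinates. Qed.

Lemma natV_act_bracket x y v : natV_act (sl2_bracket x y) v
  = natV_act x (natV_act y v) - natV_act y (natV_act x v).
Proof. natV_coordinates. Qed.

Lemma odotV_actl x v w : odotV (natV_act x v) w
  = 2^-1 *: (sl2_bracket x (odotV v w) - detV v w *: x).
Proof. sl2_coordinates. Qed.

Lemma odotV_actr x v w : odotV v (natV_act x w)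
  = 2^-1 *: (sl2_bracket x (odotV v w) + detV v w *: x).
Proof. sl2_coordinates. Qed.

Lemma natV_act_odotV u v w :
  natV_act (odotV v w) u = 2^-1 *: (detV v u *: w + detV w u *: v).
Proof. natV_coordinates. Qed.

Lemma detV_cycle u v w : detV u v *: w + detV v w *: u + detV w u *: v = 0.
Proof. natV_coordinates. Qed.

End SL2Facts.

(** * Maps of four variables on pairs of tensors *)

Lemma tensor_eq (K : fieldType) (U W T : lmodType K) (f g : tensor_mod U W -> T) :
  linear f -> linear g -> (forall u w, f (u ⊗ w) = g (u ⊗ w)) -> f =1 g.
Proof.
by move=> hf hg e t; apply: span_eq (tensor_span t) => // _ [u [w ->]].
Qed.

Lemma tensor_lift_linear (K : fieldType) (X U W T : lmodType K)
    (F : X -> U -> W -> T) :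
  (forall x, bilin (F x)) -> (forall u w, linear (fun x => F x u w)) ->
  forall t, linear (fun x => tensor_lift (F x) t).
Proof.
move=> Fx Fuw t k x y; have lift z := tensor_liftP (Fx z).
move: t; apply: tensor_eq; first by case: (lift (k *: x + y)).
  by apply: linear_comb; [case: (lift x) | case: (lift y)].
by move=> u w /=; rewrite !(lift _).2; exact: Fuw.
Qed.

Lemma tensor_lift_bilin (K : fieldType) (X U W T : lmodType K)
    (F : X -> U -> W -> T) :
  (forall x, bilin (F x)) -> (forall u w, linear (fun x => F x u w)) ->
  bilin (fun x t => tensor_lift (F x) t).
Proof.
move=> Fx Fuw; split=> [t|x]; first exact: tensor_lift_linear.
by case: (tensor_liftP (Fx x)).
Qed.

Section TensorMap.
Variables (K : fieldType) (U W U' W' X Y T : lmodType K).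
Variables (f : U -> U' -> X) (g : W -> W' -> Y) (h : X -> Y -> T).
Hypotheses (hf : bilin f) (hg : bilin g) (hh : bilin h).

Definition tensor_map2 (s : tensor_mod U W) (t : tensor_mod U' W') : T :=
  tensor_lift (fun u w => tensor_lift (fun u' w' => h (f u u') (g w w')) t) s.

Let bilin12 u' w' : bilin (fun u w => h (f u u') (g w w')).
Proof. by split=> [w|u] k z z'; rewrite (hf.1, hg.1) (hh.1, hh.2). Qed.

Let bilin34 u w : bilin (fun u' w' => h (f u u') (g w w')).
Proof. by split=> [w'|u'] k z z'; rewrite (hf.2, hg.2) (hh.1, hh.2). Qed.

Let inner_bilin t :
  bilin (fun u w => tensor_lift (fun u' w' => h (f u u') (g w w')) t).
Proof.
split=> [w|u].
  exact: (tensor_lift_linear (fun u => bilin34 u w) (fun u' w' => (bilin12 u' w').1 w)).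
exact: (tensor_lift_linear (bilin34 u) (fun u' w' => (bilin12 u' w').2 u)).
Qed.

Lemma tensor_map2_bilin : bilin tensor_map2.
Proof.
split=> [t|s]; first by case: (tensor_liftP (inner_bilin t)).
apply: (tensor_lift_linear inner_bilin) => u w.
by case: (tensor_liftP (bilin34 u w)).
Qed.

Lemma tensor_map2E u w u' w' :
  tensor_map2 (u ⊗ w) (u' ⊗ w') = h (f u u') (g w w').
Proof.
by rewrite /tensor_map2 (tensor_liftP (inner_bilin _)).2 (tensor_liftP (bilin34 u w)).2.
Qed.

End TensorMap.

(** * The bracket of TAG(J, M) *)

Section Bracket.
Variables (K : fieldType) (J M : superspace K) (T : ternary_superalgebra J M).
Hypothesis two_neq0 : 2 != 0 :> K.
Notation sg n := (sgn K n).
Notation "a ·j b" := (jmul T a b) (at level 40).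
Notation "a • m" := (jact T a m) (at level 40).
Notation "m ⋆ n" := (mstar T m n) (at level 40).
Notation actJ := (@B_actJ K J M T).
Notation actM := (@B_actM K J M T).
Notation actB := (@B_actB K J M T).
Notation L := (TAG T).
Notation SJ := (tensor_superspace (purely_even (sl2 K)) J).
Notation VMt := (tensor_superspace (purely_even (natV K)) M).
Notation sl := (TAG_sl T).
Notation vm := (TAG_V T).
Notation inB := (@TAG_B K J M T).
Implicit Types (p pa pb pc pd pm pn pr ps : bool) (a b c d : J) (m n r s : M)
  (x y z : sl2 K) (v w : natV K) (q : Bs T).

Ltac pair_eq := apply: injective_projections; first apply: injective_projections.

Definition TAG_inS (t : SJ) : L := ((t, 0), 0).
Definition TAG_inV (t : VMt) : L := ((0, t), 0).

Lemma TAG_inS_linear : linear TAG_inS.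
Proof. by move=> k t t'; pair_eq; rewrite /= ?scaler0 ?addr0. Qed.
Lemma TAG_inV_linear : linear TAG_inV.
Proof. by move=> k t t'; pair_eq; rewrite /= ?scaler0 ?addr0. Qed.
Lemma TAG_B_linear : linear inB.
Proof. by move=> k t t'; pair_eq; rewrite /= ?scaler0 ?addr0. Qed.

Lemma TAG_sl_bilin : bilin sl.
Proof.
have [hl hr] := tensor_bilin (purely_even (sl2 K)) J.
by split=> [a k x y|x k a b]; rewrite /TAG_sl /slJ -[LHS]/(TAG_inS _) ?hl ?hr TAG_inS_linear.
Qed.
Lemma TAG_V_bilin : bilin vm.
Proof.
have [hl hr] := tensor_bilin (purely_even (natV K)) M.
by split=> [a k x y|x k a b]; rewrite /TAG_V /VM -[LHS]/(TAG_inV _) ?hl ?hr TAG_inV_linear.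
Qed.

Lemma TAG_BZ k q : inB (k *: q) = k *: inB q.
Proof. exact: (linear_Z TAG_B_linear). Qed.
Lemma TAG_BD q q' : inB (q + q') = inB q + inB q'.
Proof. exact: (linear_D TAG_B_linear). Qed.

Definition TAG_prS (u : L) : SJ := u.1.1.
Definition TAG_prV (u : L) : VMt := u.1.2.
Definition TAG_prB (u : L) : Bs T := u.2.
Lemma TAG_prS_linear : linear TAG_prS. Proof. by move=> k [[? ?] ?] [[? ?] ?]. Qed.
Lemma TAG_prV_linear : linear TAG_prV. Proof. by move=> k [[? ?] ?] [[? ?] ?]. Qed.
Lemma TAG_prB_linear : linear TAG_prB. Proof. by move=> k [[? ?] ?] [[? ?] ?]. Qed.

Definition sl_sl_part := tensor_map2 (@sl2_bracket K) (jmul T)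
  (@tensor K (purely_even (sl2 K)) J : _ -> _ -> SJ).
Definition sl_sl_B := tensor_map2 (fun x y => half_kappa x y : K^o) (clJ T)
  (fun (k : K^o) (q : Bs T) => (k : K) *: q).
Definition sl_V_part := tensor_map2 (@natV_act K) (jact T)
  (@tensor K (purely_even (natV K)) M : _ -> _ -> VMt).
Definition V_V_part := tensor_map2 (@odotV K) (mstar T)
  (@tensor K (purely_even (sl2 K)) J : _ -> _ -> SJ).
Definition V_V_B := tensor_map2 (fun v w => detV v w : K^o) (clM T)
  (fun (k : K^o) (q : Bs T) => (k : K) *: q).
Definition B_sl_part q (t : SJ) : SJ := tensor_lift (fun (x : sl2 K) a => x ⊗ actJ q a) t.
Definition B_V_part q (t : VMt) : VMt := tensor_lift (fun (v : natV K) m => v ⊗ actM q m) t.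

Lemma half_kappa_bilin : bilin (fun x y => half_kappa x y : K^o).
Proof.
by split=> [y|x] k z z'; rewrite /half_kappa (kappaDl, kappaDr) mulrDr mulrCA.
Qed.

Lemma detV_bilin : bilin (fun v w => detV v w : K^o).
Proof. by split=> [w|v] k u u'; rewrite (detVDl, detVDr). Qed.

Let tensor_SJ := tensor_bilin (purely_even (sl2 K)) J.
Let tensor_VM := tensor_bilin (purely_even (natV K)) M.
Lemma sl_sl_part_bilin : bilin sl_sl_part.
Proof.
exact: tensor_map2_bilin (sl2_bracket_bilin K) (jmul_bilin T) tensor_SJ.
Qed.
Lemma sl_sl_B_bilin : bilin sl_sl_B.
Proof.
exact: tensor_map2_bilin half_kappa_bilin (clJ_bilin T) (bilin_scale _).
Qed.
Lemma sl_V_part_bilin : bilin sl_V_part.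
Proof.
exact: tensor_map2_bilin (natV_act_bilin K) (jact_bilin T) tensor_VM.
Qed.
Lemma V_V_part_bilin : bilin V_V_part.
Proof.
exact: tensor_map2_bilin (odotV_bilin two_neq0) (mstar_bilin T) tensor_SJ.
Qed.
Lemma V_V_B_bilin : bilin V_V_B.
Proof.
exact: tensor_map2_bilin detV_bilin (clM_bilin T) (bilin_scale _).
Qed.

Lemma sl_sl_partE x a y b : sl_sl_part (x ⊗ a) (y ⊗ b) = sl2_bracket x y ⊗ (a ·j b).
Proof.
exact: (tensor_map2E (sl2_bracket_bilin K) (jmul_bilin T) tensor_SJ).
Qed.
Lemma sl_sl_BE x a y b : sl_sl_B (x ⊗ a) (y ⊗ b) = half_kappa x y *: clJ T a b.
Proof.
exact: (tensor_map2E half_kappa_bilin (clJ_bilin T) (bilin_scale _)).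
Qed.
Lemma sl_V_partE x a v m : sl_V_part (x ⊗ a) (v ⊗ m) = natV_act x v ⊗ (a • m).
Proof.
exact: (tensor_map2E (natV_act_bilin K) (jact_bilin T) tensor_VM).
Qed.
Lemma V_V_partE v m w n : V_V_part (v ⊗ m) (w ⊗ n) = odotV v w ⊗ (m ⋆ n).
Proof.
exact: (tensor_map2E (odotV_bilin two_neq0) (mstar_bilin T) tensor_SJ).
Qed.
Lemma V_V_BE v m w n : V_V_B (v ⊗ m) (w ⊗ n) = detV v w *: clM T m n.
Proof.
exact: (tensor_map2E detV_bilin (clM_bilin T) (bilin_scale _)).
Qed.

Lemma B_sl_bilin q : bilin (fun (x : sl2 K) a => x ⊗ actJ q a : SJ).
Proof.
split=> [a|x] k z z'; first exact: tensor_SJ.1.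
by rewrite (B_actJ_bilin T two_neq0).2 tensor_SJ.2.
Qed.
Lemma B_V_bilin q : bilin (fun (v : natV K) m => v ⊗ actM q m : VMt).
Proof.
split=> [m|v] k z z'; first exact: tensor_VM.1.
by rewrite (B_actM_bilin T two_neq0).2 tensor_VM.2.
Qed.

Lemma B_sl_part_bilin : bilin B_sl_part.
Proof.
apply: (tensor_lift_bilin B_sl_bilin) => x a k q q'.
by rewrite (B_actJ_bilin T two_neq0).1 tensor_SJ.2.
Qed.
Lemma B_V_part_bilin : bilin B_V_part.
Proof.
apply: (tensor_lift_bilin B_V_bilin) => v m k q q'.
by rewrite (B_actM_bilin T two_neq0).1 tensor_VM.2.
Qed.
Lemma B_sl_partE q x a : B_sl_part q (x ⊗ a) = x ⊗ actJ q a.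
Proof. exact: (tensor_liftP (B_sl_bilin q)).2. Qed.
Lemma B_V_partE q v m : B_V_part q (v ⊗ m) = v ⊗ actM q m.
Proof. exact: (tensor_liftP (B_V_bilin q)).2. Qed.

(** Brackets of two elements of the same summand are given by formulas that are
   super-anticommutative themselves. *)
Definition TAG_diag (u u' : L) : L :=
  TAG_inS (sl_sl_part (TAG_prS u) (TAG_prS u')) + inB (sl_sl_B (TAG_prS u) (TAG_prS u'))
  + TAG_inS (V_V_part (TAG_prV u) (TAG_prV u')) + inB (V_V_B (TAG_prV u) (TAG_prV u'))
  + inB (actB (TAG_prB u) (TAG_prB u')).

(** Brackets of elements of different summands are given for one order of the
   summands; [TAG_mixed_flip] supplies the other order. *)
Definition TAG_mixed (u u' : L) : L :=
  TAG_inS (B_sl_part (TAG_prB u) (TAG_prS u')) + TAG_inV (B_V_part (TAG_prB u) (TAG_prV u'))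
  + TAG_inV (sl_V_part (TAG_prS u) (TAG_prV u')).

Lemma TAG_diag_bilin : bilin TAG_diag.
Proof.
do !apply: bilin_add.
- exact: (bilin_comp sl_sl_part_bilin TAG_inS_linear TAG_prS_linear TAG_prS_linear).
- exact: (bilin_comp sl_sl_B_bilin TAG_B_linear TAG_prS_linear TAG_prS_linear).
- exact: (bilin_comp V_V_part_bilin TAG_inS_linear TAG_prV_linear TAG_prV_linear).
- exact: (bilin_comp V_V_B_bilin TAG_B_linear TAG_prV_linear TAG_prV_linear).
- exact: (bilin_comp (B_actB_bilin T two_neq0) TAG_B_linear TAG_prB_linear TAG_prB_linear).
Qed.

Lemma TAG_mixed_bilin : bilin TAG_mixed.
Proof.
do !apply: bilin_add.
- exact: (bilin_comp B_sl_part_bilin TAG_inS_linear TAG_prB_linear TAG_prS_linear).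
- exact: (bilin_comp B_V_part_bilin TAG_inV_linear TAG_prB_linear TAG_prV_linear).
- exact: (bilin_comp sl_V_part_bilin TAG_inV_linear TAG_prS_linear TAG_prV_linear).
Qed.

Definition TAG_mixed_flip := hext2 (fun p p' (u u' : L) => sg (p * p') *: TAG_mixed u' u).

Lemma TAG_mixed_flip_bilin : bilin TAG_mixed_flip.
Proof.
apply: hext2_bilin => p p'; split=> [u'|u] k z z'.
  by rewrite TAG_mixed_bilin.2 scalerDr !scalerA mulrC.
by rewrite TAG_mixed_bilin.1 scalerDr !scalerA mulrC.
Qed.

(* Locked: otherwise the rewriting of sums would unfold it into its parts. *)
Definition TAG_br : L -> L -> L :=
  locked (fun u u' => TAG_diag u u' + TAG_mixed u u' + - TAG_mixed_flip u u').

Lemma TAG_brE u u' : TAG_br u u' = TAG_diag u u' + TAG_mixed u u' - TAG_mixed_flip u u'.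
Proof. by rewrite /TAG_br -lock. Qed.

Lemma TAG_br_bilin : bilin TAG_br.
Proof.
rewrite /TAG_br -lock.
exact: bilin_add (bilin_add TAG_diag_bilin TAG_mixed_bilin) (bilin_opp TAG_mixed_flip_bilin).
Qed.

Lemma TAG_prE :
    (forall x a, (TAG_prS (sl x a) = x ⊗ a) * (TAG_prV (sl x a) = 0)
      * (TAG_prB (sl x a) = 0))
  * (forall v m, (TAG_prS (vm v m) = 0) * (TAG_prV (vm v m) = v ⊗ m)
      * (TAG_prB (vm v m) = 0))
  * (forall q, (TAG_prS (inB q) = 0) * (TAG_prV (inB q) = 0) * (TAG_prB (inB q) = q)).
Proof. by []. Qed.

Definition TAG_zeroE := (bilin0l sl_sl_part_bilin, bilin0r sl_sl_part_bilin, bilin0l sl_sl_B_bilin,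
  bilin0r sl_sl_B_bilin, bilin0l V_V_part_bilin, bilin0r V_V_part_bilin, bilin0l V_V_B_bilin,
  bilin0r V_V_B_bilin, bilin0l sl_V_part_bilin, bilin0r sl_V_part_bilin, bilin0l B_sl_part_bilin,
  bilin0r B_sl_part_bilin, bilin0l B_V_part_bilin, bilin0r B_V_part_bilin,
  bilin0l (B_actB_bilin T two_neq0), bilin0r (B_actB_bilin T two_neq0),
  linear_0 TAG_inS_linear, linear_0 TAG_inV_linear, linear_0 TAG_B_linear, addr0, add0r).

Lemma TAG_diagE : (forall x a y b, TAG_diag (sl x a) (sl y b)
    = sl (sl2_bracket x y) (a ·j b) + half_kappa x y *: inB (clJ T a b))
  * (forall v m w n, TAG_diag (vm v m) (vm w n)
    = sl (odotV v w) (m ⋆ n) + detV v w *: inB (clM T m n))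
  * (forall q q', TAG_diag (inB q) (inB q') = inB (actB q q'))
  * (forall x a v m, TAG_diag (sl x a) (vm v m) = 0)
  * (forall x a v m, TAG_diag (vm v m) (sl x a) = 0)
  * (forall x a q, TAG_diag (sl x a) (inB q) = 0)
  * (forall x a q, TAG_diag (inB q) (sl x a) = 0)
  * (forall v m q, TAG_diag (vm v m) (inB q) = 0)
  * (forall v m q, TAG_diag (inB q) (vm v m) = 0).
Proof.
by do !split; move=> *; rewrite /TAG_diag !TAG_prE ?(sl_sl_partE, sl_sl_BE, V_V_partE, V_V_BE)
  !TAG_zeroE ?TAG_BZ.
Qed.

Lemma TAG_mixedE : (forall q x a, TAG_mixed (inB q) (sl x a) = sl x (actJ q a))
  * (forall q v m, TAG_mixed (inB q) (vm v m) = vm v (actM q m))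
  * (forall x a v m, TAG_mixed (sl x a) (vm v m) = vm (natV_act x v) (a • m))
  * (forall q x a, TAG_mixed (sl x a) (inB q) = 0)
  * (forall q v m, TAG_mixed (vm v m) (inB q) = 0)
  * (forall x a v m, TAG_mixed (vm v m) (sl x a) = 0)
  * (forall x a y b, TAG_mixed (sl x a) (sl y b) = 0)
  * (forall v m w n, TAG_mixed (vm v m) (vm w n) = 0)
  * (forall q q', TAG_mixed (inB q) (inB q') = 0).
Proof.
by do !split; move=> *; rewrite /TAG_mixed !TAG_prE !TAG_zeroE ?(sl_V_partE, B_sl_partE, B_V_partE).
Qed.

Inductive TAG_gen (p : bool) : L -> Prop :=
  | TAG_gen_sl x a : homog p a -> TAG_gen p (sl x a)
  | TAG_gen_V v m : homog p m -> TAG_gen p (vm v m)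
  | TAG_gen_B q : homog p q -> TAG_gen p (inB q).

Lemma TAG_sl_homog p x a : homog p a -> homog p (sl x a).
Proof.
move=> ha; split; [split|]; [|exact: homog0|exact: homog0].
by rewrite -[p]addFb; apply: tensor_homog_gen.
Qed.
Lemma TAG_V_homog p v m : homog p m -> homog p (vm v m).
Proof.
move=> hm; split; [split|]; [exact: homog0| |exact: homog0].
by rewrite -[p]addFb; apply: tensor_homog_gen.
Qed.
Lemma TAG_B_homog p q : homog p q -> homog p (inB q).
Proof. by move=> hq; split; [split; exact: homog0|]. Qed.

Lemma TAG_gen_homog p (u : L) : TAG_gen p u -> homog p u.
Proof.
by case=> *; [exact: TAG_sl_homog|exact: TAG_V_homog|exact: TAG_B_homog].
Qed.

(** In a tensor product with an even space the parity is that of the second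
   factor. *)
Lemma even_tensor_span (E : lmodType K) (N : superspace K) p
    (t : tensor_superspace (purely_even E) N) : homog p t ->
  span (fun t => exists (e : purely_even E) (u : N), homog p u /\ t = e ⊗ u) t.
Proof.
move: t; refine (span_ind _ _); first exact: span0.
move=> k _ t [[] [r [e [u [he hu <- ->]]]]] IH; last first.
  by apply: span_lin IH; apply: span_gen; exists e, u.
by rewrite (he isT) tensor0l scaler0 add0r.
Qed.

Lemma TAG_span p (u : L) : homog p u -> span (TAG_gen p) u.
Proof.
case: u => [[s t] q] [[/= hs ht] hq].
have -> : ((s, t), q) = 1 *: TAG_inS s + (1 *: TAG_inV t + inB q) :> L.
  by pair_eq;
    rewrite /= ?scaler0 ?scale1r ?add0r ?addr0.
apply: span_lin; [|apply: span_lin]; last first.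
- by apply: span_gen; exact: TAG_gen_B.
- apply: (span_image TAG_inV_linear _ (even_tensor_span ht)) => _ [v [m [hm ->]]].
  exact: TAG_gen_V.
apply: (span_image TAG_inS_linear _ (even_tensor_span hs)) => _ [x [a [ha ->]]].
exact: TAG_gen_sl.
Qed.

Lemma TAG_br_homogE p p' (u u' : L) : homog p u -> homog p' u' ->
  TAG_br u u' = TAG_diag u u' + TAG_mixed u u' - sg (p * p') *: TAG_mixed u' u.
Proof.
move=> hu hu'; rewrite TAG_brE /TAG_mixed_flip (hext2E _ hu hu') // => q q'.
by split=> [w|w] k z z'; rewrite (TAG_mixed_bilin.1, TAG_mixed_bilin.2);
  rewrite scalerDr !scalerA mulrC.
Qed.

Lemma TAG_eq (W : lmodType K) (f g : L -> W) : linear f -> linear g ->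
  (forall p u, TAG_gen p u -> f u = g u) -> f =1 g.
Proof.
move=> hf hg e; apply: homog_ind => [u u' IH IH'|p u /TAG_span hu].
  by rewrite (linear_D hf) (linear_D hg) IH IH'.
by move: u hu; apply: span_eq => // u; exact: e.
Qed.

Lemma TAG_eq2 (W : lmodType K) (f g : L -> L -> W) : bilin f -> bilin g ->
  (forall p p' u u', TAG_gen p u -> TAG_gen p' u' -> f u u' = g u u') ->
  forall u u', f u u' = g u u'.
Proof.
move=> hf hg e u u'; move: u; apply: homog_ind => [u v|p u /TAG_span hu].
  by rewrite (bilinDl hf) (bilinDl hg) => -> ->.
move: u'; apply: homog_ind => [u' v|p' u' /TAG_span hu'].
  by rewrite (bilinDr hf) (bilinDr hg) => -> ->.
move: u hu; apply: (span_eq (hf.1 u') (hg.1 u')) => u hu.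
by move: u' hu'; apply: (span_eq (hf.2 u) (hg.2 u)) => u' hu'; exact: e hu hu'.
Qed.

Lemma TAG_clJ_anti p p' a b : homog p a -> homog p' b ->
  inB (clJ T a b) = - sg (p * p') *: inB (clJ T b a).
Proof. by move=> ha hb; rewrite (clJ_anti T two_neq0 ha hb); exact: TAG_BZ. Qed.

Lemma TAG_clM_symm p p' m n : homog p m -> homog p' n ->
  inB (clM T m n) = sg (p * p') *: inB (clM T n m).
Proof. by move=> hm hn; rewrite (clM_symm T two_neq0 hm hn); exact: TAG_BZ. Qed.

Lemma TAG_diag_anti p p' u u' : TAG_gen p u -> TAG_gen p' u' ->
  TAG_diag u u' = - sg (p * p') *: TAG_diag u' u.
Proof.
case=> [x a ha|v m hm|q hq]; case=> [y b hb|w n hn|q' hq']; rewrite !TAG_diagE ?scaler0 //.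
- rewrite (jmulC T ha hb) (TAG_clJ_anti ha hb) /half_kappa (kappaC x y).
  have -> : sl2_bracket x y = - sl2_bracket y x.
    by apply/val_inj; rewrite /= opprB.
  move: (inB (clJ T b a)) (b ·j a) (sl2_bracket y x) => q c z.
  by rewrite (bilinNl TAG_sl_bilin) (bilinZr TAG_sl_bilin); module_coefs K; ring.
- rewrite (mstar_anti T hm hn) (TAG_clM_symm hm hn) (detVC v w) (odotVC two_neq0 v w).
  move: (inB (clM T n m)) (n ⋆ m) (odotV w v) => q c z.
  by rewrite (bilinNr TAG_sl_bilin) (bilinZr TAG_sl_bilin); module_coefs K; ring.
- by rewrite (B_actB_anti two_neq0 hq hq'); exact: TAG_BZ.
Qed.

Lemma TAG_br_anti p p' u u' : homog p u -> homog p' u' ->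
  TAG_br u u' = - (sg (p * p') *: TAG_br u' u).
Proof.
move=> hu hu'; rewrite (TAG_br_homogE hu hu') (TAG_br_homogE hu' hu).
suff -> : TAG_diag u u' = - sg (p * p') *: TAG_diag u' u by signed_module two_neq0.
move: (TAG_span hu) (TAG_span hu') => {hu hu'} hu hu'.
move: u hu; apply: span_eq => [||u hu]; first exact: TAG_diag_bilin.1.
  exact: linear_scale (TAG_diag_bilin.2 u').
move: u' hu'; apply: span_eq => [||u' hu']; first exact: TAG_diag_bilin.2.
  exact: linear_scale (TAG_diag_bilin.1 u).
exact: TAG_diag_anti.
Qed.

Lemma TAG_br_sl_sl x a y b : TAG_br (sl x a) (sl y b)
  = sl (sl2_bracket x y) (a ·j b) + half_kappa x y *: inB (clJ T a b).
Proof.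
move: a b; apply: homog_ind => [a a' IH IH' b|p a ha].
  rewrite (bilinDr TAG_sl_bilin) (bilinDl TAG_br_bilin) IH IH' (bilinDl (jmul_bilin T)).
  rewrite (bilinDl (clJ_bilin T)) TAG_BD (bilinDr TAG_sl_bilin).
  by module_coefs K; ring.
apply: homog_ind => [b b' IH IH'|q b hb].
  rewrite (bilinDr TAG_sl_bilin) (bilinDr TAG_br_bilin) IH IH' (bilinDr (jmul_bilin T)).
  rewrite (bilinDr (clJ_bilin T)) TAG_BD (bilinDr TAG_sl_bilin).
  by module_coefs K; ring.
rewrite (TAG_br_homogE (TAG_sl_homog x ha) (TAG_sl_homog y hb)) TAG_diagE !TAG_mixedE.
by rewrite scaler0 subr0 addr0.
Qed.

End Bracket.

Section Jacobi.
Variables (K : fieldType) (J M : superspace K) (T : ternary_superalgebra J M).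
Hypothesis two_neq0 : 2 != 0 :> K.
Notation sg n := (sgn K n).
Notation "a ·j b" := (jmul T a b) (at level 40).
Notation "a • m" := (jact T a m) (at level 40).
Notation "m ⋆ n" := (mstar T m n) (at level 40).
Notation actJ := (@B_actJ K J M T).
Notation actM := (@B_actM K J M T).
Notation actB := (@B_actB K J M T).
Notation L := (TAG T).
Notation sl := (TAG_sl T).
Notation vm := (TAG_V T).
Notation inB := (@TAG_B K J M T).
Notation br := (@TAG_br K J M T).
Notation hk := (@half_kappa K).
Implicit Types (p pa pb pc pd pm pn pr ps : bool) (a b c d : J) (m n r s : M)
  (x y z : sl2 K) (v w : natV K) (q : Bs T).

Let brb := TAG_br_bilin T two_neq0.
Let slr x := (TAG_sl_bilin T).2 x.
Let vmr v := (TAG_V_bilin T).2 v.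
Let inBl : linear inB := @TAG_B_linear K J M T.
Let idl (V : lmodType K) : linear (@id V). Proof. by move=> k u v. Qed.

Lemma TAG_br_V_V v m w n : br (vm v m) (vm w n)
  = sl (odotV v w) (m ⋆ n) + detV v w *: inB (clM T m n).
Proof.
move: m n; apply: homog_eq2 => [||p q m n hm hn].
- exact: (bilin_comp brb (@idl L) (vmr v) (vmr w)).
- apply: bilin_add; first exact: (bilin_comp (mstar_bilin T) (slr _) (@idl M) (@idl M)).
  exact: (bilin_comp (clM_bilin T) (linear_scale _ inBl) (@idl M) (@idl M)).
rewrite (TAG_br_homogE two_neq0 (TAG_V_homog T v hm) (TAG_V_homog T w hn)) (TAG_diagE T two_neq0).
by rewrite !(TAG_mixedE T two_neq0) scaler0 subr0 addr0.
Qed.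

Lemma TAG_br_sl_V x a v m : br (sl x a) (vm v m) = vm (natV_act x v) (a • m).
Proof.
move: a m; apply: homog_eq2 => [||p q a m ha hm].
- exact: (bilin_comp brb (@idl L) (slr x) (vmr v)).
- exact: (bilin_comp (jact_bilin T) (vmr _) (@idl J) (@idl M)).
rewrite (TAG_br_homogE two_neq0 (TAG_sl_homog T x ha) (TAG_V_homog T v hm)) (TAG_diagE T two_neq0).
by rewrite !(TAG_mixedE T two_neq0) scaler0 subr0 add0r.
Qed.

Lemma TAG_br_B_sl q x a : br (inB q) (sl x a) = sl x (actJ q a).
Proof.
move: q a; apply: homog_eq2 => [||p p' q a hq ha].
- exact: (bilin_comp brb (@idl L) inBl (slr x)).
- exact: (bilin_comp (B_actJ_bilin T two_neq0) (slr x) (@idl (Bs T)) (@idl J)).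
rewrite (TAG_br_homogE two_neq0 (TAG_B_homog hq) (TAG_sl_homog T x ha)) (TAG_diagE T two_neq0).
by rewrite !(TAG_mixedE T two_neq0) scaler0 subr0 add0r.
Qed.

Lemma TAG_br_B_V q v m : br (inB q) (vm v m) = vm v (actM q m).
Proof.
move: q m; apply: homog_eq2 => [||p p' q m hq hm].
- exact: (bilin_comp brb (@idl L) inBl (vmr v)).
- exact: (bilin_comp (B_actM_bilin T two_neq0) (vmr v) (@idl (Bs T)) (@idl M)).
rewrite (TAG_br_homogE two_neq0 (TAG_B_homog hq) (TAG_V_homog T v hm)) (TAG_diagE T two_neq0).
by rewrite !(TAG_mixedE T two_neq0) scaler0 subr0 add0r.
Qed.

Lemma TAG_br_B_B q q' : br (inB q) (inB q') = inB (actB q q').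
Proof.
move: q q'; apply: homog_eq2 => [||p p' q q' hq hq'].
- exact: (bilin_comp brb (@idl L) inBl inBl).
- exact: (bilin_comp (B_actB_bilin T two_neq0) inBl (@idl (Bs T)) (@idl (Bs T))).
rewrite (TAG_br_homogE two_neq0 (TAG_B_homog hq) (TAG_B_homog hq')) (TAG_diagE T two_neq0).
by rewrite !(TAG_mixedE T two_neq0) scaler0 subr0 addr0.
Qed.

Lemma TAG_gen_br_homog p p' u u' : TAG_gen p u -> TAG_gen p' u' ->
  homog (p (+) p') (br u u').
Proof.
have flip (v v' : L) : TAG_gen p v -> TAG_gen p' v' ->
    homog (p (+) p') (br v' v) -> homog (p (+) p') (br v v').
  move=> /TAG_gen_homog hv /TAG_gen_homog hv' h; rewrite (TAG_br_anti two_neq0 hv hv').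
  exact/homogN/homogZ.
have hJ po q pa a (hq : homog po q) (ha : homog pa a) : homog (po (+) pa) (actJ q a).
  exact: (sd_homogJ (superder_B two_neq0 hq) ha).
have hM po q pm m (hq : homog po q) (hm : homog pm m) : homog (po (+) pm) (actM q m).
  exact: (sd_homogM (superder_B two_neq0 hq) hm).
move=> hu hu'; case: (hu) => [x a ha|v m hm|q hq]; case: (hu') => [y b hb|w n hn|q' hq'].
- rewrite (TAG_br_sl_sl T two_neq0); apply: homogD.
    exact: TAG_sl_homog (jmul_homog T ha hb).
  exact: homogZ (TAG_B_homog (clJ_homog T ha hb)).
- by rewrite TAG_br_sl_V; exact: TAG_V_homog (jact_homog T ha hn).
- apply: flip; [exact: TAG_gen_sl|exact: TAG_gen_B|].
  by rewrite TAG_br_B_sl addbC; exact: TAG_sl_homog (hJ _ _ _ _ hq' ha).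
- apply: flip; [exact: TAG_gen_V|exact: TAG_gen_sl|].
  by rewrite TAG_br_sl_V addbC; exact: TAG_V_homog (jact_homog T hb hm).
- rewrite TAG_br_V_V; apply: homogD; first exact: TAG_sl_homog (mstar_homog T hm hn).
  exact: homogZ (TAG_B_homog (clM_homog T hm hn)).
- apply: flip; [exact: TAG_gen_V|exact: TAG_gen_B|].
  by rewrite TAG_br_B_V addbC; exact: TAG_V_homog (hM _ _ _ _ hq' hm).
- by rewrite TAG_br_B_sl; exact: TAG_sl_homog (hJ _ _ _ _ hq hb).
- by rewrite TAG_br_B_V; exact: TAG_V_homog (hM _ _ _ _ hq hn).
- by rewrite TAG_br_B_B; exact: TAG_B_homog (B_actB_homog two_neq0 hq hq').
Qed.

Lemma TAG_br_homog p p' u u' : homog p u -> homog p' u' -> homog (p (+) p') (br u u').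
Proof.
move=> /TAG_span hu /TAG_span hu'; move: u hu.
apply: (span_ind (P := fun u => homog (p (+) p') (br u u'))).
  by rewrite (bilin0l brb); exact: homog0.
move=> k u v hu IH; rewrite brb.1; apply: homog_lin IH.
move: u' hu' {v}; apply: (span_ind (P := fun u' => homog (p (+) p') (br u u'))).
  by rewrite (bilin0r brb); exact: homog0.
move=> l u' v hu' IH; rewrite brb.2; apply: homog_lin IH.
exact: TAG_gen_br_homog.
Qed.

(** The sign involves only the parities of the first two arguments. *)
Definition jacobi p p' (u1 u2 u3 : L) : Prop :=
  br u1 (br u2 u3) = br (br u1 u2) u3 + sg (p * p') *: br u2 (br u1 u3).

Lemma jacobi_swap12 p p' (u1 u2 u3 : L) : homog p u1 -> homog p' u2 ->
  jacobi p p' u1 u2 u3 -> jacobi p' p u2 u1 u3.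
Proof.
move=> h1 h2; rewrite /jacobi (TAG_br_anti two_neq0 h2 h1) (bilinNl brb) (bilinZl brb).
move: (br u1 _) (br u2 _) (br _ u3) => A B C e.
by apply: (add_eq (- sg (p * p')) e); signed_module two_neq0.
Qed.

Lemma jacobi_swap23 p p' p'' (u1 u2 u3 : L) :
  homog p u1 -> homog p' u2 -> homog p'' u3 ->
  jacobi p p' u1 u2 u3 -> jacobi p p'' u1 u3 u2.
Proof.
move=> h1 h2 h3; rewrite /jacobi => e.
rewrite (TAG_br_anti two_neq0 h3 h2) (bilinNr brb) (bilinZr brb).
rewrite (TAG_br_anti two_neq0 (TAG_br_homog h1 h3) h2).
rewrite (TAG_br_anti two_neq0 h3 (TAG_br_homog h1 h2)).
move: (br u1 _) (br u2 _) (br _ u3) e => A B C e.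
by apply: (add_eq (- sg (p' * p'')) e); signed_module two_neq0.
Qed.

Lemma TAG_br_sl_B p p' x a q : homog p a -> homog p' q ->
  br (sl x a) (inB q) = - (sg (p * p') *: sl x (actJ q a)).
Proof.
move=> ha hq; rewrite (TAG_br_anti two_neq0 (TAG_sl_homog T x ha) (TAG_B_homog hq)).
by rewrite TAG_br_B_sl.
Qed.

Lemma TAG_br_V_B p p' v m q : homog p m -> homog p' q ->
  br (vm v m) (inB q) = - (sg (p * p') *: vm v (actM q m)).
Proof.
move=> hm hq; rewrite (TAG_br_anti two_neq0 (TAG_V_homog T v hm) (TAG_B_homog hq)).
by rewrite TAG_br_B_V.
Qed.

Lemma TAG_br_V_sl p p' x a v m : homog p m -> homog p' a ->
  br (vm v m) (sl x a) = - (sg (p * p') *: vm (natV_act x v) (a • m)).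
Proof.
move=> hm ha; rewrite (TAG_br_anti two_neq0 (TAG_V_homog T v hm) (TAG_sl_homog T x ha)).
by rewrite TAG_br_sl_V.
Qed.

Lemma TAG_slD x a b : sl x (a + b) = sl x a + sl x b.
Proof. exact: (bilinDr (TAG_sl_bilin T)). Qed.
Lemma TAG_slZ k x a : sl x (k *: a) = k *: sl x a.
Proof. exact: (bilinZr (TAG_sl_bilin T)). Qed.
Lemma TAG_slN x a : sl x (- a) = - sl x a.
Proof. exact: (bilinNr (TAG_sl_bilin T)). Qed.
Lemma TAG_VD v m n : vm v (m + n) = vm v m + vm v n.
Proof. exact: (bilinDr (TAG_V_bilin T)). Qed.
Lemma TAG_VZ k v m : vm v (k *: m) = k *: vm v m.
Proof. exact: (bilinZr (TAG_V_bilin T)). Qed.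
Lemma TAG_VN v m : vm v (- m) = - vm v m.
Proof. exact: (bilinNr (TAG_V_bilin T)). Qed.
Lemma TAG_BN q : inB (- q) = - inB q.
Proof. exact: (linear_N inBl). Qed.

Lemma TAG_B_comb k l q q' : inB (k *: q - l *: q') = k *: inB q - l *: inB q'.
Proof.
rewrite TAG_BD TAG_BN; exact: congr2 (TAG_BZ k q) (congr1 -%R (TAG_BZ l q')).
Qed.

(** A Jacobi identity with two arguments in B is the representation property of
   the action of B, and one with a single argument in B is the derivation
   property for the bracket of the other two. *)
Lemma jacobi_BBB p p' q q' q'' : homog p q -> homog p' q' ->
  jacobi p p' (inB q) (inB q') (inB q'').
Proof.
move=> hq hq'; rewrite /jacobi !TAG_br_B_B (B_actB_B two_neq0 q'' hq hq').
move: (actB q _) (actB q' _) => r r'.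
by rewrite TAG_BD TAG_BN TAG_BZ; signed_module two_neq0.
Qed.

Lemma jacobi_BBs p p' q q' x a : homog p q -> homog p' q' ->
  jacobi p p' (inB q) (inB q') (sl x a).
Proof.
move=> hq hq'; rewrite /jacobi TAG_br_B_B !TAG_br_B_sl (B_actJ_B two_neq0 a hq hq').
move: (actJ q _) (actJ q' _) => b c.
by rewrite TAG_slD TAG_slN TAG_slZ; signed_module two_neq0.
Qed.

Lemma jacobi_BBV p p' q q' v m : homog p q -> homog p' q' ->
  jacobi p p' (inB q) (inB q') (vm v m).
Proof.
move=> hq hq'; rewrite /jacobi TAG_br_B_B !TAG_br_B_V (B_actM_B two_neq0 m hq hq').
move: (actM q _) (actM q' _) => n r.
by rewrite TAG_VD TAG_VN TAG_VZ; signed_module two_neq0.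
Qed.

Lemma jacobi_Bss p pa pb q x a y b : homog p q -> homog pa a -> homog pb b ->
  jacobi p pa (inB q) (sl x a) (sl y b).
Proof.
move=> hq ha hb; rewrite /jacobi !TAG_br_B_sl !(TAG_br_sl_sl T two_neq0).
rewrite (bilinDr brb) (bilinZr brb) TAG_br_B_sl TAG_br_B_B.
rewrite (sd_jmul (superder_B two_neq0 hq) ha hb) (B_actB_clJ two_neq0 b hq ha).
move: (actJ q a ·j b) (a ·j actJ q b) (clJ T (actJ q a) b) (clJ T a (actJ q b)) => c d r r'.
rewrite TAG_BD TAG_BZ TAG_slD TAG_slZ.
by signed_coefs K two_neq0 ltac:(case: p pa {hq ha} => -[]).
Qed.

Lemma jacobi_BsV p pa pm q x a v m : homog p q -> homog pa a -> homog pm m ->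
  jacobi p pa (inB q) (sl x a) (vm v m).
Proof.
move=> hq ha hm; rewrite /jacobi !TAG_br_B_V !TAG_br_B_sl !TAG_br_sl_V TAG_br_B_V.
rewrite (sd_jact (superder_B two_neq0 hq) ha hm).
move: (actJ q a • m) (a • actM q m) => n r.
by rewrite TAG_VD TAG_VZ.
Qed.

Lemma jacobi_BVV p pm pn q v m w n : homog p q -> homog pm m -> homog pn n ->
  jacobi p pm (inB q) (vm v m) (vm w n).
Proof.
move=> hq hm hn; rewrite /jacobi !TAG_br_B_V !TAG_br_V_V.
rewrite (bilinDr brb) (bilinZr brb) TAG_br_B_sl TAG_br_B_B.
rewrite (sd_mstar (superder_B two_neq0 hq) hm hn) (B_actB_clM two_neq0 n hq hm).
move: (actM q m ⋆ n) (m ⋆ actM q n) (clM T (actM q m) n) (clM T m (actM q n)) => c d r r'.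
rewrite TAG_BD TAG_BZ TAG_slD TAG_slZ.
by signed_coefs K two_neq0 ltac:(case: p pm {hq hm} => -[]).
Qed.

Lemma TAG_slDl x y a : sl (x + y) a = sl x a + sl y a.
Proof. exact: (bilinDl (TAG_sl_bilin T)). Qed.
Lemma TAG_slZl k x a : sl (k *: x) a = k *: sl x a.
Proof. exact: (bilinZl (TAG_sl_bilin T)). Qed.
Lemma TAG_slNl x a : sl (- x) a = - sl x a.
Proof. exact: (bilinNl (TAG_sl_bilin T)). Qed.
Lemma TAG_VDl v w m : vm (v + w) m = vm v m + vm w m.
Proof. exact: (bilinDl (TAG_V_bilin T)). Qed.
Lemma TAG_VZl k v m : vm (k *: v) m = k *: vm v m.
Proof. exact: (bilinZl (TAG_V_bilin T)). Qed.
Lemma TAG_VNl v m : vm (- v) m = - vm v m.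
Proof. exact: (bilinNl (TAG_V_bilin T)). Qed.

(** I_{a,b,c} in the form in which it enters the Jacobi identity on sl2 ⊗ J. *)
Lemma clJ_cycle pa pb pc a b c : homog pa a -> homog pb b -> homog pc c ->
  clJ T a (b ·j c) = clJ T (a ·j b) c - sg (pa * pb) *: clJ T b (a ·j c).
Proof.
move=> ha hb hc; have h := rRs_abc (respects_Rs_cl T) ha hb hc.
rewrite (jmulC T hc ha) (bilinZl (clJ_bilin T)) in h.
apply: (add_eq (- sg (pa * pc)) h).
apply: (add_eq 1 (clJ_anti T two_neq0 ha (jmul_homog T hb hc))).
apply: (add_eq (sg (pa * pb)) (clJ_anti T two_neq0 hb (jmul_homog T ha hc))).
signed_module two_neq0.
Qed.

Lemma B_actJ_clJE pa pb a b c : homog pa a -> homog pb b ->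
  actJ (clJ T a b) c = angleJ T pa pb a b c.
Proof. by move=> ha hb; rewrite (B_actJ_clJ T two_neq0) (ext_angleJE T c ha hb). Qed.

(** The part in sl2 ⊗ J compares the coefficients of k(x, y) z, k(x, z) y and k(y, z) x,
   which are instances of the definition of <a, b>. The part in B has the factor
   k([x, y], z) throughout, by invariance of the form. *)
Lemma jacobi_sss pa pb pc x a y b z c : homog pa a -> homog pb b -> homog pc c ->
  jacobi pa pb (sl x a) (sl y b) (sl z c).
Proof.
move=> ha hb hc; rewrite /jacobi !(TAG_br_sl_sl T two_neq0).
rewrite !(bilinDr brb) !(bilinZr brb) !(bilinDl brb) !(bilinZl brb).
rewrite !(TAG_br_sl_sl T two_neq0) TAG_br_B_sl.
rewrite (TAG_br_sl_B x ha (clJ_homog T hb hc)) (TAG_br_sl_B y hb (clJ_homog T ha hc)).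
rewrite (clJ_cycle ha hb hc) (B_actJ_clJE _ ha hb) (B_actJ_clJE _ hb hc) (B_actJ_clJE _ ha hc).
rewrite /angleJ (jmulC T hc ha) (jmulC T hc hb) (jmulC T hb ha).
rewrite (jmulC T (jmul_homog T ha hb) hc) !(bilinZr (jmul_bilin T)).
rewrite (half_kappa_bracket y x z) (sl2_bracketC y x) (half_kappa_bracket x y z).
rewrite !(sl2_bracket2r two_neq0) (sl2_bracket2l two_neq0) (half_kappaC y x).
rewrite (half_kappaNl two_neq0).
move: (hk (sl2_bracket x y) z) (hk x y) (hk y z) (hk x z) => k0 k1 k2 k3.
move: (a ·j (b ·j c)) (b ·j (a ·j c)) (c ·j (a ·j b)) => A B C.
move: (clJ T (a ·j b) c) (clJ T b (a ·j c)) => D E.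
rewrite TAG_BD TAG_BN TAG_BZ !TAG_slDl !TAG_slNl !TAG_slZl !TAG_slD !TAG_slN !TAG_slZ.
by signed_coefs K two_neq0 ltac:(case: pa pb pc {ha hb hc} => -[] []).
Qed.

(** Writing xy and yx as ±[x, y]/2 + k(x, y)/4, the terms in [x, y] are the special
   module axiom and those in k(x, y) the definition of <a, b> on M. *)
Lemma jacobi_ssV pa pb x a y b v m : homog pa a -> homog pb b ->
  jacobi pa pb (sl x a) (sl y b) (vm v m).
Proof.
move=> ha hb; rewrite /jacobi !TAG_br_sl_V (TAG_br_sl_sl T two_neq0).
rewrite (bilinDl brb) (bilinZl brb) !TAG_br_sl_V TAG_br_B_V.
rewrite (B_actM_clJ T two_neq0) (ext_angleME T m ha hb) /angleM (jactM T m ha hb).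
rewrite (natV_act2 two_neq0 x y) (natV_act2 two_neq0 y x) (half_kappaC y x) (sl2_bracketC y x).
rewrite (bilinNl (natV_act_bilin K)).
move: (natV_act (sl2_bracket x y) v) (a • (b • m)) (b • (a • m)) (hk x y) => w n r k.
rewrite !(TAG_VDl, TAG_VZl, TAG_VNl, TAG_VZ, TAG_VD, TAG_VN).
by signed_coefs K two_neq0 ltac:(case: pa pb {ha hb} => -[]).
Qed.

Lemma TAG_clM_jact pa pm pn a m n : homog pa a -> homog pm m -> homog pn n ->
  inB (clM T (a • m) n) = sg (pa * pm) *: inB (clM T m (a • n))
    - (2 : K) *: inB (clJ T a (m ⋆ n)).
Proof.
move=> ha hm hn.
have -> : clM T (a • m) n = sg (pa * pm) *: clM T m (a • n) - (2 : K) *: clJ T a (m ⋆ n).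
  apply: (add_eq 1 (rRs_amn (respects_Rs_cl T) ha hm hn)).
  apply: (add_eq 2 (clJ_anti T two_neq0 ha (mstar_homog T hm hn))).
  signed_module two_neq0.
exact: TAG_B_comb.
Qed.

(** The terms in [x, v ⊙ w] are SJT1, those in det(v, w) x the definition of ∂ on J,
   and those in B are I_{a,m,n} with the factor det(xv, w). *)
Lemma jacobi_sVV pa pm pn x a v m w n : homog pa a -> homog pm m -> homog pn n ->
  jacobi pa pm (sl x a) (vm v m) (vm w n).
Proof.
move=> ha hm hn; rewrite /jacobi !TAG_br_sl_V !TAG_br_V_V.
rewrite (bilinDr brb) (bilinZr brb) (TAG_br_sl_sl T two_neq0).
rewrite (TAG_br_sl_B x ha (clM_homog T hm hn)) (half_kappa_odotV two_neq0).
rewrite (B_actJ_clM T two_neq0) (ext_partialJE T hm hn ha) /partialJ (sjt1 T ha hm hn).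
rewrite (odotV_actl two_neq0) (odotV_actr two_neq0) detV_act (TAG_clM_jact ha hm hn).
move: (inB (clM T m (a • n))) (inB (clJ T a (m ⋆ n))) => D E.
move: ((a • m) ⋆ n) (m ⋆ (a • n)) (sl2_bracket x _) (detV v w) (detV _ w) => b c y k l.
rewrite !(TAG_slDl, TAG_slZl, TAG_slNl, TAG_slZ, TAG_slD, TAG_slN).
by signed_coefs K two_neq0 ltac:(case: pa pm pn {ha hm hn} => -[] []).
Qed.

(** SJT4 and SJT3 combined: a transposition followed by a reversal is a cyclic
   permutation of the arguments. *)
Lemma mtri_cycle pm pn pr m n r : homog pm m -> homog pn n -> homog pr r ->
  mtri T m n r = sg (pm * (pn + pr)) *: (mtri T n r m - (n ⋆ r) • m)
    - sg (pn * pr) *: ((m ⋆ r) • n).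
Proof.
move=> hm hn hr.
apply: (add_eq (- sg (pm * (pn + pr))) (sjt4 T hn hr hm)).
apply: (add_eq (- sg (pm * (pn + pr) + pn * pr)) (sjt3 T hr hn hm)).
rewrite (mstar_anti T hr hm) (bilinNl (jact_bilin T)) (bilinZl (jact_bilin T)).
signed_module two_neq0.
Qed.

(** Three vectors of the plane V satisfy a linear relation; it lets the first
   tensor factors in the Jacobi identity on V ⊗ M be reduced to two of them. *)
Lemma TAG_V_cycle u v w m :
  detV v w *: vm u m = detV u w *: vm v m - detV u v *: vm w m.
Proof.
rewrite -!TAG_VZl -TAG_VNl -TAG_VDl; congr (vm _ m).
apply/eqP; rewrite -subr_eq0; apply/eqP.
rewrite -[RHS](detV_cycle u v w) (detVC w u) scaleNr.
by module_coefs K; ring.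
Qed.

(** With the triple products reduced to (n, r, m), only first tensor factors u, v
   and w remain to be compared; [TAG_V_cycle] eliminates u. *)
Lemma jacobi_VVV pm pn pr u v w m n r : homog pm m -> homog pn n -> homog pr r ->
  jacobi pm pn (vm u m) (vm v n) (vm w r).
Proof.
move=> hm hn hr; rewrite /jacobi !TAG_br_V_V.
rewrite !(bilinDr brb) !(bilinZr brb) !(bilinDl brb) !(bilinZl brb).
rewrite TAG_br_sl_V TAG_br_B_V.
rewrite (TAG_br_V_sl (odotV v w) u hm (mstar_homog T hn hr)).
rewrite (TAG_br_V_sl (odotV u w) v hn (mstar_homog T hm hr)).
rewrite (TAG_br_V_B u hm (clM_homog T hn hr)) (TAG_br_V_B v hn (clM_homog T hm hr)).
rewrite !(B_actM_clM T two_neq0) /partialM !(natV_act_odotV two_neq0).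
rewrite (mtri_cycle hm hn hr) (sjt3 T hm hr hn).
rewrite (detVC v u) (detVC w u) (detVC w v).
move: ((n ⋆ r) • m) ((m ⋆ n) • r) ((m ⋆ r) • n) (mtri T n r m) => A B C D.
rewrite !(TAG_VDl, TAG_VZl, TAG_VNl, TAG_VZ, TAG_VD, TAG_VN).
have eA := TAG_V_cycle u v w A; have eB := TAG_V_cycle u v w B.
have eC := TAG_V_cycle u v w C; have eD := TAG_V_cycle u v w D.
move: (detV u v) (detV v w) (detV u w) eA eB eC eD => k1 k2 k3 eA eB eC eD.
apply: (add_eq (- 2^-1 * sg (pm * (pn + pr))) eA); apply: (add_eq (- 2^-1) eB).
apply: (add_eq (- 2^-1 * sg (pn * pr)) eC); apply: (add_eq (sg (pm * (pn + pr))) eD).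
by signed_coefs K two_neq0 ltac:(case: pm pn pr {hm hn hr} => -[] []).
Qed.

(** By permutation the arguments are brought into the order B, sl2 ⊗ J, V ⊗ M. *)
Lemma jacobi_gen p p' p'' (u1 u2 u3 : L) :
  TAG_gen p u1 -> TAG_gen p' u2 -> TAG_gen p'' u3 -> jacobi p p' u1 u2 u3.
Proof.
move=> g1 g2 g3; have h1 := TAG_gen_homog g1; have h2 := TAG_gen_homog g2.
have h3 := TAG_gen_homog g3.
have s12 := jacobi_swap12 h2 h1 (u3 := u3).
have s23 := jacobi_swap23 h1 h3 h2.
have s231 (h : jacobi p' p'' u2 u3 u1) : jacobi p p' u1 u2 u3.
  exact: s12 (jacobi_swap23 h2 h3 h1 h).
have s312 (h : jacobi p'' p u3 u1 u2) : jacobi p p' u1 u2 u3.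
  exact: s23 (jacobi_swap12 h3 h1 h).
have s321 (h : jacobi p'' p' u3 u2 u1) : jacobi p p' u1 u2 u3.
  exact: s231 (jacobi_swap12 h3 h2 h).
move: s12 s23 s231 s312 s321 => {h1 h2 h3}.
case: g1 => [x1 a1 ha1|v1 m1 hm1|q1 hq1]; case: g2 => [x2 a2 ha2|v2 m2 hm2|q2 hq2];
  case: g3 => [x3 a3 ha3|v3 m3 hm3|q3 hq3] s12 s23 s231 s312 s321.
- exact: (jacobi_sss _ _ _ ha1 ha2 ha3).
- exact: (jacobi_ssV _ _ _ _ ha1 ha2).
- apply: s312; exact: (jacobi_Bss _ _ hq3 ha1 ha2).
- apply: s23; exact: (jacobi_ssV _ _ _ _ ha1 ha3).
- exact: (jacobi_sVV _ _ _ ha1 hm2 hm3).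
- apply: s312; exact: (jacobi_BsV _ _ hq3 ha1 hm2).
- apply: s12; exact: (jacobi_Bss _ _ hq2 ha1 ha3).
- apply: s12; exact: (jacobi_BsV _ _ hq2 ha1 hm3).
- apply: s231; exact: (jacobi_BBs _ _ hq2 hq3).
- apply: s231; exact: (jacobi_ssV _ _ _ _ ha2 ha3).
- apply: s12; exact: (jacobi_sVV _ _ _ ha2 hm1 hm3).
- apply: s321; exact: (jacobi_BsV _ _ hq3 ha2 hm1).
- apply: s312; exact: (jacobi_sVV _ _ _ ha3 hm1 hm2).
- exact: (jacobi_VVV _ _ _ hm1 hm2 hm3).
- apply: s312; exact: (jacobi_BVV _ _ hq3 hm1 hm2).
- apply: s231; exact: (jacobi_BsV _ _ hq2 ha3 hm1).
- apply: s12; exact: (jacobi_BVV _ _ hq2 hm1 hm3).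
- apply: s231; exact: (jacobi_BBV _ _ hq2 hq3).
- exact: (jacobi_Bss _ _ hq1 ha2 ha3).
- exact: (jacobi_BsV _ _ hq1 ha2 hm3).
- apply: s23; exact: (jacobi_BBs _ _ hq1 hq3).
- apply: s23; exact: (jacobi_BsV _ _ hq1 ha3 hm2).
- exact: (jacobi_BVV _ _ hq1 hm2 hm3).
- apply: s23; exact: (jacobi_BBV _ _ hq1 hq3).
- exact: (jacobi_BBs _ _ hq1 hq2).
- exact: (jacobi_BBV _ _ hq1 hq2).
- exact: (jacobi_BBB _ hq1 hq2).
Qed.

Lemma TAG_jacobi p p' (u1 u2 u3 : L) : homog p u1 -> homog p' u2 ->
  jacobi p p' u1 u2 u3.
Proof.
move=> h1 h2; move: u3; apply: homog_ind => [u u'|p'' u3 h3].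
  rewrite /jacobi !(bilinDr brb) => -> ->.
  by move: (br (br _ _) _) (br _ (br _ _)) => A B; signed_module two_neq0.
have lin_add (f g : L -> L) k : linear f -> linear g -> linear (fun u => f u + k *: g u).
  by move=> hf hg l u u'; rewrite hf hg !scalerDr !scalerA [l * k]mulrC addrACA.
have l1 u : linear (br u) := brb.2 u.
have l2 u : linear (br^~ u) := brb.1 u.
move: u1 {h1} (TAG_span h1); apply: span_eq => [||u1 g1].
- exact: l2.
- apply: lin_add; first exact: (linear_comp (l2 u3) (l2 u2)).
  exact: (linear_comp (l1 u2) (l2 u3)).
move: u2 {h2} (TAG_span h2); apply: span_eq => [||u2 g2].
- exact: (linear_comp (l1 u1) (l2 u3)).
- apply: lin_add; first exact: (linear_comp (l2 u3) (l1 u1)).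
  exact: l2.
move: u3 {h3} (TAG_span h3); apply: span_eq => [||u3 g3].
- exact: (linear_comp (l1 u1) (l1 u2)).
- apply: lin_add; first exact: l1.
  exact: (linear_comp (l1 u2) (l1 u1)).
exact: jacobi_gen g1 g2 g3.
Qed.

Lemma TAG_Lie_superalgebra : Lie_superalgebra br.
Proof.
split; first by split; [exact: brb|move=> p p' u v; exact: TAG_br_homog].
  by move=> p p' u v; exact: TAG_br_anti.
by move=> p p' u v w hu hv; exact: TAG_jacobi.
Qed.

End Jacobi.

(** * The defining formulas and the action of sl2 *)

Section Conclusion.
Variables (K : fieldType) (J M : superspace K) (T : ternary_superalgebra J M).
Hypothesis two_neq0 : 2 != 0 :> K.
Notation sg n := (sgn K n).
Notation actJ := (@B_actJ K J M T).
Notation actM := (@B_actM K J M T).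
Notation L := (TAG T).
Notation sl := (TAG_sl T).
Notation vm := (TAG_V T).
Notation inB := (@TAG_B K J M T).
Notation br := (@TAG_br K J M T).
Notation act := (@short_action K J M (Bs T)).
Implicit Types (p pa pb pc pd pm pn pr ps : bool) (a b c d : J) (m n r s : M)
  (x y z : sl2 K) (v w : natV K) (q : Bs T).

Let brb := TAG_br_bilin T two_neq0.

Lemma TAG_br_bracket : TAG_bracket br.
Proof.
split.
- exact: brb.
- by move=> p p' u v; exact: TAG_br_anti.
- move=> pa pb pc a b c d ha hb hc; rewrite (TAG_br_B_B two_neq0).
  rewrite (B_actB_clJ two_neq0 d (clJ_homog T ha hb) hc).
  by rewrite !(B_actJ_clJE T two_neq0 _ ha hb).
- move=> pa pb pm a b m n ha hb hm; rewrite (TAG_br_B_B two_neq0).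
  rewrite (B_actB_clM two_neq0 n (clJ_homog T ha hb) hm).
  by rewrite !(B_actM_clJ T two_neq0) !(ext_angleME T _ ha hb).
- move=> pm pn pr m n r s hm hn hr; rewrite (TAG_br_B_B two_neq0).
  rewrite (B_actB_clM two_neq0 s (clM_homog T hm hn) hr).
  by rewrite !(B_actM_clM T two_neq0).
- move=> pa pb a b x c ha hb.
  by rewrite (TAG_br_B_sl two_neq0) (B_actJ_clJE T two_neq0 _ ha hb).
- move=> pm pn pc m n x c hm hn hc.
  by rewrite (TAG_br_B_sl two_neq0) (B_actJ_clM T two_neq0) (ext_partialJE T hm hn hc).
- move=> pa pb a b v m ha hb.
  by rewrite (TAG_br_B_V two_neq0) (B_actM_clJ T two_neq0) (ext_angleME T m ha hb).
- by move=> m n v r; rewrite (TAG_br_B_V two_neq0) (B_actM_clM T two_neq0).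
- move=> x y a b; rewrite (TAG_br_sl_sl T two_neq0); congr (_ + _).
  exact: esym (TAG_BZ _ _).
- by move=> x v a m; rewrite (TAG_br_sl_V T two_neq0).
- move=> v w m n; rewrite (TAG_br_V_V T two_neq0); congr (_ + _).
  exact: esym (TAG_BZ _ _).
Qed.

(** The formulas, extended by bilinearity and super-anticommutativity, determine
   the bracket on all pairs of generators. *)
Lemma TAG_bracket_unique (br1 br2 : L -> L -> L) :
  TAG_bracket br1 -> TAG_bracket br2 -> forall u u', br1 u u' = br2 u u'.
Proof.
move=> h1 h2; have [b1 b2] := (TAG_bilin h1, TAG_bilin h2).
have inBl := @TAG_B_linear K J M T.
have flip p p' u u' : homog p u -> homog p' u' -> br1 u' u = br2 u' u ->
    br1 u u' = br2 u u'.
  by move=> hu hu' e; rewrite (TAG_anti h1 hu hu') (TAG_anti h2 hu hu') e.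
have B_sl p q p' x c : homog p q -> homog p' c -> br1 (inB q) (sl x c) = br2 (inB q) (sl x c).
  move=> hq hc; move: q {hq} (B_span hq); apply: span_eq.
  - exact: (linear_comp (b1.1 (sl x c)) inBl).
  - exact: (linear_comp (b2.1 (sl x c)) inBl).
  move=> _ [pa pb a b ha hb _|pm pn m n hm hn _].
    by rewrite (TAG_abxc h1 x c ha hb) (TAG_abxc h2 x c ha hb).
  by rewrite (TAG_mnxc h1 x hm hn hc) (TAG_mnxc h2 x hm hn hc).
have B_V p q v r : homog p q -> br1 (inB q) (vm v r) = br2 (inB q) (vm v r).
  move=> hq; move: q {hq} (B_span hq); apply: span_eq.
  - exact: (linear_comp (b1.1 (vm v r)) inBl).
  - exact: (linear_comp (b2.1 (vm v r)) inBl).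
  move=> _ [pa pb a b ha hb _|pm pn m n hm hn _].
    by rewrite (TAG_abvm h1 v r ha hb) (TAG_abvm h2 v r ha hb).
  by rewrite (TAG_mnvr h1) (TAG_mnvr h2).
have JM pa pb pm pn a b m n : homog pa a -> homog pb b -> homog pm m -> homog pn n ->
    br1 (inB (clJ T a b)) (inB (clM T m n)) = br2 (inB (clJ T a b)) (inB (clM T m n)).
  by move=> ha hb hm hn; rewrite (TAG_abmn h1 n ha hb hm) (TAG_abmn h2 n ha hb hm).
have B_B p q p' q' : homog p q -> homog p' q' -> br1 (inB q) (inB q') = br2 (inB q) (inB q').
  move=> hq hq'; move: q {hq} (B_span hq); apply: span_eq.
  - exact: (linear_comp (b1.1 (inB q')) inBl).
  - exact: (linear_comp (b2.1 (inB q')) inBl).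
  move=> q hq; move: q' {hq'} (B_span hq'); apply: span_eq.
  - exact: (linear_comp (b1.2 (inB q)) inBl).
  - exact: (linear_comp (b2.2 (inB q)) inBl).
  case: hq => [pa pb a b ha hb _|pm pn m n hm hn _] _ [pc pd c d hc hd _|pr ps r s hr hs _].
  - by rewrite (TAG_abcd h1 d ha hb hc) (TAG_abcd h2 d ha hb hc).
  - exact: JM ha hb hr hs.
  - apply: flip (TAG_B_homog (clM_homog T hm hn)) (TAG_B_homog (clJ_homog T hc hd)) _.
    exact: JM hc hd hm hn.
  - by rewrite (TAG_mnrs h1 s hm hn hr) (TAG_mnrs h2 s hm hn hr).
apply: TAG_eq2 => // p p' u u' gu gu'.
have hu := TAG_gen_homog gu; have hu' := TAG_gen_homog gu'.
case: gu hu => [x a ha|v m hm|q hq] hu; case: gu' hu' => [y b hb|w n hn|q' hq'] hu'.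
- by rewrite (TAG_xayb h1) (TAG_xayb h2).
- by rewrite (TAG_xavm h1) (TAG_xavm h2).
- exact: flip hu hu' (B_sl _ _ _ _ _ hq' ha).
- by apply: flip hu hu' _; rewrite (TAG_xavm h1) (TAG_xavm h2).
- by rewrite (TAG_vmwn h1) (TAG_vmwn h2).
- exact: flip hu hu' (B_V _ _ _ _ hq').
- exact: B_sl hq hb.
- exact: B_V hq.
- exact: B_B hq hq'.
Qed.

Lemma act_sl x y a : act x (sl y a) = sl (sl2_bracket x y) a.
Proof. by have [] := short_actionE x y (0 : natV K) a (0 : M) (0 : Bs T). Qed.
Lemma act_V x v m : act x (vm v m) = vm (natV_act x v) m.
Proof. by have [] := short_actionE x (0 : sl2 K) v (0 : J) m (0 : Bs T). Qed.
Lemma act_B x q : act x (inB q) = 0 :> L.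
Proof. by have [] := short_actionE x (0 : sl2 K) (0 : natV K) (0 : J) (0 : M) q. Qed.

Lemma short_action_bilin : bilin (fun x (u : L) => act x u).
Proof.
pose FS x (y : sl2 K) a : tensor_superspace (purely_even (sl2 K)) J := sl2_bracket x y ⊗ a.
pose FV x (v : natV K) m : tensor_superspace (purely_even (natV K)) M := natV_act x v ⊗ m.
have [tS tV] := (tensor_bilin (purely_even (sl2 K)) J, tensor_bilin (purely_even (natV K)) M).
have bS x : bilin (FS x).
  split=> [a|y] k z z'; last exact: tS.2.
  by rewrite /FS (sl2_bracket_bilin K).2 tS.1.
have bV x : bilin (FV x).
  split=> [m|v] k z z'; last exact: tV.2.
  by rewrite /FV (natV_act_bilin K).2 tV.1.
have idl : linear (@id (sl2 K)) by move=> k x y.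
have linS : bilin (fun x t => tensor_lift (FS x) t).
  apply: (tensor_lift_bilin bS) => y a k x x'.
  by rewrite /FS (sl2_bracket_bilin K).1 tS.1.
have linV : bilin (fun x t => tensor_lift (FV x) t).
  apply: (tensor_lift_bilin bV) => v m k x x'.
  by rewrite /FV (natV_act_bilin K).1 tV.1.
have actE x (u : L) : act x u
    = TAG_inS T (tensor_lift (FS x) (TAG_prS u)) + TAG_inV T (tensor_lift (FV x) (TAG_prV u)).
  by apply: injective_projections; first apply: injective_projections;
    rewrite /= ?addr0 ?add0r.
have SS := bilin_comp linS (@TAG_inS_linear K J M T) idl (@TAG_prS_linear K J M T).
have VV := bilin_comp linV (@TAG_inV_linear K J M T) idl (@TAG_prV_linear K J M T).
split=> [u|x] k z z'; rewrite !actE.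
  by rewrite SS.1 VV.1 scalerDr addrACA.
by rewrite SS.2 VV.2 scalerDr addrACA.
Qed.

Let act_linear x : linear (act x) := short_action_bilin.2 x.

Lemma short_action_bracket x y (u : L) :
  act (sl2_bracket x y) u = act x (act y u) - act y (act x u).
Proof.
move: u; apply: TAG_eq => [||p u [z a _|v m _|q _]].
- exact: act_linear.
- move=> k u u'; rewrite !act_linear; module_coefs K; ring.
- rewrite !act_sl -TAG_slNl -TAG_slDl; congr (sl _ a).
  rewrite (sl2_bracket2l two_neq0) !(sl2_bracket2r two_neq0) (half_kappaC y x).
  by module_coefs K; ring.
- by rewrite !act_V -TAG_VNl -TAG_VDl (natV_act_bracket x y v).
- by rewrite !act_B; exact: (esym (subrr (0 : L))).
Qed.

Lemma short_action_homog x p (u : L) : homog p u -> homog p (act x u).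
Proof.
move/TAG_span; move: u; apply: (span_ind (P := fun u => homog p (act x u))).
  by rewrite (linear_0 (act_linear x)); exact: homog0.
move=> k u u' hu IH; rewrite act_linear; apply: homog_lin IH.
case: hu => [y a ha|v m hm|q _].
- by rewrite act_sl; exact: TAG_sl_homog.
- by rewrite act_V; exact: TAG_V_homog.
- by rewrite act_B; exact: homog0.
Qed.

Lemma short_action_derivation x (u u' : L) :
  act x (br u u') = br (act x u) u' + br u (act x u').
Proof.
have hL := act_linear x; have idl : linear (@id L) by move=> k z z'.
move: u u'; apply: TAG_eq2 => [||p p' u u' gu gu'].
- exact: (bilin_comp brb hL idl idl).
- exact: (bilin_add (bilin_comp brb idl hL idl) (bilin_comp brb idl idl hL)).
have hxu := short_action_homog x (TAG_gen_homog gu).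
have hxu' := short_action_homog x (TAG_gen_homog gu').
have flip : act x (br u' u) = br (act x u') u + br u' (act x u) ->
    act x (br u u') = br (act x u) u' + br u (act x u').
  move=> e; rewrite (TAG_br_anti two_neq0 (TAG_gen_homog gu) (TAG_gen_homog gu')).
  rewrite (TAG_br_anti two_neq0 hxu (TAG_gen_homog gu')).
  rewrite (TAG_br_anti two_neq0 (TAG_gen_homog gu) hxu').
  rewrite (linear_N hL) (linear_Z hL) e; module_coefs K; ring.
case: gu flip {hxu hxu'} => [y a _|v m _|q _]; case: gu' => [z b _|w n _|q' _] flip.
- rewrite !act_sl !(TAG_br_sl_sl T two_neq0) (linear_D hL) (linear_Z hL) act_sl act_B.
  move: (inB _) => q.
  rewrite (half_kappa_bracket y x z) (sl2_bracketC y x) (half_kappaNl two_neq0).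
  rewrite (sl2_bracket2l two_neq0) !(sl2_bracket2r two_neq0) (half_kappaC y x).
  by rewrite !(TAG_slDl, TAG_slNl, TAG_slZl); module_coefs K; ring.
- rewrite act_sl !act_V !(TAG_br_sl_V T two_neq0) act_V (natV_act_bracket x y w).
  by rewrite TAG_VDl TAG_VNl subrK.
- by apply: flip; rewrite !act_sl act_B (bilin0l brb) !(TAG_br_B_sl two_neq0) act_sl add0r.
- apply: flip; rewrite act_sl !act_V !(TAG_br_sl_V T two_neq0) act_V (natV_act_bracket x z v).
  by rewrite TAG_VDl TAG_VNl subrK.
- rewrite !act_V !(TAG_br_V_V T two_neq0) (linear_D hL) (linear_Z hL) act_sl act_B.
  rewrite (odotV_actl two_neq0) (odotV_actr two_neq0) detV_act.
  move: (inB _) (sl2_bracket _ _) => q y.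
  rewrite !(TAG_slZl, TAG_slDl, TAG_slNl); module_coefs K; by field.
- by apply: flip; rewrite !act_V act_B (bilin0l brb) !(TAG_br_B_V two_neq0) act_V add0r.
- by rewrite !act_sl act_B (bilin0l brb) !(TAG_br_B_sl two_neq0) act_sl add0r.
- by rewrite !act_V act_B (bilin0l brb) !(TAG_br_B_V two_neq0) act_V add0r.
- rewrite (TAG_br_B_B two_neq0) !act_B (bilin0l brb) (bilin0r brb).
  exact: (esym (addr0 (0 : L))).
Qed.

Lemma TAG_short_Lie : short_sl2_Lie_superalgebra br act.
Proof.
split; first exact: TAG_Lie_superalgebra.
  split; [exact: short_action_bilin|exact: short_action_bracket| |exact: short_action_derivation].
  by move=> x p u; exact: short_action_homog.
exists J, M, (Bs T), id; split; [by split=> // k u v| |by []].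
exact: (Bijective (g := id)).
Qed.

End Conclusion.

Local Open Scope complex_scope.

Theorem theorem4p11 (R : realType) (J M : superspace R[i])
    (T : ternary_superalgebra J M) :
  exists br : TAG T -> TAG T -> TAG T,
    [/\ TAG_bracket br,
        forall br', TAG_bracket br' -> forall u v, br' u v = br u v
      & short_sl2_Lie_superalgebra br (@short_action R[i] J M (Bs T))].
Proof.
have two_neq0 : 2 != 0 :> R[i] by rewrite pnatr_eq0.
exists (@TAG_br _ _ _ T); split.
- exact: TAG_br_bracket.
- by move=> br' hbr' u v; exact: TAG_bracket_unique hbr' (TAG_br_bracket T two_neq0) u v.
- exact: TAG_short_Lie.
Qed.
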